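(* Let $X$ be a complex manifold with a holomorphic foliation $\mathcal{F}$ of complex dimension $1$ with parabolic leaves, such that $X$ is either Kähler or has complex dimension $2$. Suppose that along a transverse holomorphic disk $D$ (parametrized by $x$) all the leaves are compact. If, for any $x$, $G_x$ denotes the fundamental group of the leaf $L_x$, then any continuous family $\gamma(x)\in G_x$, $x\in D$, depends holomorphically on $x$.
   Context: A leaf is parabolic if its universal covering is biholomorphic to $\mathbb{C}$. Let $n$ be the complex dimension of $X$. $D$ is an $(n-1)$-dimensional holomorphic disk transverse to $\mathcal{F}$, parametrized holomorphically by the unit ball $\mathbb{D}^{n-1}$ of $\mathbb{C}^{n-1}$, with which it is identified; $L_x$ is the leaf through the point $x\in D$. A holomorphic trivialization $x\mapsto t_x\in T_x\mathcal{F}$ of the tangent bundle $T\mathcal{F}$ of the foliation along $D$ is fixed. For each $x\in D$, $F_x:\mathbb{C}\to L_x$ is the unique holomorphic universal covering map with $F_x(0)=x$ and $dF_x(0)(1)=t_x$. Through $F_x$ the leaf is written $L_x=\mathbb{C}/G_x$, where $G_x\subset\mathbb{C}$ is the group (a lattice, as $L_x$ is compact) of all $\gamma\in\mathbb{C}$ with $F_x(y+\gamma)=F_x(y)$ for all $y$; this is how the fundamental group of $L_x$ is regarded as a subset of $\mathbb{C}$. Standing assumption: the map $F(x,y)=F_x(y)$ from $\mathbb{D}^{n-1}\times\mathbb{C}$ to $X$ is a smooth immersion. *)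

(* Defs.v *)
From HB Require Import structures.
From mathcomp Require Import all_boot all_order all_algebra.
From mathcomp Require Import all_classical all_reals all_analysis.
From mathcomp Require Import complex.

Set Implicit Arguments.
Unset Strict Implicit.
Unset Printing Implicit Defensive.

Import Order.TTheory GRing.Theory Num.Theory.
Import numFieldNormedType.Exports.

Local Open Scope classical_set_scope.
Local Open Scope ring_scope.

(* The regular module R[i]^o, not the bare R[i], carries the instances of a
   normed module over R[i]; [differentiable] between such modules is
   complex differentiability. *)
Notation Cx R := (R[i]^o) (only parsing).
Notation Cvec R n := 'rV[R[i]^o]_n (only parsing).

Definition unit_ball (R : realType) (m : nat) : set (Cvec R m) :=
  [set x | \sum_(j < m) `|(x 0 j : R[i])| ^+ 2 < 1].
Arguments unit_ball R m : clear implicits.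

(** * Real smoothness of maps between complex vector spaces *)

(* C^k = R^(2k), real parts first. *)
Definition toR (R : realType) k (z : Cvec R k) : 'rV[R]_(k + k) :=
  row_mx (\row_j complex.Re (z 0 j)) (\row_j complex.Im (z 0 j)).

Definition ofR (R : realType) k (x : 'rV[R]_(k + k)) : Cvec R k :=
  \row_j (Complex (lsubmx x 0 j) (rsubmx x 0 j)).

Definition realify (R : realType) p q (f : Cvec R p -> Cvec R q) :
    'rV[R]_(p + p) -> 'rV[R]_(q + q) :=
  fun x => toR (f (ofR x)).

(* [U] is meant to be open, the spaces finite-dimensional. *)
Fixpoint Ck_on (R : realType) (V W : normedModType R) (k : nat) (U : set V)
    (f : V -> W) : Prop :=
  if k is k'.+1 then
    (forall x, U x -> differentiable f x) /\
    (forall v, Ck_on k' U (fun x => 'D_v f x))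
  else forall x, U x -> {for x, continuous f}.

Definition smooth_on (R : realType) p q (U : set (Cvec R p))
    (f : Cvec R p -> Cvec R q) : Prop :=
  forall k, Ck_on k (@ofR R p @^-1` U) (realify f).

(** * Complex manifolds *)

(* Only the values of [cfun] on [cdom] and of [cinv] on [cfun @` cdom] are
   meaningful. *)
Record chart (R : realType) (X : topologicalType) (n : nat) := Chart {
  cdom : set X ;
  cfun :> X -> Cvec R n ;
  cinv : Cvec R n -> X ;
  cdom_open : open cdom ;
  cimg_open : open (cfun @` cdom) ;
  cfunK : forall p, cdom p -> cinv (cfun p) = p ;
  cfun_continuous : forall p, cdom p -> {for p, continuous cfun} ;
  cinv_continuous : forall p, cdom p -> {for cfun p, continuous cinv}
}.

Definition transition (R : realType) (X : topologicalType) n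
    (phi psi : chart R X n) : Cvec R n -> Cvec R n :=
  psi \o cinv phi.

Definition holo_compatible (R : realType) (X : topologicalType) n
    (phi psi : chart R X n) : Prop :=
  forall p, cdom phi p -> cdom psi p ->
    differentiable (transition phi psi) (phi p).

Record complex_manifold (R : realType) (X : topologicalType) (n : nat) :=
  ComplexManifold {
  cm_hausdorff : hausdorff_space X ;
  cm_second_countable : @second_countable X ;
  atlas : set (chart R X n) ;
  atlas_cover : forall p, exists2 phi, atlas phi & cdom phi p ;
  atlas_compatible : forall phi psi, atlas phi -> atlas psi ->
    holo_compatible phi psi
}.

Definition max_atlas (R : realType) (X : topologicalType) n
    (M : complex_manifold R X n) : set (chart R X n) :=
  [set phi | forall psi, atlas M psi ->
     holo_compatible phi psi /\ holo_compatible psi phi].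

Definition holomorphic_map (R : realType) (X : topologicalType) n
    (M : complex_manifold R X n) (V : normedModType R[i])
    (U : set V) (f : V -> X) : Prop :=
  forall x, U x -> {for x, continuous f} /\
    forall phi, max_atlas M phi -> cdom phi (f x) ->
      differentiable (phi \o f) x.

Definition smooth_immersion (R : realType) (X : topologicalType) n
    (M : complex_manifold R X n) p (U : set (Cvec R p))
    (f : Cvec R p -> X) : Prop :=
  [/\ forall x, U x -> {for x, continuous f},
      forall phi, max_atlas M phi ->
        smooth_on (U `&` f @^-1` cdom phi) (phi \o f)
    & forall phi x, max_atlas M phi -> U x -> cdom phi (f x) ->
        injective ('d (realify (phi \o f)) (toR x))].

(* A tangent vector at [p] is the family of its coordinates in the charts
   around [p]; the values at other charts are irrelevant. *)
Definition tangent_vector (R : realType) (X : topologicalType) n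
    (M : complex_manifold R X n) (p : X) (v : chart R X n -> Cvec R n) : Prop :=
  forall phi psi, max_atlas M phi -> max_atlas M psi ->
    cdom phi p -> cdom psi p ->
    v psi = 'd (transition phi psi) (phi p) (v phi).

(** * Kaehler metrics *)

Definition herm_form (R : realType) n (g : 'M[R[i]^o]_n) (u v : Cvec R n) :
    R[i] :=
  \sum_(j < n) \sum_(k < n) u 0 j * g j k * conjc (v 0 k).

(* The associated real (1,1)-form. *)
Definition fund_form (R : realType) n (g : 'M[R[i]^o]_n) (u v : Cvec R n) : R :=
  - complex.Im (herm_form g u v).

(* d omega = 0, evaluated on constant vector fields u, v, w: their brackets
   vanish, so only the three derivative terms of d omega(u, v, w) remain. *)
Definition closed_fund_form (R : realType) n (U : set (Cvec R n))
    (g : Cvec R n -> 'M[R[i]^o]_n) : Prop :=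
  let dd u v w z :=
    'D_(toR u) (fun x => fund_form (g (ofR x)) v w) (toR z) : R in
  forall z u v w, U z -> dd u v w z + dd v w u z + dd w u v z = 0.

(* [g phi z] is the Gram matrix of the metric in the chart [phi] at the point
   of coordinates [z]. *)
Definition kahler_metric (R : realType) (X : topologicalType) n
    (M : complex_manifold R X n)
    (g : chart R X n -> Cvec R n -> 'M[R[i]^o]_n) : Prop :=
  [/\ forall phi, max_atlas M phi ->
        smooth_on (phi @` cdom phi) (fun z => mxvec (g phi z)),
      forall phi p, max_atlas M phi -> cdom phi p ->
        (forall u v, herm_form (g phi (phi p)) v u
                     = conjc (herm_form (g phi (phi p)) u v)) /\
        (forall u, u != 0 -> 0 < herm_form (g phi (phi p)) u u),
      forall phi psi p, max_atlas M phi -> max_atlas M psi ->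
        cdom phi p -> cdom psi p -> forall u v,
        herm_form (g psi (psi p)) ('d (transition phi psi) (phi p) u)
                                  ('d (transition phi psi) (phi p) v)
        = herm_form (g phi (phi p)) u v
    & forall phi, max_atlas M phi ->
        closed_fund_form (phi @` cdom phi) (g phi)].

Definition kahler (R : realType) (X : topologicalType) n
    (M : complex_manifold R X n) : Prop :=
  exists g, kahler_metric M g.

(** * Holomorphic foliations of dimension 1 *)

(* In C^(m+1) = C^m x C the first factor is transverse, the second one is
   tangent to the leaves. *)
Definition transv (R : realType) m (z : Cvec R (m + 1)) : Cvec R m := lsubmx z.

(* The changes of foliated coordinates have the form
   (w, s) |-> (h(w), k(w, s)); [h] is then automatically holomorphic because
   the change of coordinates is. *)
Record foliation (R : realType) (X : topologicalType) (m : nat)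
    (M : complex_manifold R X (m + 1)) := Foliation {
  fol_atlas : set (chart R X (m + 1)) ;
  fol_atlas_sub : fol_atlas `<=` max_atlas M ;
  fol_atlas_cover : forall p, exists2 phi, fol_atlas phi & cdom phi p ;
  fol_atlas_compatible : forall phi psi p, fol_atlas phi -> fol_atlas psi ->
    cdom phi p -> cdom psi p ->
    exists h : Cvec R m -> Cvec R m,
      \forall q \near p, transv (psi q) = h (transv (phi q))
}.

(* The leaf topology on X: its open sets are the unions of open subsets of
   plaques. *)
Definition leaf_open (R : realType) (X : topologicalType) m
    (M : complex_manifold R X (m + 1)) (fol : foliation M) (A : set X) : Prop :=
  forall phi p, fol_atlas fol phi -> cdom phi p -> A p ->
    \forall q \near p, transv (phi q) = transv (phi p) -> A q.

Lemma leaf_openT (R : realType) (X : topologicalType) m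
    (M : complex_manifold R X (m + 1)) (fol : foliation M) :
  leaf_open fol setT.
Proof. by move=> phi p _ _ _; apply: filterE. Qed.

Lemma leaf_openI (R : realType) (X : topologicalType) m
    (M : complex_manifold R X (m + 1)) (fol : foliation M) :
  setI_closed (leaf_open fol).
Proof.
move=> A B oA oB phi p fphi dp [Ap Bp].
apply: filterS2 (oA _ _ fphi dp Ap) (oB _ _ fphi dp Bp) => q Aq Bq e.
by split; [exact: Aq | exact: Bq].
Qed.

Lemma leaf_open_bigU (R : realType) (X : topologicalType) m
    (M : complex_manifold R X (m + 1)) (fol : foliation M)
    (I : Type) (f : I -> set X) :
  (forall i, leaf_open fol (f i)) -> leaf_open fol (\bigcup_i f i).
Proof.
move=> of_ phi p fphi dp [i _ fip].
by apply: filterS (of_ i _ _ fphi dp fip) => q fq e; exists i => //; exact: fq.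
Qed.

Definition leafspace (R : realType) (X : topologicalType) m
    (M : complex_manifold R X (m + 1)) (fol : foliation M) : Type := X.

HB.instance Definition _ (R : realType) (X : topologicalType) m
    (M : complex_manifold R X (m + 1)) (fol : foliation M) :=
  Choice.copy (leafspace fol) X.
HB.instance Definition _ (R : realType) (X : topologicalType) m
    (M : complex_manifold R X (m + 1)) (fol : foliation M) :=
  isOpenTopological.Build (leafspace fol)
    (@leaf_openT R X m M fol) (@leaf_openI R X m M fol) (@leaf_open_bigU R X m M fol).

Definition leaf (R : realType) (X : topologicalType) m
    (M : complex_manifold R X (m + 1)) (fol : foliation M) (p : X) :
    set (leafspace fol) :=
  connected_component [set: leafspace fol] (p : leafspace fol).
Arguments leaf {R X m M} fol p.

Definition covering_onto (T U : topologicalType) (f : T -> U) (L : set U) :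
    Prop :=
  [/\ continuous f, range f = L
    & forall p, L p -> exists V : set U, [/\ open V, V p, V `<=` L
      & exists (I : Type) (W : I -> set T),
        [/\ forall i, open (W i), trivIset setT W,
            \bigcup_i W i = f @^-1` V
          & forall i, [/\ {in W i &, injective f}, f @` W i = V
              & forall O, open O -> O `<=` W i -> open (f @` O)]]]].

(* C being simply connected, such a covering is universal.  A map into X that
   is continuous for the leaf topology is holomorphic as a map into the leaf iff
   it is holomorphic as a map into X. *)
Definition leaf_uniformization (R : realType) (X : topologicalType) m
    (M : complex_manifold R X (m + 1)) (fol : foliation M) (p : X)
    (f : Cx R -> X) : Prop :=
  covering_onto (f : Cx R -> leafspace fol) (leaf fol p) /\
  holomorphic_map M [set: Cx R] f.

Definition parabolic_leaves (R : realType) (X : topologicalType) m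
    (M : complex_manifold R X (m + 1)) (fol : foliation M) : Prop :=
  forall p, exists f, leaf_uniformization fol p f.

Definition leaf_tangent (R : realType) (X : topologicalType) m
    (M : complex_manifold R X (m + 1)) (fol : foliation M) (p : X)
    (v : chart R X (m + 1) -> Cvec R (m + 1)) : Prop :=
  tangent_vector M p v /\
  forall phi, fol_atlas fol phi -> cdom phi p -> transv (v phi) = 0.

(** * Transverse disks *)

(* A holomorphic embedding [iota] of the unit ball, together with
   T_x D + T_x F = T_x X in foliated coordinates. *)
Definition transverse_disk (R : realType) (X : topologicalType) m
    (M : complex_manifold R X (m + 1)) (fol : foliation M)
    (iota : Cvec R m -> X) : Prop :=
  let B := unit_ball R m in
  [/\ holomorphic_map M B iota,
      {in B &, injective iota},
      forall V, open V -> V `<=` B ->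
        exists2 W : set X, open W & iota @` V = W `&` iota @` B,
      forall phi x, max_atlas M phi -> B x -> cdom phi (iota x) ->
        injective ('d (phi \o iota) x)
    & forall phi x, fol_atlas fol phi -> B x -> cdom phi (iota x) ->
        forall u, exists v w, transv w = 0 /\ u = 'd (phi \o iota) x v + w].

Definition leaf_trivialization (R : realType) (X : topologicalType) m
    (M : complex_manifold R X (m + 1)) (fol : foliation M)
    (iota : Cvec R m -> X)
    (t : Cvec R m -> chart R X (m + 1) -> Cvec R (m + 1)) : Prop :=
  forall x, unit_ball R m x ->
    leaf_tangent fol (iota x) (t x) /\
    forall phi, max_atlas M phi -> cdom phi (iota x) ->
      t x phi != 0 /\ differentiable (fun x' => t x' phi) x.

Definition period_group (R : realType) (X : Type) (f : Cx R -> X) :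
    set (Cx R) :=
  [set c | forall y, f (y + c) = f y].
Arguments period_group {R X} f.

Definition family_map (R : realType) (X : Type) m
    (F : Cvec R m -> Cx R -> X) : Cvec R (m + 1) -> X :=
  fun z => F (lsubmx z) (rsubmx z 0 0).

Definition ball_times_C (R : realType) m : set (Cvec R (m + 1)) :=
  [set z | unit_ball R m (lsubmx z)].
Arguments ball_times_C R m : clear implicits.

(* Main.v *)
(* In a chart of X write F(x, y) as G(x, y), and let dbar G be the
   antiholomorphic derivative in x.  The transverse part of G does not depend
   on y and is holomorphic at y = 0, so dbar G is tangent to the leaves, that
   is, dbar G = alpha(x, y) dG/dy with alpha entire in y.  As F(x, 0) = x and
   dF_x(0)(1) = t_x are holomorphic in x, alpha vanishes to order 2 at y = 0.

   A continuous family c(x) of periods is differentiable by the implicit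
   function theorem applied to F(x, y + c(x)) = F(x, y), and differentiating
   this identity gives alpha(x, y) = alpha(x, y + c(x)) + dbar c(x).  Where two
   R-independent continuous families of periods exist locally, alpha(x, .)
   therefore grows at most linearly, and Liouville's theorem gives
   alpha(x, .) = 0.  The groups G_x being lattices, whose union over x is
   closed, Baire's theorem provides such families near a dense set of x, and
   alpha = 0 everywhere by continuity.  The same identity with c = gamma then
   says that dbar gamma = 0. *)

From HB Require Import structures.
Require Import Defs.
From mathcomp Require Import all_boot all_order all_algebra.
From mathcomp Require Import all_classical all_reals all_analysis.
From mathcomp Require Import complex ring lra.

Set Implicit Arguments.
Unset Strict Implicit.
Unset Printing Implicit Defensive.

Import Order.TTheory GRing.Theory Num.Theory.
Import numFieldNormedType.Exports.

Local Open Scope classical_set_scope.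
Local Open Scope ring_scope.

(** * Complex functions of one complex variable *)

(** The joint smoothness of F, and not only the holomorphy of each F_x, feeds the one-variable
    function theory: a smooth map satisfying the Cauchy-Riemann equation in y has at every point an
    expansion of order 2 in y ([taylor2]). This class is stable under sums, products and quotients,
    and it suffices for a maximum principle, because summing over the four points z0 + i^k t cancels
    the terms of degree 1 and the holomorphic terms of degree 2. Liouville's theorem follows from
    that, without Cauchy's formula or power series.

    Compactness of a leaf does not give a lattice at once: it only yields pairs with F_x(y) =
    F_x(z), and such a pair has to make y - z a period. Hence deck transformations are built by
    lifting and shown to be translations.

    Independent families come from far targets: if every point of the plane is within N of G_x, the
    periods chosen within N of 4N and of 4Ni are independent over R. As N depends on x, the
    countable cover in Baire's theorem is indexed by an integer bound and by small rational discs,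
    in which a period is unique because periods are uniformly separated near x. *)

Section Modulus.
Variable R : realType.
Implicit Types z w : R[i].

(** Real-valued, because the norm of [R[i]] lives in [R[i]], whose order is partial; inequalities
    between moduli can then be left to [lra]. *)
Definition cmod z : R := complex.Re `|z|.

Lemma normcmod z : `|z| = (cmod z)%:C%C.
Proof. by rewrite /cmod normc_def. Qed.

Lemma cmod_ge0 z : 0 <= cmod z.
Proof. by rewrite -ler0c -normcmod. Qed.
Hint Resolve cmod_ge0 : core.

Lemma cmodM z w : cmod (z * w) = cmod z * cmod w.
Proof. by apply: complexI; rewrite rmorphM -!normcmod normrM. Qed.

Lemma cmodD z w : cmod (z + w) <= cmod z + cmod w.
Proof. by rewrite -lecR rmorphD -!normcmod ler_normD. Qed.

Lemma cmodN z : cmod (- z) = cmod z.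
Proof. by rewrite /cmod normrN. Qed.

Lemma cmodB z w : cmod (z - w) <= cmod z + cmod w.
Proof. by rewrite -(cmodN w) cmodD. Qed.

Lemma cmod_distC z w : cmod (z - w) = cmod (w - z).
Proof. by rewrite /cmod distrC. Qed.

Lemma cmod_dist z w : `|cmod z - cmod w| <= cmod (z - w).
Proof.
have := cmodD (z - w) w; have := cmodD (w - z) z; rewrite !subrK => h1 h2.
by rewrite (cmod_distC w z) in h1; rewrite ler_norml; lra.
Qed.

Lemma cmod0 : cmod 0 = 0.
Proof. by rewrite /cmod normr0. Qed.

Lemma cmod_eq0 z : (cmod z == 0) = (z == 0).
Proof. by rewrite -(normr_eq0 z) normcmod fmorph_eq0. Qed.

Lemma cmod_gt0 z : (0 < cmod z) = (z != 0).
Proof. by rewrite lt_def cmod_eq0 cmod_ge0 andbT. Qed.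

Lemma cmodV z : cmod z^-1 = (cmod z)^-1.
Proof. by apply: complexI; rewrite fmorphV -!normcmod normfV. Qed.

Lemma cmodX z n : cmod (z ^+ n) = cmod z ^+ n.
Proof. by apply: complexI; rewrite [RHS]rmorphXn /= -!normcmod normrX. Qed.

Lemma cmod_sqr z : cmod z ^+ 2 = complex.Re z ^+ 2 + complex.Im z ^+ 2.
Proof. by apply: complexI; rewrite add_Re2_Im2 normcmod -rmorphXn. Qed.

Lemma Re_le_cmod z : `|complex.Re z| <= cmod z.
Proof. by rewrite -lecR -normcmod normc_ge_Re. Qed.

Lemma Im_le_cmod z : `|complex.Im z| <= cmod z.
Proof.
rewrite -(@ler_pXn2r _ 2) ?nnegrE ?normr_ge0 // cmod_sqr real_normK ?num_real //.
by rewrite lerDr sqr_ge0.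
Qed.

Lemma cmodC (x : R) : cmod x%:C%C = `|x|.
Proof.
apply/eqP; rewrite -(@eqrXn2 _ 2) // cmod_sqr /= expr0n addr0.
by rewrite real_normK ?num_real.
Qed.

Lemma cmodi : cmod 'i%C = 1.
Proof.
apply/eqP; rewrite -(@eqrXn2 _ 2) // cmod_sqr /=.
by rewrite expr0n add0r expr1n.
Qed.

Lemma cmod_le_ReIm z : cmod z <= `|complex.Re z| + `|complex.Im z|.
Proof.
rewrite {1}[z]complexE; apply: (le_trans (cmodD _ _)).
by rewrite cmodM cmodi mul1r !cmodC.
Qed.

Lemma nbhs_cmodP (z : Cx R) (A : set (Cx R)) :
  nbhs z A <-> exists2 d, 0 < d & forall w, cmod (w - z) < d -> A w.
Proof.
split=> [/nbhs_ballP[e /= e0 eA]|[d d0 dA]].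
  have [e1 e2] : 0 < complex.Re e /\ e = (complex.Re e)%:C%C.
    move: e0; rewrite ltcE /= => /andP[/eqP ie re]; split=> //.
    by rewrite {1}[e]complexE ie mulr0 addr0.
  exists (complex.Re e) => // w wz; apply: eA.
  by rewrite -ball_normE /= e2 normcmod ltcR cmod_distC.
apply/nbhs_ballP; exists d%:C%C => /=; first by rewrite ltcR.
by move=> w; rewrite -ball_normE /= normcmod ltcR cmod_distC => /dA.
Qed.

Lemma near_cmod (z : Cx R) (d : R) : 0 < d ->
  \forall w \near z, cmod (w - z) < d.
Proof. by move=> d0; apply/nbhs_cmodP; exists d. Qed.

Lemma cmod_continuous (z : Cx R) : {for z, continuous (fun w : Cx R => cmod w)}.
Proof.
apply/(@cvgrPdist_lt _ R _ (nbhs z) _ (fun w : Cx R => cmod w) (cmod z)) => e e0.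
apply: filterS (near_cmod z e0) => w; apply: le_lt_trans.
by rewrite (le_trans (cmod_dist _ _)) // cmod_distC.
Qed.

Lemma continuous_cmodP (T : topologicalType) (f : T -> Cx R) (x : T) :
  {for x, continuous f} <->
  forall e, 0 < e -> \forall y \near x, cmod (f y - f x) < e.
Proof.
split=> [cf e e0|H].
  exact: (cf _ (near_cmod (f x) e0)).
move=> A /nbhs_cmodP[d d0 dA].
by apply: (filterS _ (H d d0)) => y /dA.
Qed.

End Modulus.
#[export] Hint Resolve cmod_ge0 : core.

Section ContinuousFor.
Variables (R : realType) (T : topologicalType).
Implicit Types (f g : T -> Cx R) (x : T).

Lemma cfor_cst (a : Cx R) x : {for x, continuous (fun=> a : Cx R)}.
Proof. exact: cst_continuous. Qed.

Lemma cfor_id (x : Cx R) : {for x, continuous (fun w : Cx R => w)}.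
Proof. exact: cvg_id. Qed.

Lemma cforD f g x : {for x, continuous f} -> {for x, continuous g} ->
  {for x, continuous (fun w => f w + g w)}.
Proof. exact: (@continuousD _ (Cx R) T). Qed.

Lemma cforN f x : {for x, continuous f} -> {for x, continuous (fun w => - f w)}.
Proof. exact: (@continuousN _ (Cx R) T). Qed.

Lemma cforM f g x : {for x, continuous f} -> {for x, continuous g} ->
  {for x, continuous (fun w => f w * g w)}.
Proof. exact: (@continuousM _ T). Qed.

Lemma cforX f x n : {for x, continuous f} ->
  {for x, continuous (fun w => f w ^+ n)}.
Proof.
move=> cf; elim: n => [|n IH].
  have -> : (fun w => f w ^+ 0) = (fun=> 1).
    by apply/funext => w; rewrite expr0.
  exact: cfor_cst.
have -> : (fun w => f w ^+ n.+1) = (fun w => f w * f w ^+ n).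
  by apply/funext => w; rewrite exprS.
exact: cforM.
Qed.

Lemma cfor_cmod f x : {for x, continuous f} ->
  {for x, continuous (fun w => cmod (f w))}.
Proof. by move=> cf; apply: (continuous_comp cf); exact: cmod_continuous. Qed.

End ContinuousFor.

Ltac ccont := repeat lazymatch goal with
  | |- prop_for _ (inPhantom (continuous ?f)) =>
    lazymatch f with
    | (fun=> ?c) => exact: cfor_cst
    | (fun w => w) => exact: cfor_id
    | (fun w => @?a w + @?b w) => refine (@cforD _ _ a b _ _ _)
    | (fun w => - @?a w) => refine (@cforN _ _ a _ _)
    | (fun w => @?a w * @?b w) => refine (@cforM _ _ a b _ _ _)
    | (fun w => @?a w ^+ ?n) => refine (@cforX _ _ a _ n _)
    | _ => assumption
    end
  end.

Section Disc.
Variable R : realType.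

Lemma Complex_continuous (T : topologicalType) (f g : T -> R) (x : T) :
  {for x, continuous f} -> {for x, continuous g} ->
  {for x, continuous (fun t => Complex (f t) (g t) : Cx R)}.
Proof.
move=> fc gc; apply/continuous_cmodP => e e0.
have e2 : 0 < e / 2 by rewrite divr_gt0.
have H (h : T -> R) : {for x, continuous h} ->
    nbhs x (fun t => `|h t - h x| < e / 2).
  by move=> /cvgrPdistC_lt/(_ _ e2).
apply: filterS2 (H _ fc) (H _ gc) => t h1 h2.
by apply: (le_lt_trans (cmod_le_ReIm _)) => /=; lra.
Qed.

Lemma disc_closed (c : Cx R) (r : R) : closed [set z : Cx R | cmod (z - c) <= r].
Proof.
apply: (@closed_comp _ _ (fun z : Cx R => cmod (z - c)) [set x | x <= r]).
  move=> z _; refine (@cfor_cmod _ _ (fun w : Cx R => w - c) _ _).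
  by ccont.
exact: closed_le.
Qed.

(** A closed disc is a closed subset of the continuous image of a square in [R * R]. *)
Lemma disc_compact (c : Cx R) (r : R) : compact [set z : Cx R | cmod (z - c) <= r].
Proof.
pose g (p : R * R) : Cx R := Complex p.1 p.2 + c.
apply: (@subclosed_compact _ _ (g @` (`[- r, r] `*` `[- r, r]))).
- exact: disc_closed.
- apply: continuous_compact; last by apply: compact_setX; exact: segment_compact.
  apply: continuous_subspaceT => p; apply: cforD; last exact: cfor_cst.
  by apply: Complex_continuous; [exact: cvg_fst|exact: cvg_snd].
- move=> z /= zr; exists (complex.Re (z - c), complex.Im (z - c)) => /=.
    have := Re_le_cmod (z - c); have := Im_le_cmod (z - c).
    by rewrite !ler_norml !in_itv /= => h1 h2; split; lra.
  by rewrite /g /=; move: (z - c) (subrK c z) => [a b] /= <-.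
Qed.

Lemma disc_max (f : Cx R -> R) (c : Cx R) (r : R) : 0 <= r ->
  (forall z : Cx R, cmod (z - c) <= r -> {for z, continuous f}) ->
  exists2 z0 : Cx R, cmod (z0 - c) <= r &
    forall w : Cx R, cmod (w - c) <= r -> f w <= f z0.
Proof.
move=> r0 fc.
have [||z0 z0r zmax] := compact_EVT_max (f := f) _ (@disc_compact c r).
- by exists c; rewrite /= subrr cmod0.
- apply: continuous_in_subspaceT => z; rewrite inE; exact: fc.
exists z0; first by move: z0r; rewrite inE.
by move=> w wr; apply: zmax; rewrite inE.
Qed.

End Disc.

Section NearContinuous.
Variable R : realType.
Implicit Types (f g : R[i] -> R[i]) (z w : R[i]) (P Q : R[i] -> Prop).

(* Neighbourhoods and continuity on [R[i]] in terms of the real-valued modulus;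
   see [nbhs_cmodP] and [cctsP] for the comparison with the topology of
   [R[i]^o]. *)
Definition cnear z P := exists2 d : R, 0 < d & forall w, cmod (w - z) < d -> P w.

Definition ccts f z :=
  forall e : R, 0 < e -> cnear z (fun w => cmod (f w - f z) < e).

Lemma cnearW z P : (forall w, P w) -> cnear z P.
Proof. by move=> H; exists 1. Qed.

Lemma cnearI z P Q : cnear z P -> cnear z Q -> cnear z (fun w => P w /\ Q w).
Proof.
move=> [d d0 dP] [e e0 eQ]; exists (Order.min d e); first by rewrite lt_min d0.
by move=> w; rewrite lt_min => /andP[/dP ? /eQ].
Qed.

Lemma cnearS z P Q : (forall w, P w -> Q w) -> cnear z P -> cnear z Q.
Proof. by move=> PQ [d d0 dP]; exists d => // w /dP/PQ. Qed.

Lemma cnearS2 z P Q (S : R[i] -> Prop) :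
  (forall w, P w -> Q w -> S w) -> cnear z P -> cnear z Q -> cnear z S.
Proof. by move=> PQ zP zQ; apply: cnearS (cnearI zP zQ) => w [/PQ]. Qed.

Lemma cnear_self z P : cnear z P -> P z.
Proof. by move=> [d d0]; apply; rewrite subrr cmod0. Qed.

Lemma cnear_disc z (e : R) : 0 < e -> cnear z (fun w => cmod (w - z) < e).
Proof. by exists e. Qed.

Lemma cnear0 z P : cnear z P -> cnear 0 (fun h => P (z + h)).
Proof.
move=> [d d0 dP]; exists d => // w; rewrite subr0 => wd.
by apply: dP; rewrite addrC addKr.
Qed.

Lemma cnearB z P : cnear 0 P -> cnear z (fun w => P (w - z)).
Proof. by move=> [d d0 dP]; exists d => // w wd; apply: dP; rewrite subr0. Qed.

Lemma cctsP f z : {for (z : Cx R), continuous (f : Cx R -> Cx R)} <-> ccts f z.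
Proof.
split=> [/continuous_cmodP H e /H/nbhs_cmodP//|H].
by apply/continuous_cmodP => e /H /nbhs_cmodP.
Qed.

Lemma ccts_cst a z : ccts (fun=> a) z.
Proof. by move=> e e0; apply: cnearW => w; rewrite subrr cmod0. Qed.

Lemma ccts_id z : ccts (fun w => w) z.
Proof. by move=> e; exact: cnear_disc. Qed.

Lemma cctsD f g z : ccts f z -> ccts g z -> ccts (fun w => f w + g w) z.
Proof.
move=> fc gc e e0; have e2 : 0 < e / 2 by rewrite divr_gt0.
apply: cnearS2 (fc _ e2) (gc _ e2) => w h1 h2.
rewrite opprD addrACA (le_lt_trans (cmodD _ _)) //; lra.
Qed.

Lemma cctsM f g z : ccts f z -> ccts g z -> ccts (fun w => f w * g w) z.
Proof.
move=> fc gc e e0.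
have [F0 G0] : 0 < cmod (f z) + 1 /\ 0 < cmod (g z) + 1.
  by have := cmod_ge0 (f z); have := cmod_ge0 (g z); split; lra.
have e1 : 0 < e / (2 * (cmod (g z) + 1)) by rewrite divr_gt0 // mulr_gt0.
have e2 : 0 < e / (2 * (cmod (f z) + 1)) by rewrite divr_gt0 // mulr_gt0.
apply: cnearS2 (cnearI (fc _ e1) (gc _ ltr01)) (gc _ e2) => w [h1 h3] h2.
have -> : f w * g w - f z * g z = (f w - f z) * g w + f z * (g w - g z) by ring.
apply: le_lt_trans (cmodD _ _) _; rewrite !cmodM.
have h4 : cmod (g w) < cmod (g z) + 1.
  by have := cmodD (g w - g z) (g z); rewrite subrK; lra.
have h5 : cmod (f w - f z) * cmod (g w) <= e / 2.
  have -> : e / 2 = e / (2 * (cmod (g z) + 1)) * (cmod (g z) + 1).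
    by field; exact: lt0r_neq0.
  by apply: ler_pM; rewrite ?cmod_ge0 ?ltW.
have h6 : cmod (f z) * cmod (g w - g z) < e / 2.
  have -> : e / 2 = (cmod (f z) + 1) * (e / (2 * (cmod (f z) + 1))).
    by field; exact: lt0r_neq0.
  apply: le_lt_trans (_ : (cmod (f z) + 1) * cmod (g w - g z) < _).
    by apply: ler_wpM2r; rewrite ?cmod_ge0 ?lerDl.
  by rewrite ltr_pM2l.
lra.
Qed.

Lemma cctsN f z : ccts f z -> ccts (fun w => - f w) z.
Proof.
by move=> fc e /fc; apply: cnearS => w; rewrite -opprD cmodN.
Qed.

Lemma cctsX f z n : ccts f z -> ccts (fun w => f w ^+ n) z.
Proof.
move=> fc; elim: n => [|n IH].
  have -> : (fun w => f w ^+ 0) = (fun=> 1) by apply/funext => w; rewrite expr0.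
  exact: ccts_cst.
have -> : (fun w => f w ^+ n.+1) = (fun w => f w * f w ^+ n).
  by apply/funext => w; rewrite exprS.
exact: cctsM.
Qed.

Lemma ccts_near f z P : ccts f z -> cnear (f z) P -> cnear z (fun w => P (f w)).
Proof. by move=> fc [d d0 dP]; apply: cnearS (fc d d0) => w /dP. Qed.

Lemma ccts_comp f g z : ccts f z -> ccts g (f z) -> ccts (fun w => g (f w)) z.
Proof. by move=> fc gc e e0; exact: (ccts_near fc (gc e e0)). Qed.

Lemma ccts_neq0 f z : ccts f z -> f z != 0 -> cnear z (fun w => f w != 0).
Proof.
rewrite -cmod_gt0 => fc fz; apply: cnearS (fc _ fz) => w.
by apply: contraTneq => ->; rewrite sub0r cmodN ltxx.
Qed.

Lemma cctsV f z : f z != 0 -> ccts f z -> ccts (fun w => (f w)^-1) z.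
Proof.
move=> z0 fc e e0; have a0 : 0 < cmod (f z) by rewrite cmod_gt0.
have e1 : 0 < e * (cmod (f z) ^+ 2 / 2) by rewrite mulr_gt0 // divr_gt0 // exprn_gt0.
have e2 : 0 < cmod (f z) / 2 by rewrite divr_gt0.
apply: cnearS2 (cnearI (fc _ e1) (fc _ e2)) (ccts_neq0 fc z0) => w [h1 h2] nz.
have -> : (f w)^-1 - (f z)^-1 = (f z - f w) / (f w * f z).
  by field; rewrite nz z0.
have h3 : cmod (f z) / 2 < cmod (f w).
  have := cmodD (f z - f w) (f w); rewrite subrK cmod_distC; lra.
rewrite cmodM cmodV cmod_distC cmodM ltr_pdivrMr ?mulr_gt0 ?cmod_gt0 //.
apply: lt_trans h1 _; rewrite ltr_pM2l // expr2 mulrAC ltr_pM2r //.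

Qed.

End NearContinuous.

Ltac ccts_tac := repeat lazymatch goal with
  | |- ccts ?f _ =>
    lazymatch f with
    | (fun=> ?c) => exact: ccts_cst
    | (fun w => w) => exact: ccts_id
    | (fun w => @?a w + @?b w) => refine (@cctsD _ a b _ _ _)
    | (fun w => - @?a w) => refine (@cctsN _ a _ _)
    | (fun w => @?a w * @?b w) => refine (@cctsM _ a b _ _ _)
    | (fun w => @?a w ^+ ?n) => refine (@cctsX _ a _ n _)
    | _ => assumption
    end
  end.

(** * Complex expansions of order 2 *)

Section Taylor2.
Variable R : realType.
Implicit Types (f g : R[i] -> R[i]) (z : R[i]).

(* [f (z + h) = f z + b h + c h^2 + o(h^2)], with [kap] the quotient of the
   last two terms by [h^2]. *)
Definition taylor2_at f z b := exists kap : R[i] -> R[i],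
  ccts kap 0 /\
  cnear 0 (fun h => f (z + h) = f z + b * h + h ^+ 2 * kap h).

Definition taylor2 f z := exists b, taylor2_at f z b.

Lemma taylor2_cst (a : R[i]) z : taylor2 (fun=> a) z.
Proof.
exists 0, (fun=> 0); split; first exact: ccts_cst.
by apply: cnearW => h; rewrite mul0r mulr0 !addr0.
Qed.

Lemma taylor2_id z : taylor2 id z.
Proof.
exists 1, (fun=> 0); split; first exact: ccts_cst.
by apply: cnearW => h; rewrite mul1r mulr0 addr0.
Qed.

Lemma taylor2D f g z : taylor2 f z -> taylor2 g z ->
  taylor2 (fun w => f w + g w) z.
Proof.
move=> [b [k [kc fk]]] [b' [k' [kc' gk]]].
exists (b + b'), (fun h => k h + k' h); split; first by ccts_tac.
by apply: cnearS2 fk gk => h -> ->; ring.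
Qed.

Lemma taylor2M f g z : taylor2 f z -> taylor2 g z ->
  taylor2 (fun w => f w * g w) z.
Proof.
move=> [b [k [kc fk]]] [b' [k' [kc' gk]]].
exists (f z * b' + b * g z), (fun h => f z * k' h + g z * k h + b * b' +
  h * (b * k' h + b' * k h) + h ^+ 2 * (k h * k' h)); split; last first.
  by apply: cnearS2 fk gk => h -> ->; ring.
ccts_tac.
Qed.

Lemma taylor2_at_lin f g z a b c : taylor2_at f z b -> taylor2_at g z c ->
  taylor2_at (fun w => f w + a * g w) z (b + a * c).
Proof.
move=> [k [kc fk]] [k' [kc' gk]].
exists (fun h => k h + a * k' h); split; first by ccts_tac.
by apply: cnearS2 fk gk => h -> ->; ring.
Qed.

Lemma taylor2N f z : taylor2 f z -> taylor2 (fun w => - f w) z.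
Proof.
move=> /(taylor2M (taylor2_cst (-1) z)).
by congr (taylor2 _ z); apply/funext => w; rewrite mulN1r.
Qed.

Lemma taylor2X f z n : taylor2 f z -> taylor2 (fun w => f w ^+ n) z.
Proof.
move=> fz; elim: n => [|n IH].
  by under eq_fun do rewrite expr0; exact: taylor2_cst.
by under eq_fun do rewrite exprS; exact: taylor2M.
Qed.

Lemma taylor2_continuous f z : taylor2 f z -> ccts f z.
Proof.
move=> [b [k [kc fk]]] e e0.
have c0 : ccts (fun h => f z + b * h + h ^+ 2 * k h) 0 by ccts_tac.
have := cnearB z (cnearI (c0 e e0) fk); apply: cnearS => w.
by rewrite mulr0 addr0 expr0n mul0r addr0 [z + _]addrC subrK => -[+ ->].
Qed.

Lemma taylor2V f z : f z != 0 -> taylor2 f z -> taylor2 (fun w => (f w)^-1) z.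
Proof.
move=> fz0 f2; have fc := taylor2_continuous f2.
move: f2 => [b [k [kc fk]]].
set a := f z in fz0 fk *.
have vc : ccts (fun h => a + b * h + h ^+ 2 * k h) 0 by ccts_tac.
have v0 : a + b * 0 + 0 ^+ 2 * k 0 = a by rewrite mulr0 expr0n mul0r !addr0.
(* The second witness is (1 / (a + v) - 1 / a + b h / a^2) / h^2 with v = b h + h^2 k h, put over
   the common denominator a^2 (a + v). *)
exists (- b / a ^+ 2), (fun h => (b ^+ 2 / a ^+ 2 - k h / a + b * h * k h / a ^+ 2)
   * (a + b * h + h ^+ 2 * k h)^-1); split.
  have vVc : ccts (fun h => (a + b * h + h ^+ 2 * k h)^-1) 0.
    by apply: cctsV vc; rewrite v0.
  ccts_tac.
have := ccts_neq0 vc; rewrite v0 => /(_ fz0); apply: cnearS2 fk => h -> nz.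
by rewrite -/a; field; rewrite nz.
Qed.

Lemma taylor2_near f g z : cnear z (fun w => f w = g w) ->
  taylor2 f z -> taylor2 g z.
Proof.
move=> fg [b [k [kc fk]]]; exists b, k; split => //.
have <- := cnear_self fg.
by apply: cnearS2 fk (cnear0 fg) => h -> ->.
Qed.

(* The first-order coefficient of [u] at [s z] being nonzero, [s] is a local
   solution of an implicit equation. *)
Lemma taylor2_implicit (u v s : R[i] -> R[i]) z b b' :
  b != 0 -> taylor2_at u (s z) b -> taylor2_at v z b' -> ccts s z ->
  cnear z (fun w => u (s w) = v w) -> taylor2_at s z (b' / b).
Proof.
move=> b0 [k [kc uk]] [k' [kc' vk]] sc us.
pose p h := s (z + h) - s z.
have p0 : p 0 = 0 by rewrite /p addr0 subrr.
have pc : ccts p 0.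
  move=> e e0; apply: cnearS (cnear0 (sc e e0)) => h.
  by rewrite p0 subr0.
have kpc : ccts (fun h => k (p h)) 0 by apply: ccts_comp => //; rewrite p0.
(* Near 0 the hypothesis reads [p h * d h = h * (b' + h * k' h)]. As [d 0 = b] is nonzero,
   [p h = h * r h] with [r] continuous at 0 and [r 0 = b' / b]. The remainder exhibited below is (r
   h - b' / b) / h, rewritten with d h - b = h * r h * k (p h). *)
pose d h := b + p h * k (p h).
have d0 : d 0 = b by rewrite /d p0 mul0r addr0.
have dc : ccts d 0 by rewrite /d; ccts_tac.
have dVc : ccts (fun h => (d h)^-1) 0 by apply: cctsV => //; rewrite d0.
pose r h := (b' + h * k' h) * (d h)^-1.
have rc : ccts r 0 by rewrite /r; ccts_tac.
exists (fun h => (k' h - b' * r h * k (p h) / b) * (d h)^-1).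
split; first by ccts_tac.
have nz : cnear 0 (fun h => d h != 0) by apply: ccts_neq0 => //; rewrite d0.
have uk' : cnear 0 (fun h => u (s z + p h) = u (s z) + b * p h + p h ^+ 2 * k (p h)).
  by apply: (@ccts_near _ p 0 (fun q => u (s z + q) = u (s z) + b * q + q ^+ 2 * k q));
    rewrite ?p0.
have us0 := cnear_self us.
apply: cnearS (cnearI (cnearI uk' (cnear0 us)) (cnearI vk nz)).
move=> h [[e1 e2] [e3 dn]].
have ph : p h * d h = h * (b' + h * k' h).
  have : u (s z) + b * p h + p h ^+ 2 * k (p h) = v z + b' * h + h ^+ 2 * k' h.
    by rewrite -e3 -e2 -e1 /p addrCA subrr addr0.
  rewrite us0 -!addrA => /addrI e4.
  by rewrite /d mulrDr [p h * b]mulrC mulrA -expr2 e4; ring.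
have ph' : p h = h * r h.
  by rewrite /r mulrA -ph mulfK.
have rE : r h * (b + h * r h * k (p h)) = b' + h * k' h.
  by rewrite -ph' -/(d h) /r -mulrA mulVf // mulr1.
have -> : s (z + h) = s z + h * r h by rewrite -ph' /p addrCA subrr addr0.
rewrite -addrA; congr (_ + _).
have dE : d h = b + h * r h * k (p h) by rewrite /d -ph'.
move: rE; rewrite -dE => rE; move: rE dE dn.
move: (d h) (r h) (k' h) (k (p h)) => D r1 k1 k2 rE DE dn.
apply: (mulIf dn).
have -> : (b' / b * h + h ^+ 2 * ((k1 - b' * r1 * k2 / b) * D^-1)) * D =
    b' / b * h * D + h ^+ 2 * (k1 - b' * r1 * k2 / b) by field; rewrite dn b0.
by rewrite -[LHS]mulrA rE DE; field; rewrite b0.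
Qed.

End Taylor2.

(** * The maximum principle *)

Section MaxPrinciple.
Variable R : realType.

(** At an interior maximum z0 of |f|^2 + e |z|^2, the values at z0 + t, z0 - t, z0 + it and z0 - it
    are summed: the terms of degree 1 cancel, those of degree 2 of [f] cancel up to o(t^2) since
    (it)^2 = -t^2, and about 4 e t^2 is left, against maximality. The alternative [f z = 0] admits
    points without expansion, as needed in [liouville_removable]; it cannot occur at z0, where |f
    z0| > M. *)
Lemma max_principle (f : R[i] -> R[i]) (r M : R) : 0 <= M ->
  (forall z, cmod z <= r -> ccts f z) ->
  (forall z, cmod z < r -> taylor2 f z \/ f z = 0) ->
  (forall z, cmod z = r -> cmod (f z) <= M) ->
  forall z, cmod z <= r -> cmod (f z) <= M.
Proof.
move=> M0 fc f2 fM z1 z1r; apply/negPn/negP; rewrite -ltNge => Mz1.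
have r0 : 0 <= r by exact: le_trans (cmod_ge0 z1) z1r.
(* Small enough that the perturbation, at most e r^2 on the disc, stays below the excess of |f z1|^2
   over M^2; the + 1 covers r = 0. *)
pose e : R := (cmod (f z1) ^+ 2 - M ^+ 2) / (2 * (r ^+ 2 + 1)).
have den : 0 < 2 * (r ^+ 2 + 1) by rewrite mulr_gt0 // ltr_wpDl // sqr_ge0.
have q0 : 0 < cmod (f z1) ^+ 2 - M ^+ 2 by rewrite subr_gt0 ltr_pXn2r ?nnegrE ?cmod_ge0.
have e0 : 0 < e by rewrite divr_gt0.
have er : e * r ^+ 2 < cmod (f z1) ^+ 2 - M ^+ 2.
  rewrite /e mulrAC ltr_pdivrMr //.
  move: q0.
  have := sqr_ge0 r; set q := _ - _; nra.
pose u (w : R[i]) : R := cmod (f w) ^+ 2 + e * cmod w ^+ 2.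
have [z0 z0r uz0] : exists2 z0 : R[i], cmod z0 <= r &
    forall w : R[i], cmod w <= r -> u w <= u z0.
  have sqc (g : R[i] -> R[i]) (z : Cx R) : ccts g z ->
      {for z, continuous (fun w : Cx R => cmod (g w) ^+ 2)}.
    move=> /cctsP/(@cfor_cmod R (Cx R) g z) gc.
    have -> : (fun w : Cx R => cmod (g w) ^+ 2) =
              (fun w => cmod (g w)) \* (fun w => cmod (g w)).
      by apply/funext => w; rewrite expr2.
    exact: (@continuousM R (Cx R)).
  have [z|z0] := @disc_max R u 0 r r0.
    rewrite subr0 => /fc zc.
    apply: (@continuousD R R (Cx R)); first exact: sqc.
    apply: (@continuousM R (Cx R)); first exact: cst_continuous.
    by apply: (sqc id); exact: ccts_id.
  rewrite subr0 => z0r zmax; exists z0 => // w wr.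
  by apply: zmax; rewrite subr0.
have uz01 := uz0 _ z1r.
have u1 : cmod (f z1) ^+ 2 <= u z1.
  by rewrite /u lerDl mulr_ge0 ?sqr_ge0 // ltW.
have ew : e * cmod z0 ^+ 2 <= e * r ^+ 2.
  by rewrite ler_pM2l // ler_pXn2r ?nnegrE ?cmod_ge0.
have fz0M : M ^+ 2 < cmod (f z0) ^+ 2 by rewrite /u in uz01 u1; lra.
have z0r' : cmod z0 < r.
  rewrite lt_neqAle z0r andbT; apply: contraTneq fz0M => /fM h.
  by rewrite -leNgt ler_pXn2r ?nnegrE ?cmod_ge0.
have [[b [k [kc fk]]]|fz00] := f2 _ z0r'; last first.
  by move: fz0M; rewrite fz00 cmod0 expr0n ltNge sqr_ge0.
set a := f z0 in fk *.
(* The four remainders contribute at most 16 |a| eta t^2, which has to stay below 4 e t^2. *)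
pose eta : R := e / (4 * (cmod a + 1)).
have a1 : 0 < cmod a + 1 by have := cmod_ge0 a; lra.
have den' : 0 < 4 * (cmod a + 1) by rewrite mulr_gt0.
have eta0 : 0 < eta by rewrite divr_gt0.
have eta_a : 4 * (cmod a * eta) < e.
  have -> : 4 * (cmod a * eta) = e * (4 * cmod a / (4 * (cmod a + 1))).
    by rewrite /eta; field; exact: lt0r_neq0.
  rewrite gtr_pMr // ltr_pdivrMr // mul1r; lra.
have rz : 0 < r - cmod z0 by rewrite subr_gt0.
have [D D0 HD] := cnearI (cnearI fk (kc _ eta0)) (cnear_disc 0 rz).
pose t : R := D / 2.
have t0 : 0 < t by rewrite divr_gt0.
(* Maximality compared at z0 + z, with the nonnegative square of the increment of [f] dropped. *)
have key (z : Cx R) : cmod z = t ->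
   2 * (complex.Re a * complex.Re (b * z + z ^+ 2 * k z) +
        complex.Im a * complex.Im (b * z + z ^+ 2 * k z)) +
   2 * e * (complex.Re z0 * complex.Re z + complex.Im z0 * complex.Im z)
   + e * t ^+ 2 <= 0 /\ cmod (k z - k 0) < eta.
  move=> zt; have zD : cmod (z - 0) < D by rewrite subr0 zt /t; lra.
  have [[/= fz kz]] := HD _ zD; rewrite subr0 => zr; split => //.
  have /uz0 : cmod (z0 + z) <= r by rewrite (le_trans (cmodD _ _)) //; lra.
  rewrite /u fz -/a -addrA !cmod_sqr !raddfD /= => h.
  have := cmod_sqr z; rewrite zt => ->.
  move: h; set X1 := complex.Re (b * z); set X2 := complex.Re (_ ^+ 2 * _).
  set Y1 := complex.Im (b * z); set Y2 := complex.Im (_ ^+ 2 * _).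
  by have := sqr_ge0 (X1 + X2); have := sqr_ge0 (Y1 + Y2); nra.
have ct : cmod (t%:C)%C = t by rewrite cmodC gtr0_norm.
have cit : cmod ('i%C * (t%:C)%C) = t by rewrite cmodM cmodi mul1r.
have [h1 k1] := key (t%:C)%C ct.
have [h2 k2] := key (- (t%:C)%C) (etrans (cmodN _) ct).
have [h3 k3] := key ('i%C * (t%:C)%C) cit.
have [h4 k4] := key (- ('i%C * (t%:C)%C)) (etrans (cmodN _) cit).
have i2 : ('i%C * (t%:C)%C) ^+ 2 = - (t%:C)%C ^+ 2 :> R[i].
  by rewrite exprMn sqr_i mulN1r.
rewrite !sqrrN !i2 in h1 h2 h3 h4.
have T0 : 0 < t ^+ 2 by rewrite exprn_gt0.
have dev (K K0 : R[i]) : cmod (K - K0) < eta ->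
    `|complex.Re a * (complex.Re K - complex.Re K0)| <= cmod a * eta /\
    `|complex.Im a * (complex.Im K - complex.Im K0)| <= cmod a * eta.
  move=> kk; rewrite !normrM -!raddfB; split; apply: ler_pM => //.
  - exact: Re_le_cmod.
  - exact: le_trans (Re_le_cmod _) (ltW kk).
  - exact: Im_le_cmod.
  - exact: le_trans (Im_le_cmod _) (ltW kk).
move: (dev _ _ k1) (dev _ _ k2) (dev _ _ k3) (dev _ _ k4).
move: h1 h2 h3 h4; clear dev k1 k2 k3 k4.
move: (k _) (k _) (k _) (k _) (k _) => [x1 y1] [x2 y2] [x3 y3] [x4 y4] [x0 y0].
move: eta_a; set c := cmod a * eta; clearbody c.
clear uz0 z0r uz01 ew fz0M z0r' fk rz kc HD den' eta0 ct cit i2 key a1.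
clear eta; clearbody a t; move: a b z0 => [a1 a2] [b1 b2] [z01 z02] /=.
rewrite !ler_norml => ce h1 h2 h3 h4 [/andP[p1 p2] /andP[p3 p4]].
move=> [/andP[q1 q2] /andP[q3 q4]] [/andP[r1 r2] /andP[r3 r4]].
move=> [/andP[s1 s2] /andP[s3 s4]].
have : 0 < t ^+ 2 * (4 * e - 16 * c) by rewrite mulr_gt0 //; lra.
have mt (x : R) : x <= c -> t ^+ 2 * x <= t ^+ 2 * c by rewrite ler_pM2l.
move: (mt _ p2) (mt _ p4) (mt _ q2) (mt _ q4).
have mt' (x : R) : - c <= x -> - (t ^+ 2 * c) <= t ^+ 2 * x.
  by rewrite -mulrN ler_pM2l.
move: (mt' _ p1) (mt' _ p3) (mt' _ q1) (mt' _ q3) (mt' _ r1) (mt' _ r3) (mt' _ s1) (mt' _ s3).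
move: (mt _ r2) (mt _ r4) (mt _ s2) (mt _ s4).
lra.
Qed.

End MaxPrinciple.

(** * Theorems of Liouville type *)

Section Liouville.
Variable R : realType.

Lemma expr_unbounded (t M : R) : 1 < t -> exists n, M < t ^+ n.
Proof.
move=> t1.
have bern n : 1 + n%:R * (t - 1) <= t ^+ n.
  elim: n => [|n IH]; first by rewrite mul0r addr0 expr0.
  rewrite exprS; have n0 : 0 <= n%:R :> R by [].
  have tn : t * (1 + n%:R * (t - 1)) <= t * t ^+ n by rewrite ler_pM2l //; lra.
  apply: le_trans tn; rewrite -natr1.
  have := mulr_ge0 n0 (sqr_ge0 (t - 1)); lra.
have [n nM] : exists n : nat, M / (t - 1) < n%:R.
  by exists (Num.trunc (Num.max 0 (M / (t - 1)))).+1;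
    rewrite (le_lt_trans _ (truncnS_gt _)) // le_max lexx orbT.
exists n; apply: lt_le_trans (bern n).
move: nM; rewrite ltr_pdivrMr ?subr_gt0 //; lra.
Qed.

(* The maximum principle is applied to the functions [q z ^+ n * z], which
   remain continuous at the possible singularity [0]. *)
Lemma liouville_removable (q : R[i] -> R[i]) (C : R) :
  (forall z, z != 0 -> taylor2 q z) ->
  cnear 0 (fun z => z != 0 -> cmod (q z) <= C) ->
  (forall e, 0 < e -> exists r, forall z, r <= cmod z -> cmod (q z) <= e) ->
  forall z, z != 0 -> q z = 0.
Proof.
move=> q2 [d d0 qC] qoo z z0; apply/eqP; rewrite -cmod_eq0 eq_le cmod_ge0 andbT.
rewrite leNgt; apply/negP => qz0.
have [r0 qr0] := qoo _ (divr_gt0 qz0 (ltr0Sn R 1)).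
pose r := Num.max r0 (cmod z).
have zr : cmod z <= r by rewrite /r le_max lexx orbT.
have zp : 0 < cmod z by rewrite cmod_gt0.
have rp : 0 < r by exact: lt_le_trans zr.
have lt12 : 1 < 2 :> R by lra.
(* With e half of |q z|, the maximum principle on |w| <= r will give (2 e)^n |z| <= e^n r, hence 2^n
   <= r / |z|, which fails for this [n]. *)
have [n] := expr_unbounded (r / cmod z) lt12.
apply/negP; rewrite -leNgt ler_pdivlMr //.
set e := cmod (q z) / 2 in qr0.
have ep : 0 < e by rewrite divr_gt0.
have e0 : 0 <= e ^+ n by rewrite exprn_ge0 // ltW.
suff : cmod (q z ^+ n * z) <= e ^+ n * r.
  have qe : cmod (q z) = 2 * e by rewrite /e; field.
  rewrite cmodM cmodX qe; clearbody e; rewrite exprMn.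
  by rewrite mulrAC [leLHS]mulrC ler_pM2l ?exprn_gt0.
have k2 w : w != 0 -> taylor2 (fun w => q w ^+ n * w) w.
  by move=> w0; apply: taylor2M; [apply: taylor2X; exact: q2|exact: taylor2_id].
apply: (@max_principle R (fun w => q w ^+ n * w) r) => //.
- by rewrite mulr_ge0 // ltW.
- move=> w _; have [->|w0] := eqVneq w 0; last exact/taylor2_continuous/k2.
  move=> x x0; rewrite mulr0.
  have Cn : 0 < `|C| ^+ n + 1 by rewrite ltr_wpDl // exprn_ge0.
  have x1 : 0 < x / (`|C| ^+ n + 1) by rewrite divr_gt0.
  have qC' : cnear 0 (fun z => z != 0 -> cmod (q z) <= C) by exists d.
  apply: cnearS2 qC' (cnear_disc 0 x1) => y; rewrite !subr0 => qy.
  rewrite ltr_pdivlMr // => yx; rewrite cmodM cmodX.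
  have [->|y0] := eqVneq y 0; first by rewrite cmod0 mulr0.
  apply: le_lt_trans yx; rewrite mulrC ler_wpM2l ?cmod_ge0 //.
  apply: (@le_trans _ _ (`|C| ^+ n)); last by rewrite lerDl.
  by rewrite lerXn2r ?nnegrE ?cmod_ge0 // (le_trans (qy y0)) // ler_norm.
- by move=> w _; have [->|/k2] := eqVneq w 0; [right; rewrite mulr0|left].
- move=> w wr; rewrite cmodM cmodX wr ler_pM2r // lerXn2r ?nnegrE ?cmod_ge0 ?(ltW ep) //.
  by apply: qr0; rewrite wr /r le_max lexx.
Qed.

(** The quotient a z / z^2 is bounded near 0 by the vanishing to order 2 and tends to 0 at infinity
    by the linear growth, so it is zero. *)
Lemma entire_linear_growth (a k : R[i] -> R[i]) (C : R) :
  (forall z, taylor2 a z) -> ccts k 0 -> cnear 0 (fun h => a h = h ^+ 2 * k h) ->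
  (forall z, cmod (a z) <= C * (1 + cmod z)) -> forall z, a z = 0.
Proof.
move=> a2 kc ak aC z.
have a0 : a 0 = 0 by rewrite (cnear_self ak) expr0n mul0r.
have [->//|z0] := eqVneq z 0.
pose q w := a w * (w ^+ 2)^-1.
suff : q z = 0.
  by move/eqP; rewrite mulf_eq0 invr_eq0 expf_eq0 (negbTE z0) andbF orbF => /eqP.
have C0 : 0 <= C.
  by have := le_trans (cmod_ge0 _) (aC 0); rewrite cmod0 addr0 mulr1.
apply: (@liouville_removable q (cmod (k 0) + 1)) => //.
- move=> w w0; apply: taylor2M => //; apply: taylor2V; last first.
    by apply: taylor2X; exact: taylor2_id.
  by rewrite expf_neq0.
- apply: cnearS2 ak (kc _ ltr01) => w aw kw w0.
  rewrite /q aw mulrAC mulfV ?expf_neq0 // mul1r.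
  by have := cmodD (k w - k 0) (k 0); rewrite subrK; lra.
(* Beyond this radius |w| >= 1, so that C (1 + |w|) <= 2 C |w| <= e |w|^2. *)
- move=> e e0; exists (1 + 2 * C / e) => w hw.
  have w1 : 1 <= cmod w by apply: le_trans hw; rewrite lerDl divr_ge0 ?mulr_ge0 // ltW.
  have wp : 0 < cmod w by lra.
  rewrite cmodM cmodV cmodX ler_pdivrMr ?exprn_gt0 //.
  apply: le_trans (aC w) _.
  have : 2 * C <= e * cmod w.
    have : 2 * C / e <= cmod w by lra.
    by rewrite ler_pdivrMr // [cmod w * e]mulrC.
  nra.
Qed.

(** The functions 1 / s and 1 / (b z) have the same principal part at 0 and tend to 0 at infinity,
    so their difference is zero by [liouville_removable]. Passing to reciprocals turns properness
    into decay. *)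
Lemma entire_proper_affine (s : R[i] -> R[i]) b :
  (forall z, taylor2 s z) -> b != 0 -> taylor2_at s 0 b -> s 0 = 0 ->
  (forall z, z != 0 -> s z != 0) ->
  (forall M, exists r, forall z, r <= cmod z -> M <= cmod (s z)) ->
  forall z, s z = b * z.
Proof.
move=> s2 b0 [k [kc sk]] s0 sn0 soo z.
have [->|z0] := eqVneq z 0; first by rewrite s0 mulr0.
pose q w := (s w)^-1 - (b * w)^-1.
suff : q z = 0 by move=> /subr0_eq/invr_inj.
(* Near 0 and off 0, this is [q] after cancellation of h. *)
pose g h := - k h * ((b + h * k h) * b)^-1.
have g0 : (b + 0 * k 0) * b != 0 by rewrite mul0r addr0 mulf_neq0.
have gc : ccts g 0.
  have gVc : ccts (fun h => ((b + h * k h) * b)^-1) 0.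
    by apply: cctsV => //; ccts_tac.
  rewrite /g; ccts_tac.
apply: (@liouville_removable q (cmod (g 0) + 1)) => //.
- move=> w w0; apply: taylor2D; first by apply: taylor2V; [exact: sn0|exact: s2].
  apply: taylor2N; apply: taylor2V; first by rewrite mulf_neq0.
  by apply: taylor2M; [exact: taylor2_cst|exact: taylor2_id].
- have dc : ccts (fun h => (b + h * k h) * b) 0 by ccts_tac.
  apply: cnearS2 (cnearI sk (ccts_neq0 dc g0)) (gc _ ltr01) => w [sw dn] gw w0.
  have -> : q w = g w.
    rewrite /q -[w in s w]add0r sw s0 add0r /g.
    have dn' : b + w * k w != 0 by move: dn; rewrite mulf_eq0 negb_or => /andP[].
    have e1 : b * w + w ^+ 2 * k w = w * (b + w * k w) by ring.
    by rewrite e1; field; rewrite w0 dn' b0.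
  by have := cmodD (g w - g 0) (g 0); rewrite subrK; lra.
- move=> e e0; have [r hr] := soo (2 / e).
  have e2 : 0 < 2 / e by rewrite divr_gt0.
  have bp : 0 < cmod b by rewrite cmod_gt0.
  exists (Num.max r (2 / (e * cmod b))) => w; rewrite ge_max => /andP[rw hw].
  apply: le_trans (cmodB _ _) _; rewrite !cmodV cmodM.
  have h1 : (cmod (s w))^-1 <= e / 2.
    rewrite -[e / 2]invrK lef_pV2 ?posrE ?invr_gt0 ?divr_gt0 //.
      by rewrite invf_div; exact: hr.
    by apply: lt_le_trans (hr _ rw).
  have eb : 0 < 2 / (e * cmod b) by rewrite divr_gt0 // mulr_gt0.
  have wp : 0 < cmod w by apply: lt_le_trans hw.
  have h2 : (cmod b * cmod w)^-1 <= e / 2.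
    rewrite -[e / 2]invrK lef_pV2 ?posrE ?invr_gt0 ?divr_gt0 ?mulr_gt0 //.
    rewrite invf_div; move: hw; rewrite !ler_pdivrMr ?mulr_gt0 //.
    by rewrite (_ : cmod w * _ = cmod b * cmod w * e) //; ring.
  lra.
Qed.

End Liouville.

(** * Periods of a holomorphic covering by the complex plane *)

Section Segments.
Variable R : realType.
Implicit Types (a b c z w : R[i]).

Definition seg a b (t : R) : R[i] := a + (t%:C)%C * (b - a).

Definition cconvex (B : R[i] -> Prop) := forall a b t,
  B a -> B b -> 0 <= t <= 1 -> B (seg a b t).

Lemma seg_ball c r : cconvex (fun z => cmod (z - c) < r).
Proof.
move=> a b t ac bc /andP[t0 t1].
have -> : seg a b t - c = ((1 - t)%:C)%C * (a - c) + (t%:C)%C * (b - c).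
  by rewrite /seg rmorphB rmorph1; ring.
apply: le_lt_trans (cmodD _ _) _; rewrite !cmodM !cmodC !ger0_norm ?subr_ge0 //.
set x := cmod (a - c) in ac *; set y := cmod (b - c) in bc *.
have mr : Num.max x y < r by rewrite gt_max ac.
have h1 : (1 - t) * x <= (1 - t) * Num.max x y.
  by rewrite ler_wpM2l ?subr_ge0 // le_max lexx.
have h2 : t * y <= t * Num.max x y by rewrite ler_wpM2l // le_max lexx orbT.
lra.
Qed.

Lemma cconvexI (A B : R[i] -> Prop) : cconvex A -> cconvex B ->
  cconvex (fun z => A z /\ B z).
Proof. by move=> hA hB a b t [? ?] [? ?] ?; split; [exact: hA|exact: hB]. Qed.

Lemma near_seg a b t (P : R[i] -> Prop) :
  cnear (seg a b t) P -> \forall s \near t, P (seg a b s).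
Proof.
move=> [d d0 dP]; have m0 : 0 < cmod (b - a) + 1 by rewrite ltr_wpDl ?cmod_ge0.
have e0 : 0 < d / (cmod (b - a) + 1) by rewrite divr_gt0.
near=> s; apply: dP.
have -> : seg a b s - seg a b t = ((s - t)%:C)%C * (b - a).
  by rewrite /seg rmorphB; ring.
rewrite cmodM cmodC.
have st : `|s - t| < d / (cmod (b - a) + 1).
  near: s; apply/nbhs_normP; exists (d / (cmod (b - a) + 1)) => // s /=.
  by rewrite distrC.
move: st; rewrite ltr_pdivlMr //; apply: le_lt_trans.
by rewrite ler_wpM2l // lerDl.
Unshelve. all: by end_near. Qed.

(** The continuation principle of the development: it yields both the uniqueness of lifts and the
    spreading along a whole leaf of a property known at y = 0. *)
Lemma cconvex_locally_constant (B P : R[i] -> Prop) a b : cconvex B ->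
  (forall z, B z -> cnear z (fun w => B w -> (P w <-> P z))) ->
  B a -> B b -> P a -> P b.
Proof.
move=> cB lP Ba Bb Pa.
have B01 t : t \in `[0, 1] -> B (seg a b t) by move=> t01; apply: cB.
have s0 : seg a b 0 = a by rewrite /seg mul0r addr0.
have s1 : seg a b 1 = b by rewrite /seg mul1r addrC subrK.
pose A : set R := `[0, 1]%classic.
have lt t : A t -> \forall s \near t, A s -> (P (seg a b s) <-> P (seg a b t)).
  move=> At; have := near_seg (lP _ (B01 _ At)); apply: filterS => s Ps As.
  exact/Ps/B01.
have /(_ [set t | A t /\ P (seg a b t)]) := @segment_connected R 0 1.
move=> cA; have : [set t | A t /\ P (seg a b t)] = A; last first.
  move=> AP; have [_] : [set t | A t /\ P (seg a b t)] 1.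
    by rewrite AP /A /= in_itv /= lexx ler01.
  by rewrite s1.
apply: cA.
- by exists 0; rewrite /= s0; split => //; rewrite /A /= in_itv /= lexx ler01.
- exists (interior [set t | A t -> P (seg a b t)]); first exact: open_interior.
  apply/seteqP; split => t /=.
    move=> [At Pt]; split=> //; rewrite /interior /=.
    by have := lt _ At; apply: filterS => s Ps As; apply/(Ps As).
  by move=> [At /nbhs_singleton/(_ At)].
- exists (~` interior [set t | A t -> ~ P (seg a b t)]).
    by apply: open_closedC; exact: open_interior.
  apply/seteqP; split => t /=.
    by move=> [At Pt]; split=> // /nbhs_singleton/(_ At).
  move=> [At nP]; split => //; apply: contrapT => nPt; apply: nP.
  rewrite /interior /=; have := lt _ At; apply: filterS => s Ps As.
  by move/(Ps As).
Qed.

End Segments.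

(** * Lifts of a covering through itself and deck transformations *)

Section Lifting.
Variables (R : realType) (U : topologicalType) (f : Cx R -> U) (L : set U).
Hypothesis fcov : covering_onto f L.
Implicit Types (y z w c : R[i]) (B : R[i] -> Prop) (s t : R[i] -> R[i]).

Let fL z : L (f z).
Proof. by have [_ <- _] := fcov; exists z. Qed.

Lemma cnear_open (W : set (Cx R)) z : open W -> W z -> cnear z W.
Proof. by move=> oW Wz; apply/nbhs_cmodP; exact: open_nbhs_nbhs. Qed.

Lemma cnear_covering z (V : set U) : nbhs (f z) V -> cnear z (fun w => V (f w)).
Proof. by have [fc _ _] := fcov => fV; apply/nbhs_cmodP; exact: fc. Qed.

Definition deck_on B s := forall z, B z -> ccts s z /\ f (s z) = f z.

Lemma deck_on_unique B s t c z : cconvex B -> deck_on B s -> deck_on B t ->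
  B c -> B z -> s c = t c -> s z = t z.
Proof.
move=> cB sB tB Bc Bz stc.
apply: (@cconvex_locally_constant R B (fun w => s w = t w) c z) => // {}z {}Bz.
have [sc fs] := sB _ Bz; have [tc ft] := tB _ Bz.
have [_ _ /(_ _ (fL z))[V [oV Vz VL [I [W [oW tW WV sW]]]]]] := fcov.
have [i _ Wi] : (\bigcup_i W i) (s z) by rewrite WV /preimage /= fs.
have [j _ Wj] : (\bigcup_i W i) (t z) by rewrite WV /preimage /= ft.
have ns := ccts_near sc (cnear_open (oW i) Wi).
have nt := ccts_near tc (cnear_open (oW j) Wj).
apply: cnearS2 ns nt => w Wiw Wjw Bw.
have [ij|nij] := pselect (i = j).
  subst j; have [injW _ _] := sW i.
  have E x : B x -> W i (s x) -> W i (t x) -> s x = t x.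
    move=> /[dup] /sB[_ fsx] /tB[_ ftx] six tix.
    by apply: injW; rewrite ?inE // fsx ftx.
  by split=> _; apply: E.
split=> st; exfalso; apply: nij.
  by apply: (tW i j) => //; exists (s w); split => //; rewrite st.
by apply: (tW i j) => //; exists (s z); split => //; rewrite st.
Qed.

(** One radius [d] serves every centre near [z] and every point [y] of the fibre, so that
    compactness can turn it into a uniform radius. *)
Lemma local_deck z : exists2 d : R, 0 < d & forall c r y, 0 < r ->
  cmod (c - z) < d -> r <= d -> f y = f c ->
  exists2 s, deck_on (fun w => cmod (w - c) < r) s & s c = y.
Proof.
have [_ _ /(_ _ (fL z))[V [oV Vz VL [I [W [oW tW WV sW]]]]]] := fcov.
have [d d0 dV] := cnear_covering (open_nbhs_nbhs (conj oV Vz)).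
exists (d / 2) => [|c r y r0 cz rd fyc]; first by rewrite divr_gt0.
have BV w : cmod (w - c) < r -> V (f w).
  move=> wc; apply: dV; rewrite -(subrK c w) -addrA (le_lt_trans (cmodD _ _)) //.
  lra.
have Vc : V (f c) by apply: BV; rewrite subrr cmod0.
have [i _ Wiy] : (\bigcup_i W i) y by rewrite WV /preimage /= fyc.
have [injW imW opW] := sW i.
have sec w : exists x, V (f w) -> W i x /\ f x = f w.
  have [Vw|nV] := pselect (V (f w)); last by exists 0.
  by move: Vw; rewrite -imW => -[x Wx fx]; exists x.
have [s sP] := choice sec.
exists s => [w /BV Vw|]; last first.
  have [Wsc fsc] := sP _ Vc; apply: injW; rewrite ?inE //.
  by rewrite fsc fyc.
have [Wsw fsw] := sP _ Vw; split => //.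
move=> e e0; pose O : set (Cx R) := W i `&` interior [set x : Cx R | cmod (x - s w) < e].
have oO : open O by apply: openI => //; exact: open_interior.
have Osw : O (s w).
  split => //; rewrite /interior /=; apply/nbhs_cmodP; exact: cnear_disc.
have fO : open (f @` O) by apply: opW => // x [].
have : nbhs (f w) (f @` O) by apply: open_nbhs_nbhs; split; [exact: fO|exists (s w)].
move=> /cnear_covering; have := cnear_covering (open_nbhs_nbhs (conj oV Vw)).
apply: cnearS2 => x /sP[Wsx fsx] [x' [Wx' Ix'] fx'].
have -> : s x = x' by apply: injW; rewrite ?inE // fsx fx'.
exact: (nbhs_singleton Ix').
Qed.

Lemma uniform_local_deck c0 (N : R) : exists2 r : R, 0 < r &
  forall c y, cmod (c - c0) <= N -> f y = f c ->
  exists2 s, deck_on (fun w => cmod (w - c) < r) s & s c = y.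
Proof.
pose P (r : R) (c : Cx R) := forall y, f y = f c ->
  exists2 s, deck_on (fun w => cmod (w - c) < r) s & s c = y.
have /compact_near_coveringP/(_ R (0^'+) P _) := @disc_compact R c0 N.
move=> H; suff : \forall r \near 0^'+, [set z : Cx R | cmod (z - c0) <= N] `<=` P r.
  move=> nr; near (0 : R)^'+ => r; exists r => // c y cN.
  have : [set z : Cx R | cmod (z - c0) <= N] `<=` P r by near: r.
  by apply.
apply: H => z _; have [d d0 dP] := local_deck z.
exists ([set c : Cx R | cmod (c - z) < d], [set r : R | 0 < r <= d]).
  split => /=; first by apply/nbhs_cmodP; exact: cnear_disc.
  near=> r; apply/andP; split => //; near: r; exact: nbhs_right_le.
move=> [c r] /= [cz /andP[r0 rd]] y; exact: dP.
Unshelve. all: by end_near. Qed.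

(** The extension takes at z the value of the local lift centred at the contraction p z of z into
    the smaller disc. Intersections of two discs are convex, so by uniqueness the lifts centred at p
    w and at p z agree near z, whence continuity. *)
Lemma deck_extend c0 (N r rho : R) s : 0 < r -> 0 < rho -> r <= N ->
  (forall c y, cmod (c - c0) <= N -> f y = f c ->
    exists2 s, deck_on (fun w => cmod (w - c) < rho) s & s c = y) ->
  deck_on (fun w => cmod (w - c0) < r) s ->
  exists2 s', deck_on (fun w => cmod (w - c0) < r + rho / 2) s' & s' c0 = s c0.
Proof.
move=> r0 rho0 rN loc sB.
have loc' c : exists t, cmod (c - c0) < r ->
    deck_on (fun w => cmod (w - c) < rho) t /\ t c = s c.
  have [cr|ncr] := pselect (cmod (c - c0) < r); last by exists s.
  have [t tB tc] := loc c (s c) (le_trans (ltW cr) rN) (proj2 (sB _ cr)).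
  by exists t.
have [t tP] := choice loc'.
have rr : 0 < r + rho / 2 by rewrite addr_gt0 // divr_gt0.
(* The homothety [p] of ratio [lam] maps the disc of radius r + rho / 2 to that of radius r and
   moves its points by less than rho / 2. *)
pose lam : R := r / (r + rho / 2).
pose p z := c0 + (lam%:C)%C * (z - c0).
have lam01 : 0 < lam < 1 by rewrite divr_gt0 //= ltr_pdivrMr // mul1r ltrDl divr_gt0.
have [lam0 lam1] := andP lam01.
have pr z : cmod (z - c0) < r + rho / 2 -> cmod (p z - c0) < r.
  move=> zr; rewrite /p addrC addKr cmodM cmodC gtr0_norm // /lam mulrAC.
  by rewrite ltr_pdivrMr // ltr_pM2l.
have pz z : cmod (z - c0) < r + rho / 2 -> cmod (z - p z) < rho / 2.
  move=> zr; have -> : z - p z = ((1 - lam)%:C)%C * (z - c0).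
    by rewrite /p rmorphB rmorph1; ring.
  rewrite cmodM cmodC gtr0_norm ?subr_gt0 //.
  have -> : rho / 2 = (1 - lam) * (r + rho / 2).
    by rewrite mulrBl mul1r /lam divfK ?gt_eqF // addrC addKr.
  by rewrite ltr_pM2l // subr_gt0.
have pc w z : cmod (w - z) < rho / 2 -> cmod (p w - p z) < rho / 2.
  move=> wz; have -> : p w - p z = (lam%:C)%C * (w - z) by rewrite /p; ring.
  rewrite cmodM cmodC gtr0_norm //; apply: le_lt_trans wz.
  by rewrite ler_piMl ?cmod_ge0 // ltW.
exists (fun z => t (p z) z); last first.
  have -> : p c0 = c0 by rewrite /p subrr mulr0 addr0.
  by have [|_ ->] := tP c0; rewrite ?subrr ?cmod0.
move=> z zr; have [tpB tp] := tP _ (pr _ zr).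
have zp := pz _ zr.
have zrho : cmod (z - p z) < rho by lra.
have [tc ft] := tpB _ zrho; split; last exact: ft.
have rho2 : 0 < rho / 2 by rewrite divr_gt0.
have near_z : cnear z (fun w => t (p w) w = t (p z) w).
  have zd : 0 < r + rho / 2 - cmod (z - c0) by rewrite subr_gt0.
  apply: cnearS (cnearI (cnear_disc z rho2) (cnear_disc z zd)) => w [wz wz'].
  have wr : cmod (w - c0) < r + rho / 2.
    by have := cmodD (w - z) (z - c0); rewrite addrA subrK; lra.
  have [tqB tq] := tP _ (pr _ wr); have wq := pz _ wr.
  have qp : cmod (p w - p z) < rho by have := pc _ _ wz; lra.
  have e1 : t (p z) (p w) = s (p w).
    apply: (@deck_on_unique (fun x => cmod (x - p z) < rho /\ cmod (x - c0) < r) _ _ (p z) (p w)).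
    - by apply: cconvexI; exact: seg_ball.
    - by move=> x [xp _]; exact: tpB.
    - by move=> x [_ xr]; exact: sB.
    - by rewrite subrr cmod0; split=> //; exact: pr.
    - by split=> //; exact: pr.
    - exact: tp.
  apply: (@deck_on_unique (fun x => cmod (x - p w) < rho /\ cmod (x - p z) < rho) _ _ (p w) w).
  - by apply: cconvexI; exact: seg_ball.
  - by move=> x [xp _]; exact: tqB.
  - by move=> x [_ xp]; exact: tpB.
  - by rewrite subrr cmod0.
  - split; first lra.
    have := cmodD (w - p w) (p w - p z); rewrite addrA subrK.
    by have := pc _ _ wz; lra.
  - by rewrite tq e1.
move=> e e0; apply: cnearS2 near_z (tc e e0) => w ->; exact.
Qed.

Lemma deck_ball c0 (N : R) y : 0 < N -> f y = f c0 ->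
  exists2 s, deck_on (fun w => cmod (w - c0) < N) s & s c0 = y.
Proof.
move=> N0 fy; have [rho rho0 loc] := uniform_local_deck c0 N.
have step n : exists2 r, Num.min N (rho + n%:R * (rho / 2)) <= r &
    0 < r /\ exists2 s, deck_on (fun w => cmod (w - c0) < r) s & s c0 = y.
  elim: n => [|n [r rn [r0 [s sB sc]]]].
    exists rho; first by rewrite mul0r addr0 ge_min lexx orbT.
    by split=> //; apply: loc => //; rewrite subrr cmod0 ltW.
  have [Nr|rN] := leP N r.
    by exists r; [rewrite ge_min Nr|split=> //; exists s].
  have [s' s'B s'c] := deck_extend r0 rho0 (ltW rN) loc sB.
  exists (r + rho / 2); last first.
    split; first by rewrite addr_gt0 // divr_gt0.
    by exists s' => //; rewrite s'c.
  move: rn; rewrite !ge_min => /orP[Nr|h]; first by move: rN; rewrite ltNge Nr.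
  by apply/orP; right; rewrite -natr1; lra.
have [n nN] : exists n : nat, N / (rho / 2) < n%:R.
  exists (Num.trunc (Num.max 0 (N / (rho / 2)))).+1.
  by rewrite (le_lt_trans _ (truncnS_gt _)) // le_max lexx orbT.
have [r rn [r0 [s sB sc]]] := step n; exists s => // z zN; apply: sB.
apply: lt_le_trans zN _; apply: le_trans rn; rewrite le_min lexx /=.
by move: nN; rewrite ltr_pdivrMr ?divr_gt0 // => h; lra.
Qed.

Definition deck s := forall z, ccts s z /\ f (s z) = f z.

Lemma deck_exists c0 y : f y = f c0 -> exists2 s, deck s & s c0 = y.
Proof.
move=> fy.
have exn (n : nat) : exists t, deck_on (fun w => cmod (w - c0) < n.+1%:R) t /\ t c0 = y.
  by have [t tB tc] := deck_ball (ltr0Sn R n) fy; exists t.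
have [t tP] := choice exn.
(* The index of a disc containing z; by uniqueness, every other such disc gives the same value at
   z. *)
pose n z := Num.trunc (cmod (z - c0)).
have nP z : cmod (z - c0) < (n z).+1%:R by exact: truncnS_gt.
have tE k z : cmod (z - c0) < k.+1%:R -> t (n z) z = t k z.
  move=> zk; have [tB tc] := tP (n z); have [tkB tkc] := tP k.
  apply: (@deck_on_unique (fun x => cmod (x - c0) < (n z).+1%:R /\ cmod (x - c0) < k.+1%:R) _ _ c0 z).
  - by apply: cconvexI; exact: seg_ball.
  - by move=> x [xp _]; exact: tB.
  - by move=> x [_ xp]; exact: tkB.
  - by rewrite subrr cmod0.
  - by split.
  - by rewrite tc tkc.
exists (fun z => t (n z) z); last by have [_ ->] := tP (n c0).
move=> z; have [tB _] := tP (n z); have [tc ft] := tB _ (nP z); split => // e e0.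
have d0 : 0 < (n z).+1%:R - cmod (z - c0) by rewrite subr_gt0.
apply: cnearS2 (tc e e0) (cnear_disc z d0) => w + wz; rewrite (tE (n z)) //.
by have := cmodD (w - z) (z - c0); rewrite addrA subrK; lra.
Qed.

Lemma deck_unique s t c z : deck s -> deck t -> s c = t c -> s z = t z.
Proof.
by move=> sd td; apply: (@deck_on_unique (fun=> True)).
Qed.

Lemma deck_id : deck id.
Proof. by move=> z; split => //; exact: ccts_id. Qed.

Lemma deck_comp s t : deck s -> deck t -> deck (t \o s).
Proof.
move=> sd td z; have [sc fs] := sd z; have [tc ft] := td (s z); split.
  exact: ccts_comp.
by rewrite /= ft.
Qed.

(* The covering has local coordinates in which it is holomorphic and
   immersive. *)
Hypothesis fhol : forall y z, f y = f z ->
  exists (u : U -> R[i]) b b', [/\ b != 0, b' != 0,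
    taylor2_at (u \o f) y b & taylor2_at (u \o f) z b'].

(* Deck transformations are injective entire functions, hence affine, and they
   have no fixed point. *)
Lemma covering_period y z : f y = f z -> period_group f (y - z : Cx R).
Proof.
move=> fyz; have [s sd sz] := deck_exists fyz.
have [t td ty] := deck_exists (esym fyz).
have tsK w : t (s w) = w.
  by apply: (@deck_unique (t \o s) id z w (deck_comp sd td) deck_id); rewrite /= sz ty.
have s2 w : exists2 b, b != 0 & taylor2_at s w b.
  have [sc fs] := sd w; have [u [b [b' [b0 b'0 ub ub']]]] := fhol fs.
  exists (b' / b); first by rewrite mulf_neq0 // invr_eq0.
  apply: (taylor2_implicit b0 ub ub' sc); apply: cnearW => x /=.
  by have [_ ->] := sd x.
have [b b0 sb] := s2 0.
pose s1 w := s w - s 0.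
have s1E : forall w, s1 w = b * w.
  apply: entire_proper_affine => //.
  - move=> w; have [bw _ sw] := s2 w; apply: taylor2D; first by exists bw.
    exact: taylor2_cst.
  - have [k [kc sk]] := sb; exists k; split => //.
    by apply: cnearS sk => h; rewrite /s1 => ->; ring.
  - by rewrite /s1 subrr.
  - move=> w; apply: contraNneq => /subr0_eq e.
    by rewrite -[w]tsK e tsK.
  (* Properness: if |s w - s 0| <= |M|, then w = t (s w) lies in the image by [t] of a compact
     disc. *)
  - move=> M.
    have [|x x0 xmax] := @disc_max R (fun w : Cx R => cmod (t w)) (s 0) `|M| (normr_ge0 _).
      by move=> x _; have [tc _] := td x; apply: (@cfor_cmod R (Cx R) t); exact/cctsP.
    exists (cmod (t x) + 1) => w wx; rewrite leNgt; apply/negP => s1M.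
    have /xmax : cmod (s w - s 0) <= `|M| by rewrite ltW // (lt_le_trans s1M) ?ler_norm.
    by rewrite tsK; lra.
have sE w : s w = b * w + s 0 by rewrite -s1E /s1 subrK.
(* Otherwise [s] has the fixed point w0, hence is the identity by uniqueness, and b = 1 after
   all. *)
have b1 : b = 1.
  apply/eqP; rewrite -subr_eq0; apply/negPn/negP => b1.
  pose w0 := s 0 / (1 - b).
  have b1' : 1 - b != 0 by rewrite -oppr_eq0 opprB.
  have fix0 : s w0 = w0 by rewrite sE /w0; field.
  have sid w : s w = w by exact: (@deck_unique s id w0 w sd deck_id fix0).
  have := sE 1; rewrite !sid mulr1 addr0 => e.
  by move: b1; rewrite -e subrr eqxx.
have yE : y - z = s 0 by rewrite -sz sE b1 mul1r addrC addKr.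
move=> w; rewrite yE -[RHS](proj2 (sd w)).
by rewrite [s w]sE b1 mul1r.
Qed.

(** Every point of [L] is interior to the image of some disc |y| <= n, so by compactness one disc
    maps onto [L]; two points with the same image then differ by a period. *)
Lemma compact_covering_periods : compact L ->
  exists2 N : R, 0 < N &
    forall y, exists2 c : Cx R, period_group f c & cmod (y - c) <= N.
Proof.
move=> /compact_near_coveringP/(_ nat \oo
  (fun n p => exists2 y, cmod y <= n%:R & f y = p) _) H.
have [|n _ nP] := H; last first.
  exists (n.+1%:R) => // y.
  have [z zn fzy] := nP n (leqnn n) _ (fL y).
  exists (y - z : Cx R); first by apply: covering_period; rewrite fzy.
  by rewrite opprB addrC subrK (le_trans zn) // ler_nat.
move=> p; have [_ rL _] := fcov; rewrite -[X in X p]rL => -[z _ <-] {p}.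
have [_ _ /(_ _ (fL z))[V [oV Vz VL [I [W [oW tW WV sW]]]]]] := fcov.
have [i _ Wi] : (\bigcup_i W i) z by rewrite WV.
have [injW imW opW] := sW i.
pose O : set (Cx R) := W i `&` interior [set x : Cx R | cmod (x - z) < 1].
have oO : open O by apply: openI => //; exact: open_interior.
have Oz : O z.
  by split => //; rewrite /interior /=; apply/nbhs_cmodP; exact: cnear_disc.
have fO : open (f @` O) by apply: opW => // x [].
(* The index must exceed |z| + 1, a bound for the modulus on [O]: one successor for the integer
   part, one for the radius of the disc about z. *)
exists (f @` O, [set n | (Num.trunc (cmod z)).+2 <= n]%N).
  split => /=; first by apply: open_nbhs_nbhs; split => //; exists z.
  by exists (Num.trunc (cmod z)).+2.
move=> [p n] /= [[x [_ /nbhs_singleton /= xz] <-] zn]; exists x => //.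
have h1 : cmod z < (Num.trunc (cmod z)).+1%:R by exact: truncnS_gt.
have h2 : ((Num.trunc (cmod z)).+2)%:R <= n%:R :> R by rewrite ler_nat.
have := cmodD (x - z) z; rewrite subrK.
by move: h2; rewrite -natr1; lra.
Qed.

End Lifting.

(** * Growth of quasi-periodic functions *)

Section QuasiPeriodic.
Variable R : realType.

Lemma quasi_periodic_int (al : R[i] -> R[i]) c b : (forall z, al z = al (z + c) + b) ->
  forall (n : int) z, al (z + n%:~R * c) = al z - n%:~R * b.
Proof.
move=> alc.
have nat_case (n : nat) z : al (z + n%:R * c) = al z - n%:R * b.
  elim: n => [|n IH]; first by rewrite !mul0r addr0 subr0.
  have := alc (z + n%:R * c); rewrite IH => e.
  rewrite -natr1 !mulrDl !mul1r addrA opprD addrA e; ring.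
case=> n z; first exact: nat_case.
have := nat_case n.+1 (z - n.+1%:R * c); rewrite subrK => ->.
have -> : (Negz n)%:~R = - n.+1%:R :> R[i] by rewrite NegzE mulrNz.
by rewrite !mulNr opprK subrK.
Qed.

(** The coordinates are given by Cramer's rule. The matrix of (c1, c2) has diagonal entries between
    3 N and 5 N and the others at most N in absolute value, so its determinant is at least 9 N^2 -
    N^2, and the numerators are bounded by (5 N + N) |z|. *)
Lemma independent_coords (N : R) (c1 c2 : R[i]) : 0 < N ->
  cmod (((4 * N)%:C)%C - c1) <= N -> cmod ('i%C * ((4 * N)%:C)%C - c2) <= N ->
  exists2 K : R, 0 <= K & forall z, exists s t : R,
    [/\ z = (s%:C)%C * c1 + (t%:C)%C * c2, `|s| <= K * cmod z & `|t| <= K * cmod z].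
Proof.
move=> N0; case: c1 => a b; case: c2 => c d h1 h2.
have := le_trans (Re_le_cmod _) h1; have := le_trans (Im_le_cmod _) h1.
have := le_trans (Re_le_cmod _) h2; have := le_trans (Im_le_cmod _) h2.
rewrite /= !ler_norml => /andP[d1 d2] /andP[e1 e2] /andP[b1 b2] /andP[a1 a2].
have a3 : 3 * N <= a by lra.
have a4 : a <= 5 * N by lra.
have b3 : b <= N by lra.
have b4 : - N <= b by lra.
have c3 : c <= N by lra.
have c4 : - N <= c by lra.
have d3 : d <= 5 * N by lra.
have d4 : 3 * N <= d by lra.
clear h1 h2 d1 d2 e1 e2 b1 b2 a1 a2.
pose D := a * d - b * c.
have D0 : 8 * N ^+ 2 <= D by rewrite /D; nra.
have Dp : 0 < D by apply: lt_le_trans D0; rewrite mulr_gt0 // exprn_gt0.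
exists (6 * N / D) => [|[x y]]; first by rewrite divr_ge0 ?mulr_ge0 // ltW.
exists ((x * d - y * c) / D), ((a * y - b * x) / D).
have xz := Re_le_cmod (Complex x y); have yz := Im_le_cmod (Complex x y).
rewrite /= in xz yz; set Z := cmod _ in xz yz *.
have Dn : D != 0 by rewrite gt_eqF.
have bound (p q r w : R) : `|p| <= Z -> `|q| <= Z -> `|r| <= 5 * N -> `|w| <= N ->
    `|(p * r - q * w) / D| <= 6 * N / D * Z.
  move=> pZ qZ rN wN; rewrite normrM normfV (gtr0_norm Dp) mulrAC ler_pM2r ?invr_gt0 //.
  apply: le_trans (ler_normB _ _) _; rewrite !normrM.
  have : `|p| * `|r| <= Z * (5 * N) by rewrite ler_pM.
  have : `|q| * `|w| <= Z * N by rewrite ler_pM.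
  by lra.
split.
- apply/eqP; rewrite eq_complex /=; apply/andP; split; apply/eqP; rewrite /D in Dn *; by field.
- by apply: bound => //; rewrite ler_norml; lra.
- have -> : a * y - b * x = y * a - x * b by ring.
  by apply: bound => //; rewrite ler_norml; lra.
Qed.

(** Integer parts of the real coordinates reduce z to a bounded set at the cost of n1 b1 + n2 b2,
    and n1, n2 grow at most linearly in |z|. *)
Lemma quasi_periodic_linear_growth (al : R[i] -> R[i]) c1 c2 b1 b2 (K : R) :
  (forall z, ccts al z) ->
  (forall z, al z = al (z + c1) + b1) -> (forall z, al z = al (z + c2) + b2) ->
  0 <= K -> (forall z, exists s t : R,
    [/\ z = (s%:C)%C * c1 + (t%:C)%C * c2, `|s| <= K * cmod z & `|t| <= K * cmod z]) ->
  exists C : R, forall z, cmod (al z) <= C * (1 + cmod z).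
Proof.
move=> ac p1 p2 K0 dec.
have r0 : 0 <= cmod c1 + cmod c2 by rewrite addr_ge0 ?cmod_ge0.
have [|w0 w0r wmax] := @disc_max R (fun w : Cx R => cmod (al w)) 0 _ r0.
  by move=> z _; apply: (@cfor_cmod R (Cx R) al); exact/cctsP.
exists (cmod (al w0) + (K + 1) * (cmod b1 + cmod b2)) => z.
have [s [t [zE sK tK]]] := dec z.
pose n1 := Num.floor s; pose n2 := Num.floor t.
pose r := z - n1%:~R * c1 - n2%:~R * c2.
have rE : r = ((s - n1%:~R)%:C)%C * c1 + ((t - n2%:~R)%:C)%C * c2.
  by rewrite /r zE !rmorphB /= !rmorph_int; ring.
have fl (x : R) : 0 <= x - (Num.floor x)%:~R < 1.
  by rewrite subr_ge0 floor_le_tmp ltrBlDl -intrD1 floorD1_gt.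
have rr : cmod (r - 0) <= cmod c1 + cmod c2.
  rewrite subr0 rE; apply: le_trans (cmodD _ _) _; rewrite !cmodM !cmodC.
  have /andP[s0 s1] := fl s; have /andP[t0 t1] := fl t.
  by rewrite !ger0_norm //; apply: lerD; apply: ler_piMl; rewrite ?cmod_ge0 // ltW.
have alE : al z = al r - n1%:~R * b1 - n2%:~R * b2.
  have -> : z = r + n1%:~R * c1 + n2%:~R * c2 by rewrite /r; ring.
  by rewrite (quasi_periodic_int p2) (quasi_periodic_int p1).
have cn (n : int) : cmod (n%:~R) = `|n%:~R| :> R.
  by rewrite -(rmorph_int (real_complex R)) cmodC.
have nb (x : R) : `|x| <= K * cmod z -> `|(Num.floor x)%:~R| <= (K + 1) * (1 + cmod z) :> R.
  move=> xK; have /andP[h1 h2] := fl x; have cz := cmod_ge0 z.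
  have := ler_normB x (x - (Num.floor x)%:~R).
  rewrite opprB addrC subrK (ger0_norm h1); nra.
have h1 : cmod (n1%:~R * b1) <= (K + 1) * (1 + cmod z) * cmod b1.
  by rewrite cmodM cn ler_wpM2r ?cmod_ge0 // nb.
have h2 : cmod (n2%:~R * b2) <= (K + 1) * (1 + cmod z) * cmod b2.
  by rewrite cmodM cn ler_wpM2r ?cmod_ge0 // nb.
have h3 := wmax r rr.
rewrite alE; apply: le_trans (cmodB _ _) _.
have := cmodB (al r) (n1%:~R * b1).
have : 0 <= cmod (al w0) * cmod z by rewrite mulr_ge0 ?cmod_ge0.
lra.
Qed.

End QuasiPeriodic.

(** * Real and complex differentiability in several variables *)

Section DifferentiableEps.
Variables (K : numFieldType) (V W : normedModType K).

Lemma differentiable_eps (f : V -> W) x (e : K) : differentiable f x -> 0 < e ->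
  \forall h \near (0 : V), `|f (x + h) - f x - 'd f x h| <= e * `|h|.
Proof.
move=> /diff_locally /eqaddoP/(_ _) H e0.
have := H e e0; apply: filterS => h /=.
rewrite !fctE /= /shift /= [h + x]addrC; apply: le_trans.
by rewrite le_eqVlt; apply/orP; left; apply/eqP; congr `|_|; rewrite opprD addrA.
Qed.

Lemma eps_differentiable (f : V -> W) x (L : {linear V -> W}) : continuous L ->
  (forall e : K, 0 < e ->
    \forall h \near (0 : V), `|f (x + h) - f x - L h| <= e * `|h|) ->
  differentiable f x /\ 'd f x = L :> (V -> W).
Proof.
move=> Lc H.
have E : f \o shift x = cst (f x) + L +o_ (0 : V) id.
  apply/eqaddoP => e e0; have := H e e0; apply: filterS => h /=.
  rewrite !fctE /= /shift /= [h + x]addrC; apply: le_trans.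
  by rewrite le_eqVlt; apply/orP; left; apply/eqP; congr `|_|; rewrite opprD addrA.
have dL := diff_unique Lc E.
split=> //; apply/diff_locallyP; rewrite dL; split => //.
Qed.

End DifferentiableEps.

Section MxNorm.
Variables (K : numDomainType) (m n : nat).

Lemma mx_norm_le (x : 'M[K]_(m, n)) (c : K) : 0 <= c ->
  (forall i j, `|x i j| <= c) -> `|x| <= c.
Proof.
move=> /nonnegP[{}c] xc; rewrite [leLHS]mx_normE num_le; apply/bigmax_leP.
by split=> [|[i j] _]; [rewrite -num_le /=|rewrite -num_le /=; exact: xc].
Qed.

Lemma mx_norm_ge (x : 'M[K]_(m, n)) i j : `|x i j| <= `|x|.
Proof.
rewrite [leRHS]mx_normE -[leLHS]nngE num_le.
exact: (le_bigmax _ (fun i : 'I_m * 'I_n => `|x i.1 i.2|%:nng) (i, j)).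
Qed.

End MxNorm.

Section RealCoordinates.
Variables (R : realType) (k : nat).
Implicit Types (z w : Cvec R k) (e v : 'rV[R]_(k + k)).

(* Multiplication by [i] on C^k = R^(2k), acting on row vectors. *)
Definition Jmx : 'M[R]_(k + k) := block_mx 0 1%:M (- 1%:M) 0.

Definition ccoord (j : 'I_k) e : R[i] := Complex (e 0 (lshift k j)) (e 0 (rshift k j)).

Lemma ccoord_inj e v : (forall j, ccoord j e = ccoord j v) -> e = v.
Proof.
move=> H; apply/rowP => i; case: (split_ordP i) => j ->.
  by have [] := H j.
by have [] := H j.
Qed.

Lemma ccoord_toR z j : ccoord j (toR z) = z 0 j.
Proof.
rewrite /ccoord /toR row_mxEl row_mxEr !mxE.
by case: (z 0 j).
Qed.

Lemma ofR_ccoord e j : ofR e 0 j = ccoord j e.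
Proof. by rewrite /ofR !mxE. Qed.

Lemma toRK z : ofR (toR z) = z.
Proof. by apply/rowP => j; rewrite ofR_ccoord ccoord_toR. Qed.

Lemma ofRK e : toR (ofR e) = e.
Proof. by apply: ccoord_inj => j; rewrite ccoord_toR ofR_ccoord. Qed.

Lemma ccoordD j e v : ccoord j (e + v) = ccoord j e + ccoord j v.
Proof. by rewrite /ccoord !mxE. Qed.

Lemma ccoordN j e : ccoord j (- e) = - ccoord j e.
Proof. by rewrite /ccoord !mxE. Qed.

Lemma ccoordB j e v : ccoord j (e - v) = ccoord j e - ccoord j v.
Proof. by rewrite ccoordD ccoordN. Qed.

Lemma ccoord0 j : ccoord j 0 = 0.
Proof. by rewrite /ccoord !mxE. Qed.

Lemma ccoordZ j (t : R) e : ccoord j (t *: e) = (t%:C)%C * ccoord j e.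
Proof. by rewrite /ccoord !mxE; apply/eqP; rewrite eq_complex /= !mul0r subr0 addr0 !eqxx. Qed.

Lemma ccoordJ j e : ccoord j (e *m Jmx) = 'i%C * ccoord j e.
Proof.
rewrite -[e in LHS]hsubmxK /Jmx mul_row_block !mulmx0 !mulmx1 mulmxN mulmx1 add0r addr0.
rewrite /ccoord row_mxEl row_mxEr !mxE; apply/eqP.
by rewrite eq_complex /= !mul0r !mul1r sub0r add0r !eqxx.
Qed.

Lemma toRD z w : toR (z + w) = toR z + toR w.
Proof. by apply: ccoord_inj => j; rewrite ccoordD !ccoord_toR mxE. Qed.

Lemma toRN z : toR (- z) = - toR z.
Proof. by apply: ccoord_inj => j; rewrite ccoordN !ccoord_toR mxE. Qed.

Lemma toRB z w : toR (z - w) = toR z - toR w.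
Proof. by rewrite toRD toRN. Qed.

Lemma ofRD e v : ofR (e + v) = ofR e + ofR v.
Proof. by rewrite -[e in LHS]ofRK -[v in LHS]ofRK -toRD toRK. Qed.

Lemma ofR0 : ofR (0 : 'rV[R]_(k + k)) = 0.
Proof. by apply/rowP => j; rewrite ofR_ccoord ccoord0 mxE. Qed.

Lemma cmod_ccoord j e : cmod (ccoord j e) <= 2 * `|e|.
Proof.
apply: le_trans (cmod_le_ReIm _) _ => /=.
by have := mx_norm_ge e 0 (lshift k j); have := mx_norm_ge e 0 (rshift k j); lra.
Qed.

Lemma norm_ccoord e (c : R) : 0 <= c -> (forall j, cmod (ccoord j e) <= c) -> `|e| <= c.
Proof.
move=> c0 ec; apply: mx_norm_le => // i0 i; rewrite ord1.
case: (split_ordP i) => j ->; apply: le_trans (ec j).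
  exact: (Re_le_cmod (ccoord j e)).
exact: (Im_le_cmod (ccoord j e)).
Qed.

Lemma Cvec_norm_le z (c : R) : 0 <= c -> (forall j, cmod (z 0 j) <= c) ->
  `|z| <= (c%:C)%C.
Proof.
move=> c0 zc; apply: mx_norm_le; first by rewrite lecR.
by move=> i j; rewrite ord1 normcmod lecR.
Qed.

Lemma Cvec_norm_ge z j : ((cmod (z 0 j))%:C)%C <= `|z|.
Proof. by rewrite -normcmod; exact: mx_norm_ge. Qed.

Lemma Cvec_norm_toR z : (`|toR z|%:C)%C <= `|z|.
Proof.
have z0 : (0 : R[i]) <= `|z| by apply: normr_ge0.
have [c zc] : exists c, `|z| = (c%:C)%C.
  by exists (complex.Re `|z|); rewrite {1}[`|z|]complexE (ger0_Im z0) mulr0 addr0.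
have c0 : 0 <= c by rewrite -ler0c -[X in _ <= X]zc; apply: normr_ge0.
rewrite zc lecR; apply: norm_ccoord => // j; rewrite ccoord_toR -lecR -zc.
exact: Cvec_norm_ge.
Qed.

Lemma Cvec_norm_toR2 z : `|z| <= ((2 * `|toR z|)%:C)%C.
Proof.
apply: Cvec_norm_le; first by rewrite mulr_ge0.
by move=> j; rewrite -ccoord_toR; exact: cmod_ccoord.
Qed.

Lemma gt0_complex (e : R[i]) : 0 < e -> exists2 c : R, 0 < c & e = (c%:C)%C.
Proof.
case: e => a b; rewrite ltcE /= => /andP[/eqP -> a0]; exists a => //.
Qed.

Lemma nbhs_toR z (A : set (Cvec R k)) :
  nbhs z A <-> nbhs (toR z) (fun e => A (ofR e)).
Proof.
split=> [/nbhs_normP[e /= /gt0_complex[c c0 ->] eA]|/nbhs_normP[c /= c0 cA]].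
  apply/(@nbhs_normP R _ (toR z) (fun e => A (ofR e))); exists (c / 2) => /=; first by rewrite divr_gt0.
  move=> v /= zv; apply: eA => /=; apply: le_lt_trans (Cvec_norm_toR2 _) _.
  by rewrite ltcR toRB ofRK; lra.
apply/(@nbhs_normP _ _ z A); exists ((c%:C)%C) => /=; first by rewrite ltcR.
move=> w /= zw; rewrite -[w]toRK; apply: cA => /=; rewrite -toRB -ltcR.
exact: le_lt_trans (Cvec_norm_toR _) zw.
Qed.

End RealCoordinates.

Section ComplexDifferentiable.
Variables (R : realType).

Lemma ofRZ k (t : R) (e : 'rV[R]_(k + k)) : ofR (t *: e) = (t%:C)%C *: ofR e.
Proof. by apply/rowP => j; rewrite ofR_ccoord ccoordZ mxE ofR_ccoord. Qed.

Lemma toRZ k (t : R) (z : Cvec R k) : toR ((t%:C)%C *: z) = t *: toR z.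
Proof. by apply: ccoord_inj => j; rewrite ccoordZ !ccoord_toR mxE. Qed.

Lemma ofRJ k (e : 'rV[R]_(k + k)) : ofR (e *m Jmx R k) = 'i%C *: ofR e.
Proof. by apply/rowP => j; rewrite ofR_ccoord ccoordJ mxE ofR_ccoord. Qed.

Lemma toRJ k (z : Cvec R k) : toR ('i%C *: z) = toR z *m Jmx R k.
Proof. by apply: ccoord_inj => j; rewrite ccoordJ !ccoord_toR mxE. Qed.

Lemma toR_continuous k : continuous (@toR R k).
Proof.
move=> z A Az; apply/nbhs_toR; move: Az.
by apply: filterS => e; rewrite /= ofRK.
Qed.

Lemma ofR_continuous k : continuous (@ofR R k).
Proof. by move=> e A /nbhs_toR; rewrite ofRK. Qed.

Variables (p q : nat) (f : Cvec R p -> Cvec R q) (x : Cvec R p).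

Lemma differentiable_realify : differentiable f x ->
  differentiable (realify f) (toR x) /\
  forall e, 'd (realify f) (toR x) e = toR ('d f x (ofR e)).
Proof.
move=> df.
pose L e := toR ('d f x (ofR e)).
have Llin : linear L by move=> t u v; rewrite /L ofRD ofRZ linearP toRD toRZ.
pose Lp : {linear 'rV[R]_(p + p) -> 'rV[R]_(q + q)} :=
  HB.pack L (GRing.isLinear.Build _ _ _ _ L Llin).
have dc := diff_continuous df.
have Lc : continuous Lp.
  move=> e; apply: (@continuous_comp _ _ _ (fun e => 'd f x (ofR e)) (@toR R q)).
    by apply: (@continuous_comp _ _ _ (@ofR R p) ('d f x)); [exact: ofR_continuous|exact: dc].
  exact: toR_continuous.
have [|d1 d2] := @eps_differentiable R _ _ (realify f) (toR x) Lp Lc; last first.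
  by split => // e; rewrite d2.
move=> e e0; have e2 : (0 : R[i]) < ((e / 2)%:C)%C by rewrite ltcR divr_gt0.
have := differentiable_eps df e2; move=> /nbhs_toR.
have -> : toR (0 : Cvec R p) = 0 by rewrite -[0 in RHS]ofRK ofR0.
apply: filterS => h H; rewrite /realify /= toRK -[h in toR x + h]ofRK -toRD toRK.
rewrite /L -!toRB -lecR; apply: le_trans (Cvec_norm_toR _) _.
apply: le_trans H _; apply: le_trans (ler_wpM2l (ltW e2) (Cvec_norm_toR2 _)) _.
by rewrite -rmorphM lecR ofRK; lra.
Qed.

(** The Cauchy-Riemann criterion: commutation with [Jmx] makes the real differential linear over
    [R[i]]. *)
Lemma realify_differentiable : differentiable (realify f) (toR x) ->
  (forall e, 'd (realify f) (toR x) (e *m Jmx R p) =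
    'd (realify f) (toR x) e *m Jmx R q) -> differentiable f x.
Proof.
move=> df dJ.
pose d := 'd (realify f) (toR x).
pose L (z : Cvec R p) : Cvec R q := ofR (d (toR z)).
have Llin : linear L.
  move=> c u v; rewrite /L toRD linearD ofRD; congr (_ + _).
  rewrite {1}[c]complexE scalerDl -scalerA toRD linearD ofRD !toRZ toRJ toRZ.
  rewrite dJ !linearZ /= -!scalemxAl !ofRZ ofRJ.
  by rewrite [c in RHS]complexE scalerDl scalerA mulrC.
pose Lp : {linear Cvec R p -> Cvec R q} :=
  HB.pack L (GRing.isLinear.Build _ _ _ _ L Llin).
have dc := diff_continuous df.
have Lc : continuous Lp.
  move=> e; apply: (@continuous_comp _ _ _ (fun e => d (toR e)) (@ofR R q)).
    by apply: (@continuous_comp _ _ _ (@toR R p) d); [exact: toR_continuous|exact: dc].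
  exact: ofR_continuous.
have [|//] := @eps_differentiable R[i] _ _ f x Lp Lc.
move=> e /gt0_complex[c c0 ->]; apply/nbhs_toR.
have -> : toR (0 : Cvec R p) = 0 by rewrite -[0 in RHS]ofRK ofR0.
have c2 : 0 < c / 2 by rewrite divr_gt0.
have := differentiable_eps df c2; apply: filterS => h H.
apply: le_trans (Cvec_norm_toR2 _) _.
apply: (@le_trans _ _ (((c * `|h|)%:C)%C)).
  rewrite lecR; move: H; rewrite /realify ofRD toRK !toRB ofRK /L ofRK => H.
  by lra.
rewrite rmorphM /=; apply: ler_wpM2l; first by rewrite lecR ltW.
by rewrite -[h in `|h|]ofRK; exact: Cvec_norm_toR.
Qed.

End ComplexDifferentiable.

(** * Differentiability of implicitly defined maps *)

Section RealCalculus.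
Variable R : realType.

Lemma mulmx_bound n k (v : 'rV[R]_n) (N : 'M[R]_(n, k)) :
  `|v *m N| <= n%:R * `|N| * `|v|.
Proof.
apply: mx_norm_le; first by rewrite !mulr_ge0.
move=> i j; rewrite mxE; apply: le_trans (ler_norm_sum _ _ _) _.
apply: (@le_trans _ _ (\sum_(l < n) `|N| * `|v|)); last first.
  by rewrite sumr_const card_ord -[leLHS]mulr_natl mulrA.
by apply: ler_sum => l _; rewrite normrM mulrC ler_pM // mx_norm_ge.
Qed.

(** The solution [e] is given and continuous, so only the differentiability part of the implicit
    function theorem is at stake: the expansion of [A] at [e x] is solved for the increment of
    [e]. *)
Lemma implicit_differentiable (V : normedModType R) n
    (A : 'rV[R]_n -> 'rV[R]_n) (e : V -> 'rV[R]_n) (x : V) :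
  differentiable A (e x) -> injective ('d A (e x)) ->
  {for x, continuous e} -> differentiable (A \o e) x -> differentiable e x.
Proof.
move=> dA injA ce dAe.
pose M := lin1_mx ('d A (e x)).
have ME v : v *m M = 'd A (e x) v by rewrite mul_rV_lin1.
have uM : M \in unitmx.
  rewrite -row_free_unit -kermx_eq0; apply/eqP/row_matrixP => i.
  rewrite row0; apply: injA; rewrite linear0 -ME.
  by apply/sub_kermxP; exact: row_sub.
pose D := 'd (A \o e) x.
pose L h := D h *m invmx M.
have Llin : linear L by move=> c u v; rewrite /L linearP mulmxDl scalemxAl.
pose Lp : {linear V -> 'rV[R]_n} :=
  HB.pack L (GRing.isLinear.Build _ _ _ _ L Llin).
pose C := n%:R * `|invmx M|.
have C0 : 0 <= C by rewrite mulr_ge0.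
have [K K0 DK] := linear_lipschitz (diff_continuous dAe).
have Lb h : `|L h| <= C * K * `|h|.
  by rewrite -mulrA; apply: le_trans (mulmx_bound _ _) _; apply: ler_wpM2l.
have CK : 0 <= C * K by rewrite mulr_ge0 // ltW.
have Lc : continuous Lp.
  apply: bounded_linear_continuous.
  apply/linear_boundedP; near=> r => y; apply: le_trans (Lb y) _.
  by apply: ler_wpM2r => //; near: r; exact: nbhs_pinfty_ge.
suff : forall eps : R, 0 < eps ->
    \forall h \near (0 : V), `|e (x + h) - e x - L h| <= eps * `|h|.
  by move/(@eps_differentiable R V _ e x Lp Lc) => [].
move=> eps eps0.
(* The first bound gives C eta <= 1/2, which lets the term in the increment k of [e] be absorbed:
   |k| <= (2 C K + 1) |h|. The error C eta (|h| + |k|) is then at most 2 C (C K + 1) eta |h|, and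
   the second bound brings this below eps |h|. *)
pose eta := Num.min ((2 * (C + 1))^-1) (eps / (2 * (C + 1) * (C * K + 1))).
have C1 : 0 < C + 1 by lra.
have CK1 : 0 < C * K + 1 by lra.
have eta0 : 0 < eta.
  by rewrite lt_min invr_gt0; apply/andP; split; rewrite ?divr_gt0 ?mulr_gt0.
have eta1 : C * eta <= 1 / 2.
  apply: (@le_trans _ _ ((C + 1) * (2 * (C + 1))^-1)).
    by apply: ler_pM => //; [rewrite ltW|lra|rewrite ge_min lexx].
  by rewrite invfM mulrCA mulfV ?gt_eqF //; lra.
have eta2 : 2 * C * (C * K + 1) * eta <= eps.
  apply: (@le_trans _ _ (2 * (C + 1) * (C * K + 1) * (eps / (2 * (C + 1) * (C * K + 1))))).
    apply: ler_pM => //; [by rewrite !mulr_ge0 // ltW|by rewrite ltW| |].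
      by rewrite ler_pM2r //; lra.
    by rewrite ge_min lexx orbT.
  by rewrite mulrC divfK // gt_eqF // !mulr_gt0.
have kc : (fun h => e (x + h) - e x) @ (0 : V) --> (0 : 'rV[R]_n).
  rewrite -(subrr (e x)); apply: cvgB; last exact: cvg_cst.
  have : {for (0 : V), continuous (e \o (fun h : V => x + h))}.
    apply: continuous_comp; last by rewrite addr0.
    by apply: cvgD; [exact: cvg_cst|exact: cvg_id].
  by rewrite /prop_for /continuous_at /= addr0.
have h1 : \forall h \near (0 : V),
    `|A (e x + (e (x + h) - e x)) - A (e x) - 'd A (e x) (e (x + h) - e x)|
    <= eta * `|e (x + h) - e x| := kc _ (differentiable_eps dA eta0).
have h2 := differentiable_eps dAe eta0.
apply: filterS2 h1 h2 => h; rewrite /=; set k := e (x + h) - e x.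
have ek : e (x + h) = e x + k by rewrite /k addrCA subrr addr0.
rewrite -ME ek -/D => h1 h2.
have kLE : k - L h = (k *m M - D h) *m invmx M.
  by rewrite mulmxBl mulmxK.
have h3 : `|k - L h| <= C * (eta * `|h| + eta * `|k|).
  rewrite kLE; apply: le_trans (mulmx_bound _ _) _; apply: ler_wpM2l => //.
  set a := A (e x + k) - A (e x) in h1 h2.
  rewrite (_ : k *m M - D h = (a - D h) - (a - k *m M)); last first.
    by rewrite opprB [RHS]addrC addrA subrK.
  by apply: le_trans (ler_normB _ _) _; lra.
have h4 : `|k| <= `|k - L h| + `|L h| by rewrite -{1}[k](subrK (L h)) ler_normD.
have h5 := Lb h.
have n0 : 0 <= `|h| by [].
have n1 : 0 <= `|k| by [].
have h6 : `|k| <= (2 * (C * K) + 1) * `|h|.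
  have : C * eta * `|k| <= 1 / 2 * `|k| by rewrite ler_wpM2r.
  have : C * eta * `|h| <= 1 / 2 * `|h| by rewrite ler_wpM2r.
  move: h3 h4 h5; set X := `|_ - _|; set Y := `|L h|; set H := `|h|; set K' := `|k|.
  clear; lra.
apply: le_trans h3 _.
have : C * eta * `|k| <= C * eta * ((2 * (C * K) + 1) * `|h|).
  by rewrite ler_wpM2l // mulr_ge0 // ltW.
have : 2 * C * (C * K + 1) * eta * `|h| <= eps * `|h| by rewrite ler_wpM2r.
lra.
Unshelve. all: by end_near. Qed.

End RealCalculus.

(** * Symmetry of second derivatives *)

Section Schwarz.
Variable R : realType.

Lemma line_derive (V W : normedModType R) (f : V -> W) q u (s : R) :
  derivable f (q + s *: u) u ->
  is_derive s 1 (fun t => f (q + t *: u)) ('D_u f (q + s *: u)).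
Proof.
have E : (fun h : R => h^-1 *: (((fun t => f (q + t *: u)) \o shift s) (h *: 1)
    - f (q + s *: u))) =
  (fun h => h^-1 *: ((f \o shift (q + s *: u)) (h *: u) - f (q + s *: u))).
  apply/funext => h; rewrite /= /shift /= -[h%:A]/(h * 1) mulr1 scalerDl.
  by rewrite addrCA.
by move=> du; split; [rewrite /derivable E|rewrite /derive E].
Qed.

Variable V : normedModType R.

Lemma MVT_line (f : V -> R) q u (r : R) : 0 < r ->
  (forall s, 0 <= s <= r -> derivable f (q + s *: u) u) ->
  exists2 c, 0 < c < r & f (q + r *: u) - f q = r * 'D_u f (q + c *: u).
Proof.
move=> r0 df.
have [x||c] := @MVT R (fun t => f (q + t *: u)) (fun s => 'D_u f (q + s *: u)) 0 r r0.
- rewrite in_itv /= => /andP[/ltW x0 /ltW xr]; apply: line_derive.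
  by apply: df; rewrite x0.
- apply: continuous_in_subspaceT => x; rewrite inE /= in_itv /= => xr.
  have [dx _] := line_derive (df _ xr).
  by apply: differentiable_continuous; apply/derivable1_diffP.
rewrite in_itv /= => cr; rewrite subr0 scale0r addr0 mulrC => e.
by exists c.
Qed.

Lemma second_difference (f : V -> R) p u v (r : R) : 0 < r ->
  (forall s t, 0 <= s <= r -> 0 <= t <= r ->
    derivable f (p + s *: u + t *: v) u /\
    derivable ('D_u f) (p + s *: u + t *: v) v) ->
  exists c c', [/\ 0 < c < r, 0 < c' < r &
    f (p + r *: u + r *: v) - f (p + r *: u) - (f (p + r *: v) - f p) =
    r * (r * 'D_v ('D_u f) (p + c *: u + c' *: v))].
Proof.
move=> r0 df.
have rr : 0 <= r <= r by apply/andP; split; [exact: ltW|].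
have r00 : 0 <= (0 : R) <= r by apply/andP; split; [|exact: ltW].
pose g q := f (q + r *: v) - f q.
have dshift s : 0 <= s <= r -> is_derive (p + s *: u) u (fun q => f (q + r *: v))
    ('D_u f (p + s *: u + r *: v)).
  move=> sr; have [d _] := df _ _ sr rr.
  have E : (fun h : R => h^-1 *: (((fun q => f (q + r *: v)) \o shift (p + s *: u)) (h *: u)
      - f (p + s *: u + r *: v))) =
    (fun h => h^-1 *: ((f \o shift (p + s *: u + r *: v)) (h *: u)
      - f (p + s *: u + r *: v))).
    by apply/funext => h; rewrite /= /shift /= !addrA.
  by split; [rewrite /derivable E|rewrite /derive E].
have d0 s : 0 <= s <= r -> is_derive (p + s *: u) u f ('D_u f (p + s *: u)).
  by move=> sr; have [d _] := df _ _ sr r00; apply/derivableP; rewrite scale0r addr0 in d.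
have dg s : 0 <= s <= r ->
    is_derive (p + s *: u) u g ('D_u f (p + s *: u + r *: v) - 'D_u f (p + s *: u)).
  by move=> sr; apply: is_deriveB; [exact: dshift|exact: d0].
have [s sr|c cr e] := @MVT_line g p u r r0.
  by have [] := dg s sr.
have cr' : 0 <= c <= r by case/andP: cr => /ltW -> /ltW.
have [t tr|c' cr'' e'] := @MVT_line ('D_u f) (p + c *: u) v r r0.
  by have [] := df _ _ cr' tr.
exists c, c'; split => //; rewrite -e' -/(g (p + r *: u)) -/(g p) e.
by have [_ ->] := dg c cr'.
Qed.

(** The second difference of [f] on the parallelogram spanned by r u and r v is symmetric in u and
    v, and by [second_difference] it is r^2 times either mixed derivative at a point close to p. *)
Lemma schwarz (f : V -> R) (p u v : V) :
  (\forall q \near p, [/\ derivable f q u, derivable f q v,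
     derivable ('D_u f) q v & derivable ('D_v f) q u]) ->
  {for p, continuous ('D_v ('D_u f))} -> {for p, continuous ('D_u ('D_v f))} ->
  'D_v ('D_u f) p = 'D_u ('D_v f) p.
Proof.
move=> nf c1 c2; apply/eqP; rewrite -subr_eq0 -normr_le0.
apply/ler_addgt0Pl => e e0; rewrite addr0.
have e2 : 0 < e / 2 by rewrite divr_gt0.
have n1 : \forall q \near p, `|'D_v ('D_u f) p - 'D_v ('D_u f) q| < e / 2.
  by move/cvgrPdist_lt : c1; apply.
have n2 : \forall q \near p, `|'D_u ('D_v f) p - 'D_u ('D_v f) q| < e / 2.
  by move/cvgrPdist_lt : c2; apply.
have [d d0 dP] : exists2 d : R, 0 < d & forall q, `|p - q| < d ->
    [/\ derivable f q u, derivable f q v, derivable ('D_u f) q v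
      & derivable ('D_v f) q u] /\
    `|'D_v ('D_u f) p - 'D_v ('D_u f) q| < e / 2 /\
    `|'D_u ('D_v f) p - 'D_u ('D_v f) q| < e / 2.
  by apply/nbhs_normP; apply: filterS3 nf n1 n2 => q.
have m0 : 0 < `|u| + `|v| + 1 by rewrite ltr_wpDl // addr_ge0.
pose r := d / (`|u| + `|v| + 1) / 2.
have r0 : 0 < r by rewrite !divr_gt0.
have inb s t : 0 <= s <= r -> 0 <= t <= r -> `|p - (p + s *: u + t *: v)| < d.
  move=> /andP[s0 sr] /andP[t0 tr].
  rewrite -addrA opprD addrA subrr sub0r normrN (le_lt_trans (ler_normD _ _)) //.
  rewrite !normrZ !ger0_norm //.
  have h1 : s * `|u| <= r * `|u| by rewrite ler_wpM2r.
  have h2 : t * `|v| <= r * `|v| by rewrite ler_wpM2r.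
  have h3 : 2 * (r * (`|u| + `|v| + 1)) = d.
    by rewrite /r; field; exact: lt0r_neq0.
  lra.
have [s t sr tr|c [c' [cr cr' E1]]] := @second_difference f p u v r r0.
  by have [[h1 h2 h3 h4] _] := dP _ (inb _ _ sr tr); split; [exact: h1|exact: h3].
have [s t sr tr|b [b' [br br' E2]]] := @second_difference f p v u r r0.
  have := dP _ (inb _ _ tr sr); rewrite -addrA [_ *: u + _]addrC addrA.
  by move=> [[h1 h2 h3 h4] _]; split; [exact: h2|exact: h4].
have oc x : 0 < x < r -> 0 <= x <= r by case/andP => /ltW -> /ltW.
have E : 'D_v ('D_u f) (p + c *: u + c' *: v) = 'D_u ('D_v f) (p + b *: v + b' *: u).
  have rn : r != 0 by rewrite gt_eqF.
  have ES : f (p + r *: u + r *: v) - f (p + r *: u) - (f (p + r *: v) - f p) =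
      f (p + r *: v + r *: u) - f (p + r *: v) - (f (p + r *: u) - f p).
    rewrite -[p + r *: v + _]addrA [r *: v + _]addrC addrA; ring.
  rewrite E1 E2 in ES; exact: (mulfI rn (mulfI rn ES)).
have [_ [h1 _]] := dP _ (inb _ _ (oc _ cr) (oc _ cr')).
have [_ [_ h2]] := dP _ (inb _ _ (oc _ br') (oc _ br)).
rewrite -addrA [b' *: u + _]addrC addrA -E in h2.
rewrite -(subrK ('D_v ('D_u f) (p + c *: u + c' *: v)) ('D_v ('D_u f) p)) -addrA.
apply: le_trans (ler_normD _ _) _.
rewrite distrC in h2; apply: le_trans (lerD (ltW h1) (ltW h2)) _.
by clear; lra.
Qed.

End Schwarz.

Section ComplexScalar.
Variables (R : realType) (k : nat).
Implicit Types (c d : R[i]) (e : 'rV[R]_(k + k)).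

(** The scalar [c] acting on C^k = R^(2k), as a real matrix on row vectors. *)
Definition cmx c : 'M[R]_(k + k) := (complex.Re c)%:M + complex.Im c *: Jmx R k.

Lemma ccoord_cmx j c e : ccoord j (e *m cmx c) = c * ccoord j e.
Proof.
rewrite mulmxDr mul_mx_scalar -scalemxAr ccoordD !ccoordZ ccoordJ mulrA -mulrDl.
by congr (_ * _); rewrite [RHS]complexE [_ * 'i%C]mulrC.
Qed.

Lemma cmxD c d e : e *m cmx (c + d) = e *m cmx c + e *m cmx d.
Proof. by apply: ccoord_inj => j; rewrite ccoordD !ccoord_cmx mulrDl. Qed.

Lemma cmx0 e : e *m cmx 0 = 0.
Proof. by apply: ccoord_inj => j; rewrite ccoord_cmx mul0r ccoord0. Qed.

Lemma cmxE c e : e *m cmx c = complex.Re c *: e + complex.Im c *: (e *m Jmx R k).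
Proof. by rewrite mulmxDr mul_mx_scalar -scalemxAr. Qed.

Lemma cmx_norm c e : `|e *m cmx c| <= 2 * `|e| * cmod c.
Proof.
apply: norm_ccoord => [|j]; first by rewrite !mulr_ge0 ?cmod_ge0.
by rewrite ccoord_cmx cmodM mulrC ler_wpM2r ?cmod_ge0 ?cmod_ccoord.
Qed.

End ComplexScalar.

Section SmoothToolkit.
Variables (R : realType) (V : normedModType R).

Definition csmooth q (U : set V) (H : V -> 'rV[R]_q) := forall k, Ck_on k U H.

Lemma csmooth_differentiable q U (H : V -> 'rV[R]_q) x :
  csmooth U H -> U x -> differentiable H x.
Proof. by move=> /(_ 1%N)[+ _]; apply. Qed.

Lemma csmooth_continuous q U (H : V -> 'rV[R]_q) x :
  csmooth U H -> U x -> {for x, continuous H}.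
Proof. by move=> /(_ 0%N); apply. Qed.

Lemma csmooth_derive q U (H : V -> 'rV[R]_q) v :
  csmooth U H -> csmooth U ('D_v H).
Proof. by move=> sH k; have [_ /(_ v)] := sH k.+1. Qed.

Lemma mulmxr_continuous n k (N : 'M[R]_(n, k)) :
  continuous (mulmxr N : 'rV[R]_n -> 'rV[R]_k).
Proof.
apply: bounded_linear_continuous; apply/linear_boundedP.
near=> r => y; apply: le_trans (mulmx_bound _ _) _.
by apply: ler_wpM2r => //; near: r; exact: nbhs_pinfty_ge.
Unshelve. all: by end_near. Qed.

Lemma derive_mulmxr n k (N : 'M[R]_(n, k)) (H : V -> 'rV[R]_n) x v :
  differentiable H x ->
  differentiable (fun y => H y *m N) x /\
  'D_v (fun y => H y *m N) x = 'D_v H x *m N.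
Proof.
move=> dH.
have dN y : differentiable (mulmxr N : 'rV[R]_n -> 'rV[R]_k) y.
  by apply: linear_differentiable; exact: mulmxr_continuous.
have dc : differentiable (mulmxr N \o H) x by exact: differentiable_comp.
split; first exact: dc.
rewrite (deriveE v dc) (deriveE v dH) diff_comp //=.
by rewrite (diff_lin _ (@mulmxr_continuous _ _ N)).
Qed.

Lemma derive_coord n (H : V -> 'rV[R]_n) x v i : differentiable H x ->
  differentiable (fun y => H y 0 i) x /\
  'D_v (fun y => H y 0 i) x = 'D_v H x 0 i.
Proof.
move=> dH; split.
  by apply: (@differentiable_comp _ _ _ _ H (fun M => M 0 i)) => //; exact: differentiable_coord.
by rewrite derive_mx ?mxE //; exact: diff_derivable.
Qed.

Lemma csmooth_derive2_coord q U (H : V -> 'rV[R]_q) x u v i : open U ->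
  csmooth U H -> U x ->
  [/\ derivable (fun y => H y 0 i) x u,
      derivable ('D_v (fun y => H y 0 i)) x u
    & 'D_u ('D_v H) x 0 i = 'D_u ('D_v (fun y => H y 0 i)) x].
Proof.
move=> oU sH Ux.
have near_U : \forall y \near x, U y by apply: open_nbhs_nbhs.
have Df : \forall z \near x, 'D_v H z 0 i = 'D_v (fun y => H y 0 i) z.
  near=> z; have Uz : U z by near: z.
  by have [_ ->] := derive_coord v i (csmooth_differentiable sH Uz).
have [dv Ev] := derive_coord u i (csmooth_differentiable (csmooth_derive v sH) Ux).
split.
- apply: diff_derivable.
  by have [] := derive_coord u i (csmooth_differentiable sH Ux).
- by apply: (near_eq_derivable Df); apply: diff_derivable.
- by rewrite -Ev; apply: near_eq_derive.
Unshelve. all: by end_near. Qed.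

Lemma csmooth_schwarz q U (H : V -> 'rV[R]_q) x u v : open U ->
  csmooth U H -> U x -> 'D_v ('D_u H) x = 'D_u ('D_v H) x.
Proof.
move=> oU sH Ux; apply/rowP => i; pose f y := H y 0 i.
have near_U : \forall y \near x, U y by apply: open_nbhs_nbhs.
have cD w w' : {for x, continuous ('D_w ('D_w' f))}.
  have cH : {for x, continuous (fun y => 'D_w ('D_w' H) y 0 i)}.
    apply: differentiable_continuous.
    by have [] := derive_coord w i
      (csmooth_differentiable (csmooth_derive w (csmooth_derive w' sH)) Ux).
  have [_ _ E] := csmooth_derive2_coord w w' i oU sH Ux.
  have E' : 'D_w ('D_w' f) x = 'D_w ('D_w' H) x 0 i by rewrite E.
  rewrite /prop_for /continuous_at E'.
  apply: cvg_trans cH; apply: near_eq_cvg; near=> y.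
  have Uy : U y by near: y.
  have [_ _ E2] := csmooth_derive2_coord w w' i oU sH Uy.
  exact: E2.
have [_ _ E1] := csmooth_derive2_coord v u i oU sH Ux.
have [_ _ E2] := csmooth_derive2_coord u v i oU sH Ux.
suff E : 'D_v ('D_u f) x = 'D_u ('D_v f) x by exact: (etrans E1 (etrans E (esym E2))).
apply: (@schwarz R V f x u v).
- apply: filterS near_U => y Uy.
  have [d1 d2 _] := csmooth_derive2_coord v u i oU sH Uy.
  have [d3 d4 _] := csmooth_derive2_coord u v i oU sH Uy.
  by split; [exact: d3|exact: d1|exact: d2|exact: d4].
- exact: cD.
- exact: cD.
Unshelve. all: by end_near. Qed.

End SmoothToolkit.

(** * Expansions of smooth maps along complex lines on which they are holomorphic *)

Section Slices.
Variable R : realType.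

(** The mean value theorem, applied to f (p + t u) minus b t + a t^2 / 2 and then to the derivative
    of [f], bounds the remainder by the oscillation of the second derivative when [a] is its value
    at p. *)
Lemma taylor_second (V : normedModType R) (f : V -> R) p u (a : R) :
  (forall s, 0 <= s <= 1 ->
    derivable f (p + s *: u) u /\ derivable ('D_u f) (p + s *: u) u) ->
  exists2 s, 0 <= s <= 1 &
    `|f (p + u) - f p - 'D_u f p - a / 2| <= `|'D_u ('D_u f) (p + s *: u) - a|.
Proof.
move=> df; pose b := 'D_u f p.
pose psi (t : R) := f (p + t *: u) - (b * t + a / 2 * t ^+ 2).
have dpoly (t : R) : is_derive t 1 (fun t : R => b * t + a / 2 * t ^+ 2) (b + a * t).
  apply: is_derive_eq; rewrite /GRing.scale /=; lra.
have dpsi (t : R) : 0 <= t <= 1 -> is_derive t 1 psi ('D_u f (p + t *: u) - (b + a * t)).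
  move=> /df[d1 _]; apply: is_deriveB; exact: line_derive.
have [x||c c01] := @MVT R psi (fun t => 'D_u f (p + t *: u) - (b + a * t)) 0 1 ltr01.
- by rewrite in_itv /= => /andP[/ltW x0 /ltW x1]; apply: dpsi; rewrite x0.
- apply: continuous_in_subspaceT => x; rewrite inE /= in_itv /= => xr.
  have [dx _] := dpsi _ xr.
  by apply: differentiable_continuous; apply/derivable1_diffP.
move: c01; rewrite in_itv /= => /andP[c0 c1].
rewrite /psi scale1r scale0r !addr0 subr0 mulr1 => e.
have [s /andP[s0 sc]|s /andP[s0 sc] e'] := @MVT_line R V ('D_u f) p u c c0.
  by have [|//] := df s; rewrite s0 (le_trans sc) // ltW.
exists s; first by rewrite ltW // (le_trans (ltW sc)) // ltW.
have -> : f (p + u) - f p - 'D_u f p - a / 2 = c * ('D_u ('D_u f) (p + s *: u) - a).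
  by rewrite mulrBr -e' -/b; move: e; rewrite !mulr0 expr0n mulr0 !mulr1; lra.
by rewrite normrM (gtr0_norm c0); apply: ler_piMl => //; exact: ltW.
Qed.

Lemma cmod_sqr_lt (eps : R) (w x y z : R[i]) : 0 < cmod w ^+ 2 ->
  cmod z <= cmod (w ^+ 2 * x) + cmod (w ^+ 2 * y) ->
  cmod x < eps / 2 -> cmod y < eps / 2 -> cmod z < cmod w ^+ 2 * eps.
Proof.
move=> w0 h h1 h2; apply: le_lt_trans h _.
by rewrite (cmodM _ x) (cmodM _ y) cmodX -mulrDr ltr_pM2l //; lra.
Qed.

(* [H] is holomorphic along the complex lines of direction [e]. *)
Definition cr_on k (U : set 'rV[R]_(k + k)) (e : 'rV[R]_(k + k))
    (H : 'rV[R]_(k + k) -> 'rV[R]_(k + k)) :=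
  forall p, U p -> 'D_(e *m Jmx R k) H p = 'D_e H p *m Jmx R k.

Variables (k : nat) (U : set 'rV[R]_(k + k)) (e : 'rV[R]_(k + k)).
Implicit Types (H : 'rV[R]_(k + k) -> 'rV[R]_(k + k)) (p v : 'rV[R]_(k + k)).
Hypothesis oU : open U.

Lemma near_open p : U p -> \forall q \near p, U q.
Proof. by move=> Up; apply: open_nbhs_nbhs. Qed.

Lemma cnear_cmx_segment (q : 'rV[R]_(k + k)) (P : 'rV[R]_(k + k) -> Prop) : nbhs q P ->
  cnear 0 (fun w => forall s : R, 0 <= s <= 1 -> P (q + s *: (e *m cmx k w))).
Proof.
move=> /nbhs_normP[d /= d0 dP].
have m0 : 0 < 2 * `|e| + 1 by rewrite ltr_wpDl // mulr_ge0.
exists (d / (2 * `|e| + 1)) => [|w]; first by rewrite divr_gt0.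
rewrite subr0 ltr_pdivlMr // => wd s /andP[s0 s1]; apply: dP => /=.
rewrite opprD addrA subrr sub0r normrN normrZ ger0_norm //.
have h := cmx_norm w e; have cw := cmod_ge0 w.
apply: le_lt_trans (_ : `|e *m cmx k w| < _); first exact: ler_piMl.
by lra.
Qed.

(** By symmetry of second derivatives. The direction [v] is arbitrary: derivatives of F across the
    leaves stay holomorphic along them. *)
Lemma cr_on_derive H v : csmooth U H -> cr_on U e H -> cr_on U e ('D_v H).
Proof.
move=> sH crH p Up; rewrite (csmooth_schwarz _ _ oU sH Up).
have -> : 'D_v ('D_(e *m Jmx R k) H) p = 'D_v (fun q => 'D_e H q *m Jmx R k) p.
  by apply: near_eq_derive; apply: filterS (near_open Up) => q; exact: crH.
have [_ ->] := derive_mulmxr (Jmx R k) v (csmooth_differentiable (csmooth_derive e sH) Up).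
by rewrite (csmooth_schwarz _ _ oU sH Up).
Qed.

Lemma cr_on_cmx H p (w : R[i]) : csmooth U H -> cr_on U e H -> U p ->
  'D_(e *m cmx k w) H p = 'D_e H p *m cmx k w.
Proof.
move=> sH crH Up; have dH := csmooth_differentiable sH Up.
rewrite !cmxE -(crH _ Up) !(deriveE _ dH) linearD !linearZ //.
Qed.

(** For u = w e the Cauchy-Riemann equation gives D_u D_u H = w^2 D_e D_e H, so the real expansion
    of order 2 along the segment of direction u is a complex one in w. *)
Lemma cr_on_taylor2 H p (z : R[i]) j : csmooth U H -> cr_on U e H ->
  U (p + e *m cmx k z) ->
  taylor2_at (fun y => ccoord j (H (p + e *m cmx k y))) z
    (ccoord j ('D_e H (p + e *m cmx k z))).
Proof.
move=> sH crH; set q := p + _ => Uq.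
pose c (w : R[i]) := ccoord j (H (q + e *m cmx k w)).
pose c2 (w : R[i]) := ccoord j ('D_e ('D_e H) (q + e *m cmx k w)).
have ncmx P := @cnear_cmx_segment q P.
have nU := ncmx _ (near_open Uq).
have sDe := csmooth_derive e sH; have sDee := csmooth_derive e sDe.
have crDe := cr_on_derive e sH crH.
pose b := ccoord j ('D_e H q).
(* Two intermediate points, since the mean value argument treats real and imaginary parts
   separately. *)
have est (w : R[i]) : (forall s : R, 0 <= s <= 1 -> U (q + s *: (e *m cmx k w))) ->
  exists s1 s2 : R, [/\ 0 <= s1 <= 1, 0 <= s2 <= 1 &
    cmod (c w - c 0 - b * w - w ^+ 2 * (c2 0 / 2)) <=
    cmod (w ^+ 2 * (c2 ((s1%:C)%C * w) - c2 0)) +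
    cmod (w ^+ 2 * (c2 ((s2%:C)%C * w) - c2 0))].
  move=> Uw; pose u := e *m cmx k w.
  have Uq0 : U (q + 0 *: u) by apply: Uw; rewrite lexx ler01.
  have DuH y : U y -> 'D_u H y = 'D_e H y *m cmx k w by move=> Uy; exact: cr_on_cmx.
  have DuuH y : U y -> ccoord j ('D_u ('D_u H) y) = w ^+ 2 * ccoord j ('D_e ('D_e H) y).
    move=> Uy.
    have -> : 'D_u ('D_u H) y = 'D_u (fun y => 'D_e H y *m cmx k w) y.
      by apply: near_eq_derive; apply: filterS (near_open Uy) => y' Uy'; exact: DuH.
    have [_ ->] := derive_mulmxr (cmx k w) u (csmooth_differentiable sDe Uy).
    by rewrite (cr_on_cmx w sDe crDe Uy) ccoord_cmx ccoord_cmx mulrA.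
  pose X := H (q + u) - H q - 'D_u H q - 2^-1 *: 'D_u ('D_u H) q.
  have EX : ccoord j X = c w - c 0 - b * w - w ^+ 2 * (c2 0 / 2).
    rewrite !ccoordB ccoordZ (DuuH _ Uq) (DuH _ Uq) ccoord_cmx /c /c2 cmx0 addr0 -/b -/u.
    have -> : ((2^-1 : R)%:C)%C = 2^-1 by rewrite fmorphV rmorph_nat.
    by ring.
  have coord i : exists2 s : R, 0 <= s <= 1 &
      `|X 0 i| <= `|('D_u ('D_u H) (q + s *: u) - 'D_u ('D_u H) q) 0 i|.
    have [s s01|s s01 E] := @taylor_second _ (fun y => H y 0 i) q u ('D_u ('D_u H) q 0 i).
      have [d1 d2 _] := csmooth_derive2_coord u u i oU sH (Uw _ s01).
      by split; [exact: d1|exact: d2].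
    exists s; first exact: s01.
    have mE (A B C D : 'rV[R]_(k + k)) :
        (A - B - C - 2^-1 *: D) 0 i = A 0 i - B 0 i - C 0 i - D 0 i / 2.
      by rewrite !mxE [D 0 i / 2]mulrC.
    have mE' (A B : 'rV[R]_(k + k)) : (A - B) 0 i = A 0 i - B 0 i by rewrite !mxE.
    rewrite mE mE'.
    have [_ _ E2] := csmooth_derive2_coord u u i oU sH (Uw _ s01).
    have [_ E1] := derive_coord u i (csmooth_differentiable sH Uq).
    have aux (a b' c0 c0' d d' d0 : R) : c0 = c0' -> d = d' ->
      `|a - b' - c0 - d0 / 2| <= `|d' - d0| -> `|a - b' - c0' - d0 / 2| <= `|d - d0|.
      by move=> -> ->.
    exact: (aux _ _ _ _ _ _ _ E1 E2 E).
  have c2E (s : R) : 0 <= s <= 1 -> w ^+ 2 * (c2 ((s%:C)%C * w) - c2 0) =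
      ccoord j ('D_u ('D_u H) (q + s *: u) - 'D_u ('D_u H) q).
    move=> s01; have e1 := DuuH _ (Uw _ s01); have e0 := DuuH _ Uq.
    have aux (A B : 'rV[R]_(k + k)) (a b' x y : R[i]) : ccoord j A = w ^+ 2 * a ->
        ccoord j B = w ^+ 2 * b' -> x = a -> y = b' ->
        w ^+ 2 * (x - y) = ccoord j (A - B).
      by move=> hA hB -> ->; rewrite ccoordB hA hB mulrBr.
    apply: (aux _ _ _ _ _ _ e1 e0); last by rewrite /c2 cmx0 addr0.
    rewrite /c2; congr (ccoord j ('D_e ('D_e H) (q + _))).
    by apply: ccoord_inj => l; rewrite ccoordZ !ccoord_cmx mulrA.
  have [s1 s1P E1] := coord (lshift k j); have [s2 s2P E2] := coord (rshift k j).
  exists s1, s2; split; [exact: s1P|exact: s2P|].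
  have aux (Y A B : 'rV[R]_(k + k)) (x y z' : R[i]) :
      ccoord j Y = z' -> x = ccoord j A -> y = ccoord j B ->
      `|Y 0 (lshift k j)| <= `|A 0 (lshift k j)| ->
      `|Y 0 (rshift k j)| <= `|B 0 (rshift k j)| -> cmod z' <= cmod x + cmod y.
    move=> <- -> -> h1 h2; apply: le_trans (cmod_le_ReIm _) _; apply: lerD.
      exact: le_trans h1 (Re_le_cmod (ccoord j A)).
    exact: le_trans h2 (Im_le_cmod (ccoord j B)).
  exact: (aux _ _ _ _ _ _ EX (c2E _ s1P) (c2E _ s2P) E1 E2).
(* The value at 0 is the limit of the quotient, half the second derivative. *)
pose kap (w : R[i]) := if w == 0 then c2 0 / 2 else (c w - c 0 - b * w) / w ^+ 2.
exists kap; split; last first.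
  apply: cnearW => h; rewrite /kap.
  have -> : p + e *m cmx k (z + h) = q + e *m cmx k h by rewrite cmxD addrA.
  rewrite -/q -/b -/(c h).
  have c0 : c 0 = ccoord j (H q) by rewrite /c cmx0 addr0.
  rewrite -c0; have [->|h0] := eqVneq h 0.
    by rewrite mulr0 expr0n mul0r !addr0.
  by rewrite [h ^+ 2 * _]mulrC divfK ?expf_neq0 //; ring.
move=> eps eps0.
have c2c : cnear 0 (fun w => forall s : R, 0 <= s <= 1 ->
    cmod (c2 ((s%:C)%C * w) - c2 0) < eps / 2).
  pose P y := cmod (ccoord j ('D_e ('D_e H) y) - ccoord j ('D_e ('D_e H) q)) < eps / 2.
  have nP : nbhs q P.
    have e4 : 0 < eps / 4 by rewrite divr_gt0.
    have := csmooth_continuous sDee Uq => /cvgrPdistC_lt/(_ _ e4).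
    apply: filterS => y yq; rewrite /P -ccoordB.
    by apply: le_lt_trans (cmod_ccoord _ _) _; lra.
  apply: cnearS (ncmx _ nP) => w Pw s s01; have := Pw _ s01; rewrite /P /c2 cmx0 addr0.
  have -> // : e *m cmx k ((s%:C)%C * w) = s *: (e *m cmx k w).
  by apply: ccoord_inj => l; rewrite ccoordZ !ccoord_cmx mulrA.
apply: cnearS2 nU c2c => w Uw cw; rewrite /kap eqxx.
have [_|w0] := eqVneq w 0; first by rewrite subrr cmod0.
have [s1 [s2 [s1P s2P E]]] := est w Uw.
have w2 : 0 < cmod w ^+ 2 by rewrite exprn_gt0 // cmod_gt0.
rewrite -(ltr_pM2l w2) -{1}cmodX -cmodM mulrBr [w ^+ 2 * (_ / _)]mulrC divfK ?expf_neq0 //.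
exact: (cmod_sqr_lt w2 E (cw _ s1P) (cw _ s2P)).
Qed.

End Slices.

Section BallOpen.
Variable R : realType.

Lemma unit_ballE m (x : Cvec R m) :
  unit_ball R m x <-> \sum_(j < m) cmod (x 0 j) ^+ 2 < 1.
Proof.
have E : \sum_(j < m) `|(x 0 j : R[i])| ^+ 2 = ((\sum_(j < m) cmod (x 0 j) ^+ 2)%:C)%C.
  by rewrite rmorph_sum; apply: eq_bigr => j _; rewrite normcmod -rmorphXn.
by rewrite /unit_ball /mkset E (ltcR _ 1).
Qed.

Lemma cfor_sum (T : topologicalType) n (f : 'I_n -> T -> R) (x : T) :
  (forall j, {for x, continuous (f j)}) ->
  {for x, continuous (fun e => \sum_(j < n) f j e)}.
Proof.
elim: n f => [|n IH] f fc.
  have -> : (fun e => \sum_(j < 0) f j e) = (fun=> 0).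
    by apply/funext => e; rewrite big_ord0.
  exact: cst_continuous.
have -> : (fun e => \sum_(j < n.+1) f j e) =
    (fun e => \sum_(j < n) f (widen_ord (leqnSn n) j) e) + f ord_max.
  by apply/funext => e; rewrite big_ord_recr.
by apply: continuousD; [exact: IH|exact: fc].
Qed.

Lemma nbhs_unit_ball m (x : Cvec R m) : unit_ball R m x -> nbhs x (unit_ball R m).
Proof.
move=> /unit_ballE xB; apply/nbhs_toR.
pose g (e : 'rV[R]_(m + m)) := \sum_(j < m)
  (e 0 (lshift m j) * e 0 (lshift m j) + e 0 (rshift m j) * e 0 (rshift m j)).
have gE e : g e = \sum_(j < m) cmod (ofR e 0 j) ^+ 2.
  by apply: eq_bigr => j _; rewrite ofR_ccoord cmod_sqr.
have gc : {for toR x, continuous g}.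
  have cc i : {for toR x, continuous (fun e : 'rV[R]_(m + m) => e 0 i)}.
    exact: coord_continuous.
  apply: cfor_sum => j.
  exact: (continuousD (continuousM (cc (lshift m j)) (cc (lshift m j)))
    (continuousM (cc (rshift m j)) (cc (rshift m j)))).
have : \forall e \near toR x, g e < 1.
  by move/cvgr_lt : gc; apply; rewrite gE toRK.
by apply: filterS => e; rewrite gE => eB; apply/unit_ballE.
Qed.

End BallOpen.

Section LineDerivative.
Variables (R : realType) (V W : normedModType R).

Lemma derive_line (f : V -> W) p w : 'D_w f p = 'D_1 (fun h : R => f (h *: w + p)) 0.
Proof.
rewrite /derive.
have -> // : (fun h : R => h^-1 *: ((f \o shift p) (h *: w) - f p)) =
  (fun h => h^-1 *: (((fun h : R => f (h *: w + p)) \o shift 0) (h *: 1) - f (0 *: w + p))).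
apply/funext => h.
by rewrite /= /shift /= -[h%:A]/(h * 1) mulr1 addr0 scale0r add0r.
Qed.

Lemma derive_line_near (f g : V -> W) p w :
  (\forall h \near (0 : R), f (h *: w + p) = g (h *: w + p)) -> 'D_w f p = 'D_w g p.
Proof. by move=> fg; rewrite !derive_line; exact: near_eq_derive. Qed.

Lemma derive_line_near2 (f : V -> W) p q w :
  (forall h : R, f (h *: w + p) = f (h *: w + q)) -> 'D_w f p = 'D_w f q.
Proof.
move=> fpq; rewrite !derive_line.
by have -> : (fun h : R => f (h *: w + p)) = (fun h => f (h *: w + q)) by exact/funext.
Qed.

Lemma near_line (P : set V) p w : nbhs p P -> \forall h \near (0 : R), P (h *: w + p).
Proof.
move=> pP; have : (fun h : R => h *: w + p) @ (0 : R) --> 0 *: w + p.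
  by apply: cvgD; [apply: cvgZr_tmp; exact: cvg_id|exact: cvg_cst].
by rewrite scale0r add0r => /(_ _ pP).
Qed.

End LineDerivative.

(** * Real coordinates on C^m x C *)

Section Coordinates.
Variables (R : realType) (m : nat).
Implicit Types (x u : Cvec R m) (y : R[i]) (p : 'rV[R]_((m + 1) + (m + 1))).

Definition lastc : 'I_(m + 1) := rshift m ord0.

(** The point (x, y) of C^m x C in real coordinates. As tangent vectors, [ey] is the direction of y,
    along the leaves, and [hx u] the direction u in the parameter x. *)
Definition pt x y : 'rV[R]_((m + 1) + (m + 1)) :=
  toR (row_mx x (const_mx y : 'rV[R[i]^o]_1) : Cvec R (m + 1)).
Definition ey := pt 0 1.
Definition hx u := pt u 0.

Lemma ccoord_pt_l x y i : ccoord (lshift 1 i) (pt x y) = x 0 i.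
Proof. by rewrite ccoord_toR row_mxEl. Qed.

Lemma ccoord_pt_r x y : ccoord lastc (pt x y) = y.
Proof. by rewrite ccoord_toR row_mxEr mxE. Qed.

Lemma ccoord_inj' p q : (forall i, ccoord (lshift 1 i) p = ccoord (lshift 1 i) q) ->
  ccoord lastc p = ccoord lastc q -> p = q.
Proof.
move=> H1 H2; apply: ccoord_inj => j; case: (split_ordP j) => k ->; first exact: H1.
by rewrite ord1.
Qed.

Lemma ptD x y x' y' : pt (x + x') (y + y') = pt x y + pt x' y'.
Proof.
apply: ccoord_inj' => [i|]; rewrite ccoordD ?ccoord_pt_l ?ccoord_pt_r //.
by rewrite mxE.
Qed.

Lemma ey_cmx y : ey *m cmx (m + 1) y = pt 0 y.
Proof.
apply: ccoord_inj' => [i|]; rewrite ccoord_cmx ?ccoord_pt_l ?ccoord_pt_r ?mulr1 //.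
by rewrite mxE mulr0.
Qed.

Lemma pt_ey x y z : pt x (y + z) = pt x y + ey *m cmx (m + 1) z.
Proof. by rewrite ey_cmx -ptD addr0. Qed.

Definition xof p : Cvec R m := lsubmx (ofR p).
Definition yof p : R[i] := ccoord lastc p.

Lemma pt_of p : pt (xof p) (yof p) = p.
Proof.
apply: ccoord_inj' => [i|]; rewrite ?ccoord_pt_l ?ccoord_pt_r //.
by rewrite mxE ofR_ccoord.
Qed.

Lemma xof_pt x y : xof (pt x y) = x.
Proof. by apply/rowP => i; rewrite mxE ofR_ccoord ccoord_pt_l. Qed.

Lemma yof_pt x y : yof (pt x y) = y.
Proof. exact: ccoord_pt_r. Qed.

Lemma xofE p i : xof p 0 i = ccoord (lshift 1 i) p.
Proof. by rewrite mxE ofR_ccoord. Qed.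

Lemma ey_neq0 : ey != 0.
Proof.
apply/eqP => e0; have := ccoord_pt_r 0 1; rewrite -/ey e0 ccoord0 => /esym/eqP.
by rewrite oner_eq0.
Qed.

Lemma hxJ u : hx u *m Jmx R (m + 1) = hx ('i%C *: u).
Proof.
apply: ccoord_inj' => [i|]; rewrite ccoordJ ?ccoord_pt_l ?ccoord_pt_r ?mulr0 //.
by rewrite mxE.
Qed.

Lemma xof_continuous : continuous (xof : _ -> Cvec R m).
Proof.
move=> p A /nbhs_toR/nbhs_normP[d /= d0 dA].
apply/(@nbhs_normP _ _ p (fun q => A (xof q))); exists (d / 4) => /=; first by rewrite divr_gt0.
move=> q /= pq; rewrite -[xof q]toRK; apply: dA => /=.
apply: (@le_lt_trans _ _ (d / 2)); last by lra.
apply: norm_ccoord => [|j]; first by rewrite divr_ge0 // ltW.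
rewrite ccoordB !ccoord_toR !xofE -ccoordB; apply: le_trans (cmod_ccoord _ _) _; lra.
Qed.

End Coordinates.

(** * Derivatives under a change of charts *)

Section ChartChange.
Variables (R : realType) (X : topologicalType) (n : nat).
Variable M : complex_manifold R X n.

Definition clinear p q (L : 'rV[R]_(p + p) -> 'rV[R]_(q + q)) :=
  linear L /\ forall e, L (e *m Jmx R p) = L e *m Jmx R q.

Lemma clinear_cmx p q (L : 'rV[R]_(p + p) -> 'rV[R]_(q + q)) e c :
  clinear L -> L (e *m cmx p c) = L e *m cmx q c.
Proof.
move=> [Ll LJ]; have L0 : L 0 = 0 by have := Ll (-1) 0 0; rewrite scaler0 addr0 scaleN1r addNr.
have LZ (a : R) v : L (a *: v) = a *: L v by have := Ll a v 0; rewrite addr0 L0 addr0.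
by rewrite !cmxE Ll LZ LJ.
Qed.

Variables (V : normedModType R).

Lemma transition_change (phi psi : chart R X n) (f : V -> X) p :
  differentiable (transition phi psi) (phi (f p)) ->
  cdom phi (f p) -> {for p, continuous f} ->
  differentiable (fun q => toR (phi (f q))) p ->
  exists2 L, clinear L &
    forall v, 'D_v (fun q => toR (psi (f q))) p = L ('D_v (fun q => toR (phi (f q))) p).
Proof.
move=> dT dp fc dphi; have [dTr dTE] := differentiable_realify dT.
exists ('d (realify (transition phi psi)) (toR (phi (f p)))).
  split; first by move=> c u v; exact: linearP.
  by move=> e; rewrite !dTE ofRJ linearZ /= toRJ.
move=> v.
have dc : differentiable (realify (transition phi psi) \o (fun q => toR (phi (f q)))) p.
  exact: differentiable_comp.
have -> : 'D_v (fun q => toR (psi (f q))) p =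
    'D_v (realify (transition phi psi) \o (fun q => toR (phi (f q)))) p.
  apply: near_eq_derive.
  have nd : \forall q \near p, cdom phi (f q).
    by apply: fc; apply: open_nbhs_nbhs; split => //; exact: cdom_open.
  apply: filterS nd => q qd.
  by rewrite /= /realify /transition /= toRK cfunK.
apply: etrans (deriveE v dc) _.
apply: etrans (congr1 (fun g => g v) (diff_comp dphi dTr)) _.
congr ('d _ _ _); exact: (esym (deriveE v dphi)).
Qed.

Lemma chart_change (phi psi : chart R X n) (f : V -> X) p :
  max_atlas M phi -> max_atlas M psi ->
  cdom phi (f p) -> cdom psi (f p) -> {for p, continuous f} ->
  (forall chi, max_atlas M chi -> cdom chi (f p) ->
     differentiable (fun q => toR (chi (f q))) p) ->
  exists2 L, clinear L &
    forall v, 'D_v (fun q => toR (psi (f q))) p = L ('D_v (fun q => toR (phi (f q))) p).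
Proof.
move=> mphi mpsi dphi dpsi fc df.
(* Charts of the maximal atlas are by definition compatible with those of the atlas, so the change
   from [phi] to [psi] passes through one of the latter. *)
have [chi achi dchi] := atlas_cover M (f p).
have mchi : max_atlas M chi.
  by move=> chi' achi'; split; apply: (atlas_compatible (c := M)).
have [c1 _] := mphi _ achi; have [_ c2] := mpsi _ achi.
have [L1 [l1 J1] E1] := transition_change (c1 _ dphi dchi) dphi fc (df _ mphi dphi).
have [L2 [l2 J2] E2] := transition_change (c2 _ dchi dpsi) dchi fc (df _ mchi dchi).
exists (L2 \o L1) => [|v]; last by rewrite E2 E1.
by split=> [c u v|e] /=; rewrite ?l1 ?l2 // J1 J2.
Qed.

End ChartChange.

Lemma differentiable_comp_linear (K : numFieldType) (V V' W : normedModType K)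
    (A : {linear V -> V'}) (f : V' -> W) z :
  continuous A -> differentiable f (A z) ->
  differentiable (f \o A) z /\ forall h, 'd (f \o A) z h = 'd f (A z) (A h).
Proof.
move=> cA df; have dA : differentiable A z by exact: linear_differentiable.
split=> [|h]; first exact: differentiable_comp.
by rewrite diff_comp //= diff_lin.
Qed.

Section LinearCoordinates.
Variables (R : realType) (W : normedModType R[i]) (m : nat).

Lemma differentiable_last_coord (f : Cx R -> W) (z : Cvec R (m + 1)) :
  differentiable f (z 0 (lastc m)) ->
  differentiable (fun w : Cvec R (m + 1) => f (w 0 (lastc m))) z /\
  forall h, 'd (fun w : Cvec R (m + 1) => f (w 0 (lastc m))) z h =
    'd f (z 0 (lastc m)) (h 0 (lastc m)).
Proof.
pose A (w : Cvec R (m + 1)) : Cx R := w 0 (lastc m).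
have Al : linear A by move=> c u v; rewrite /A !mxE.
pose Ap : {linear Cvec R (m + 1) -> Cx R} :=
  HB.pack A (GRing.isLinear.Build _ _ _ _ A Al).
apply: (@differentiable_comp_linear _ _ _ _ Ap f z).
exact: coord_continuous.
Qed.

Lemma differentiable_first_coords (f : Cvec R m -> W) (z : Cvec R (m + 1)) :
  differentiable f (lsubmx z) ->
  differentiable (fun w : Cvec R (m + 1) => f (lsubmx w)) z /\
  forall h, 'd (fun w : Cvec R (m + 1) => f (lsubmx w)) z h =
    'd f (lsubmx z) (lsubmx h).
Proof.
pose A (w : Cvec R (m + 1)) : Cvec R m := lsubmx w.
have Al : linear A by move=> c u v; rewrite /A linearP.
pose Ap : {linear Cvec R (m + 1) -> Cvec R m} :=
  HB.pack A (GRing.isLinear.Build _ _ _ _ A Al).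
apply: (@differentiable_comp_linear _ _ _ _ Ap f z).
move=> w; apply: (_ : {for w, continuous Ap}).
have -> : (Ap : _ -> _) = @xof R m \o @toR R (m + 1).
  by apply/funext => v; rewrite /xof /= toRK.
by apply: continuous_comp; [exact: toR_continuous|exact: xof_continuous].
Qed.

End LinearCoordinates.

Lemma near_differentiable (K : numFieldType) (V W : normedModType K) (f g : V -> W) x :
  (\forall y \near x, f y = g y) -> differentiable f x -> differentiable g x.
Proof.
move=> fg df.
have [||//] := @eps_differentiable K V W g x ('d f x); first exact: diff_continuous.
move=> e e0.
have fg' : \forall h \near (0 : V), f (x + h) = g (x + h).
  have : (fun h : V => x + h) @ (0 : V) --> x + 0.
    by apply: cvgD; [exact: cvg_cst|exact: cvg_id].
  by rewrite addr0 => /(_ _ fg).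
have fgx : f x = g x by exact: (nbhs_singleton fg).
by apply: filterS2 (differentiable_eps df e0) fg' => h; rewrite fgx => h1 <-.
Qed.

(** * Continuous selections of periods *)

(** Completeness of the real row spaces, the setting of the Baire argument. *)
HB.instance Definition _ (R : realType) (n : nat) :=
  Uniform_isComplete.Build 'rV[R]_n (@cauchy_cvg 'rV[R]_n).

Section PeriodSelection.
Variables (R : realType) (V : completeNormedModType R).

(** The sets [S k] are closed only relatively to [O], hence are cut with a closed ball [K] inside
    [O]. If none of these had interior points, the open sets [T k] would be dense and have a common
    point in the interior of [K], which the [S k] cover. *)
Lemma baire_interior (O : set V) (S : nat -> set V) (e0 : V) : nbhs e0 O ->
  (forall k e, O e -> ~ S k e -> \forall e' \near e, ~ S k e') ->
  (forall e, O e -> exists k, S k e) ->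
  exists e1 k, O e1 /\ nbhs e1 (S k).
Proof.
move=> /nbhs_closedballP[r rO] Sc Scov.
pose K := closed_ball e0 r%:num; pose T k := ~` (K `&` S k).
have oT k : open (T k).
  rewrite openE => e; rewrite /T /= not_andP => nKS.
  have [Ke|nKe] := pselect (K e).
    have [//|/(Sc _ _ (rO _ Ke))] := nKS.
    by apply: filterS => e' h [].
  have : nbhs e (~` K).
    by apply: open_nbhs_nbhs; split => //; apply: closed_openC; exact: closed_ball_closed.
  by apply: filterS => e' h [].
have [k nd] : exists k, ~ dense (T k).
  apply/existsNP => dT; have /Baire dI : forall k, open (T k) /\ dense (T k) by [].
  have nK : nbhs e0 K by apply/nbhs_closedballP; exists r.
  have [e [Ke Te]] := dI (K^°) (ex_intro _ e0 nK) (open_interior K).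
  have [k Sk] := Scov e (rO _ (interior_subset Ke)).
  by apply: (Te k I); split => //; exact: interior_subset Ke.
have [W [[e1 [oW We1]] WT]] := denseNE nd.
have WK e : W e -> K e /\ S k e.
  by move=> We; apply: contrapT => h; have : (W `&` T k) e by []; rewrite WT.
exists e1, k; split; first by apply: rO; have [] := WK _ We1.
by apply: filterS (open_nbhs_nbhs (conj oW We1)) => e /WK[].
Qed.

Lemma rational_approx (z : R[i]) (d : R) : 0 < d ->
  exists a b : rat, cmod (z - Complex (ratr a) (ratr b)) < d.
Proof.
case: z => x y d0; have d2 : 0 < d / 2 by rewrite divr_gt0.
have approx (s : R) : exists a : rat, `|s - ratr a| < d / 2.
  have [|a] := @rat_in_itvoo R (s - d / 2) (s + d / 2); first by lra.
  by rewrite in_itv /= => /andP[h1 h2]; exists a; rewrite ltr_norml; apply/andP; split; lra.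
have [a ha] := approx x; have [b hb] := approx y; exists a, b.
by apply: le_lt_trans (cmod_le_ReIm _) _ => /=; rewrite [ltRHS]splitr ltrD.
Qed.

Variable P : V -> set R[i].

Lemma continuous_selection (Q : set (Cx R)) (e1 : V) (d : R) : 0 < d ->
  compact Q -> (forall c c', Q c -> Q c' -> cmod (c - c') < d) ->
  (forall c c', P e1 c -> P e1 c' -> cmod (c - c') < d -> c = c') ->
  (forall Q' : set (Cx R), compact Q' -> (forall c, Q' c -> ~ P e1 c) ->
    \forall e' \near e1, forall c, Q' c -> ~ P e' c) ->
  (\forall e \near e1, exists2 c, P e c & Q c) ->
  exists c : V -> R[i], [/\ \forall e \near e1, P e (c e), Q (c e1) &
    forall eps : R, 0 < eps -> \forall e \near e1, cmod (c e - c e1) < eps].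
Proof.
move=> d0 cQ Qd gap Pc sel.
pose c e := xget 0 [set c | P e c /\ Q c].
have ncP : \forall e \near e1, P e (c e) /\ Q (c e).
  by apply: filterS sel => e [c' pc' qc']; apply: (@xgetPex _ 0 [set c | P e c /\ Q c]); exists c'.
have [pc1 qc1] := nbhs_singleton ncP.
exists c; split=> // [|eps eps0]; first by apply: filterS ncP => e [].
pose D : set (Cx R) := [set z | cmod (z - c e1) < eps].
have oD : open D.
  rewrite openE => z zD; apply/nbhs_cmodP; exists (eps - cmod (z - c e1)).
    by rewrite subr_gt0.
  move=> w wz; rewrite /D /=.
  have -> : w - c e1 = (w - z) + (z - c e1) by rewrite addrA subrK.
  by apply: le_lt_trans (cmodD _ _) _; rewrite -ltrBrDr.
have := Pc _ (compact_closedI cQ (open_closedC oD)).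
have h0 z : (Q `&` ~` D) z -> ~ P e1 z.
  move=> [Qz nD] pz; apply: nD; rewrite /D /=.
  by rewrite (gap _ _ pz pc1 (Qd _ _ Qz qc1)) subrr cmod0.
move=> /(_ h0); apply: filterS2 ncP => e [pe qe] h.
by apply: contrapT => nD; exact: (h (c e) (conj qe nD) pe).
Qed.

Lemma independent_selection (O : set V) (e0 : V) (d : R) : nbhs e0 O -> 0 < d ->
  (forall e c c', O e -> P e c -> P e c' -> cmod (c - c') < d -> c = c') ->
  (forall e (Q : set (Cx R)), O e -> compact Q -> (forall c, Q c -> ~ P e c) ->
    \forall e' \near e, forall c, Q c -> ~ P e' c) ->
  (forall e, O e -> exists2 N : R, 0 < N & forall y, exists2 c, P e c & cmod (y - c) <= N) ->
  exists e1 c1 c2 (N : R), [/\ O e1, 0 < N,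
    cmod (((4 * N)%:C)%C - c1 e1) <= N /\ cmod ('i%C * ((4 * N)%:C)%C - c2 e1) <= N,
    \forall e \near e1, P e (c1 e) /\ P e (c2 e) &
    forall eps : R, 0 < eps -> \forall e \near e1,
      cmod (c1 e - c1 e1) < eps /\ cmod (c2 e - c2 e1) < eps].
Proof.
move=> nO d0 gap Pc cob.
pose q (a b : rat) : R[i] := Complex (ratr a) (ratr b).
(* Discs of radius d / 3 have diameter less than [d], so a period in them is unique at each
   parameter of [O]; rational centres make the family countable. *)
pose Q (w : R[i]) (N : nat) (ab : rat * rat) : set (Cx R) :=
  [set z : Cx R | cmod (z - w) <= N.+1%:R] `&` [set z | cmod (z - q ab.1 ab.2) <= d / 3].
(* The two targets of [independent_coords], with N + 1 in place of N to keep the bound positive. *)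
pose w1 (N : nat) : R[i] := ((4 * N.+1%:R)%:C)%C.
pose w2 (N : nat) : R[i] := 'i%C * ((4 * N.+1%:R)%:C)%C.
have cQ w N ab : compact (Q w N ab).
  by apply: compact_closedI; [exact: disc_compact|exact: disc_closed].
have Qd w N ab c c' : Q w N ab c -> Q w N ab c' -> cmod (c - c') < d.
  move=> [_ /= h] [_ /= h'].
  have -> : c - c' = (c - q ab.1 ab.2) + - (c' - q ab.1 ab.2) by ring.
  by apply: le_lt_trans (cmodD _ _) _; rewrite cmodN; lra.
pose T := (nat * (rat * rat) * (rat * rat))%type.
pose S' (k : T) : set V := [set e | (exists2 c, P e c & Q (w1 k.1.1) k.1.1 k.1.2 c) /\
   (exists2 c, P e c & Q (w2 k.1.1) k.1.1 k.2 c)].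
(* A number that codes no triple gives the empty set, which has no interior point. *)
pose S (n : nat) : set V := if (unpickle n : option T) is Some k then S' k else set0.
have [||e1 [n [Oe1]]] := @baire_interior O S e0 nO.
- move=> n e Oe; rewrite /S; case: unpickle => [k|_]; last by apply: nearW => ? [].
  have pc (w : R[i]) N ab : ~ (exists2 c, P e c & Q w N ab c) ->
      \forall e' \near e, ~ (exists2 c, P e' c & Q w N ab c).
    move=> h; have := Pc e _ Oe (cQ w N ab).
    have h' c : Q w N ab c -> ~ P e c by move=> Qc pc; apply: h; exists c.
    by move=> /(_ h'); apply: filterS => e' h2 [c pc /h2].
  move=> /not_andP[] /pc; apply: filterS => e' h []; first by move=> /h.
  by move=> _ /h.
- move=> e Oe; have [N N0 cobN] := cob e Oe.
  have [n Nn] : exists n : nat, N <= n.+1%:R.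
    exists (Num.truncn N); rewrite ltW // truncnS_gt //.
  have d3 : 0 < d / 3 by rewrite divr_gt0.
  have find (w : R[i]) : exists ab c, P e c /\ Q w n ab c.
    have [c pc cN] := cobN w; have [a [b abc]] := rational_approx c d3.
    exists (a, b), c; split=> //; split=> /=; last exact: ltW.
    by rewrite -cmodN opprB; apply: le_trans Nn.
  have [ab1 [c1 [p1 Q1]]] := find (w1 n); have [ab2 [c2 [p2 Q2]]] := find (w2 n).
  exists (pickle (n, ab1, ab2)); rewrite /S pickleK; split; [by exists c1|by exists c2].
rewrite /S; case: unpickle => [[[N ab1] ab2]|]; last by move=> /nbhs_singleton.
move=> nS.
have s1 : \forall e \near e1, exists2 c, P e c & Q (w1 N) N ab1 c.
  by apply: filterS nS => e [].
have s2 : \forall e \near e1, exists2 c, P e c & Q (w2 N) N ab2 c.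
  by apply: filterS nS => e [].
have gap1 c c' := gap e1 c c' Oe1; have Pc1 Q' := Pc e1 Q' Oe1.
have [c1 [n1 [Q1 _] cc1]] := continuous_selection d0 (cQ _ _ _) (@Qd _ _ _) gap1 Pc1 s1.
have [c2 [n2 [Q2 _] cc2]] := continuous_selection d0 (cQ _ _ _) (@Qd _ _ _) gap1 Pc1 s2.
exists e1, c1, c2, N.+1%:R; split=> //.
- by rewrite -cmodN opprB -[cmod (_ - c2 _)]cmodN opprB.
- exact: filterS2 n1 n2 => e.
- by move=> eps eps0; apply: filterS2 (cc1 _ eps0) (cc2 _ eps0) => e.
Qed.

End PeriodSelection.

(** * The family of uniformizations *)

Section Geometry.
Variables (R : realType) (m : nat) (X : topologicalType).
Variables (M : complex_manifold R X (m + 1)) (fol : foliation M).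
Variables (iota : Cvec R m -> X) (t : Cvec R m -> chart R X (m + 1) -> Cvec R (m + 1)).
Variable F : Cvec R m -> Cx R -> X.
Hypothesis hD : transverse_disk fol iota.
Hypothesis ht : leaf_trivialization fol iota t.
Hypothesis hF : forall x, unit_ball R m x ->
       [/\ leaf_uniformization fol (iota x) (F x),
           F x 0 = iota x
         & forall phi, max_atlas M phi -> cdom phi (iota x) ->
             'd (phi \o F x) (0 : Cx R) (1 : Cx R) = t x phi].
Hypothesis himm : smooth_immersion M (ball_times_C R m) (family_map F).

Local Notation E := ('rV[R]_((m + 1) + (m + 1))).
Local Notation J := (Jmx R (m + 1)).
Local Notation ey := (ey R m).
Local Notation B := (unit_ball R m).
Implicit Types (phi psi : chart R X (m + 1)) (p v : E) (x u : Cvec R m) (y : R[i]).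

Definition fam p : X := family_map F (ofR p).

Definition fcoord phi : E -> E := realify (phi \o family_map F).

Definition fdom phi : set E :=
  @ofR R (m + 1) @^-1` (ball_times_C R m `&` family_map F @^-1` cdom phi).

Lemma famE p : fam p = F (xof p) (yof p).
Proof. by rewrite /fam /family_map /yof -ofR_ccoord mxE. Qed.

Lemma fam_pt x y : fam (pt x y) = F x y.
Proof. by rewrite famE xof_pt yof_pt. Qed.

Lemma fdomP phi p : fdom phi p <-> B (xof p) /\ cdom phi (fam p).
Proof. by []. Qed.

Lemma fdom_pt phi x y : fdom phi (pt x y) <-> B x /\ cdom phi (F x y).
Proof. by rewrite fdomP xof_pt fam_pt. Qed.

Lemma fcoordE phi p : fcoord phi p = toR (phi (fam p)).
Proof. by []. Qed.

Lemma fam_continuous p : B (xof p) -> {for p, continuous fam}.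
Proof.
move=> Bp; have [fc _ _] := himm.
by apply: (@continuous_comp _ _ _ (@ofR R (m + 1)) (family_map F));
  [exact: ofR_continuous|exact: fc].
Qed.

Lemma near_ball p : B (xof p) -> \forall q \near p, B (xof q).
Proof. by move=> /nbhs_unit_ball; apply: xof_continuous. Qed.

Lemma near_fdom phi p : fdom phi p -> \forall q \near p, fdom phi q.
Proof.
move=> [Bp dp]; have nd : \forall q \near p, cdom phi (fam q).
  apply: (fam_continuous Bp); apply: open_nbhs_nbhs; split; last exact: dp.
  exact: cdom_open.
by apply: filterS2 (near_ball Bp) nd => q.
Qed.

Lemma fdom_open phi : open (fdom phi).
Proof. by rewrite openE => p /near_fdom. Qed.

Lemma fcoord_smooth phi : max_atlas M phi -> csmooth (fdom phi) (fcoord phi).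
Proof. by have [_ sF _] := himm; exact: sF. Qed.

Lemma fcoord_differentiable phi p : max_atlas M phi -> fdom phi p ->
  differentiable (fcoord phi) p.
Proof. by move=> mphi; exact: csmooth_differentiable (fcoord_smooth mphi). Qed.

Lemma fcoord_injective phi p : max_atlas M phi -> fdom phi p ->
  injective ('d (fcoord phi) p).
Proof.
move=> mphi [Bp dp]; have [_ _ iF] := himm.
by have := iF phi (ofR p) mphi Bp dp; rewrite ofRK.
Qed.

Lemma fcoord_ey_neq0 phi p : max_atlas M phi -> fdom phi p ->
  'D_ey (fcoord phi) p != 0.
Proof.
move=> mphi Up; apply/eqP.
move=> /(etrans (esym (deriveE _ (fcoord_differentiable mphi Up)))) => e.
have := ey_neq0 R m; apply/negP; rewrite negbK; apply/eqP.
by apply: (fcoord_injective mphi Up); rewrite e linear0.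
Qed.

Lemma fcoord_derive_ey phi p (w : E) : max_atlas M phi -> fdom phi p ->
  (forall i, ccoord (lshift 1 i) w = 0) ->
  'D_w (fcoord phi) p =
    toR ('d (phi \o F (xof p)) (yof p : Cx R) (ccoord (lastc m) w : Cx R)).
Proof.
move=> mphi Up w0; have [Bp dp] := Up.
have [[_ hol] _ _] := hF Bp.
have [_ /(_ phi mphi)] := hol (yof p : Cx R) I.
rewrite -famE => /(_ dp) dphi.
have [dq dqE] : differentiable
    (fun w : Cvec R (m + 1) => phi (F (xof p) (w 0 (lastc m)))) (ofR p) /\
    forall h, 'd (fun w : Cvec R (m + 1) => phi (F (xof p) (w 0 (lastc m)))) (ofR p) h =
    'd (phi \o F (xof p)) (ofR p 0 (lastc m)) (h 0 (lastc m)).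
  by apply: differentiable_last_coord; rewrite ofR_ccoord.
have [] := differentiable_realify dq; rewrite ofRK => dr drE.
have -> : 'D_w (fcoord phi) p = 'D_w (realify
    (fun w : Cvec R (m + 1) => phi (F (xof p) (w 0 (lastc m))))) p.
  apply: derive_line_near; apply: (@filterE _ (nbhs (0 : R))) => h.
  rewrite fcoordE famE /realify ofR_ccoord; congr (toR (phi (F _ _))).
  by apply/rowP => i; rewrite !xofE ccoordD ccoordZ w0 mulr0 add0r.
by rewrite (deriveE _ dr) drE dqE !ofR_ccoord.
Qed.

Lemma fcoord_cr phi : max_atlas M phi -> cr_on (fdom phi) ey (fcoord phi).
Proof.
move=> mphi p Up.
rewrite !(fcoord_derive_ey mphi Up) ?ccoordJ ?ccoord_pt_r => [|i|i]; last 2 first.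
- by rewrite ccoord_pt_l mxE.
- by rewrite ccoordJ ccoord_pt_l mxE mulr0.
by rewrite mulr1 -toRJ -linearZ /= [_ *: _]mulr1.
Qed.

Lemma derive_hx_slice (H : E -> E) (f : Cvec R m -> Cvec R (m + 1)) x u :
  differentiable f x -> (\forall x' \near x, H (pt x' 0) = toR (f x')) ->
  'D_(hx u) H (pt x 0) = toR ('d f x u).
Proof.
move=> df Hf.
have [dq dqE] : differentiable (fun w : Cvec R (m + 1) => f (lsubmx w)) (ofR (pt x 0)) /\
    forall h, 'd (fun w : Cvec R (m + 1) => f (lsubmx w)) (ofR (pt x 0)) h =
    'd f (xof (pt x 0)) (lsubmx h).
  by apply: differentiable_first_coords; rewrite -/(xof (pt x 0)) xof_pt.
have [] := differentiable_realify dq; rewrite ofRK => dr drE.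
have -> : 'D_(hx u) H (pt x 0) =
    'D_(hx u) (realify (fun w : Cvec R (m + 1) => f (lsubmx w))) (pt x 0).
  apply: derive_line_near.
  have nq : \forall q \near pt x 0, H (pt (xof q) 0) = toR (f (xof q)).
    by apply: (@xof_continuous R m (pt x 0) (fun x' => H (pt x' 0) = toR (f x')));
      rewrite xof_pt.
  have := near_line (hx u) nq; apply: filterS => h; set q := _ + _ => Hq.
  apply: etrans (_ : H q = H (pt (xof q) 0)) Hq.
  congr (H _); rewrite -[LHS]pt_of; congr (pt _ _).
  by rewrite /yof /q ccoordD ccoordZ !ccoord_pt_r mulr0 addr0.
by rewrite (deriveE _ dr) drE dqE xof_pt; congr (toR ('d f x _)); exact: xof_pt.
Qed.

Lemma derive_hx_slice_cr (H : E -> E) (f : Cvec R m -> Cvec R (m + 1)) x u :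
  differentiable f x -> (\forall x' \near x, H (pt x' 0) = toR (f x')) ->
  'D_(hx u *m J) H (pt x 0) = 'D_(hx u) H (pt x 0) *m J.
Proof.
move=> df Hf; rewrite hxJ !(derive_hx_slice _ df Hf) -toRJ.
by rewrite linearZ.
Qed.

Lemma near_iota phi x : B x -> cdom phi (iota x) ->
  \forall x' \near x, fdom phi (pt x' 0).
Proof.
move=> Bx dx; have [/(_ x Bx)[ic _] _ _ _ _] := hD.
have nd : \forall x' \near x, cdom phi (iota x').
  by apply: ic; apply: open_nbhs_nbhs; split => //; exact: cdom_open.
apply: filterS2 (nbhs_unit_ball Bx) nd => x' Bx' dx'; apply/fdom_pt.
by have [_ -> _] := hF Bx'.
Qed.

Lemma fcoord_hx_cr0 phi x u : max_atlas M phi -> B x -> cdom phi (iota x) ->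
  'D_(hx u *m J) (fcoord phi) (pt x 0) = 'D_(hx u) (fcoord phi) (pt x 0) *m J.
Proof.
move=> mphi Bx dx; have [/(_ x Bx)[_ /(_ phi mphi dx) di] _ _ _ _] := hD.
apply: (derive_hx_slice_cr _ di).
apply: filterS (nbhs_unit_ball Bx) => x' Bx'.
by rewrite fcoordE fam_pt; have [_ -> _] := hF Bx'.
Qed.

Lemma fcoord_ey_hx_cr0 phi x u : max_atlas M phi -> B x -> cdom phi (iota x) ->
  'D_(hx u *m J) ('D_ey (fcoord phi)) (pt x 0) =
  'D_(hx u) ('D_ey (fcoord phi)) (pt x 0) *m J.
Proof.
move=> mphi Bx dx; have [_ /(_ phi mphi dx)[_ dt]] := ht Bx.
apply: (derive_hx_slice_cr _ dt).
apply: filterS (near_iota Bx dx) => x' Ux'.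
rewrite (fcoord_derive_ey mphi Ux') => [|i]; last by rewrite ccoord_pt_l mxE.
have [] := (fdom_pt _ _ _).1 Ux' => Bx' dx'; have [_ F0 dF] := hF Bx'.
by rewrite xof_pt yof_pt ccoord_pt_r dF // -F0.
Qed.

Lemma leaf_plaque phi (p : X) : fol_atlas fol phi ->
  leaf_open fol [set q | cdom phi q /\ transv (phi q) = transv (phi p)].
Proof.
move=> fphi psi q fpsi dpsi [dq tq].
have [h hq] := fol_atlas_compatible fpsi fphi dpsi dq.
have nd : \forall r \near q, cdom phi r.
  by apply: open_nbhs_nbhs; split => //; exact: cdom_open.
have hq0 := nbhs_singleton hq.
apply: filterS2 hq nd => r hr dr tr; split => //.
by rewrite hr tr -hq0.
Qed.

Lemma max_of_fol phi : fol_atlas fol phi -> max_atlas M phi.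
Proof. exact: fol_atlas_sub. Qed.

(** [F x] is continuous for the leaf topology, in which plaques are open; hence its transverse
    coordinates are locally constant in y. *)
Lemma fcoord_ey_transv phi p i : fol_atlas fol phi -> fdom phi p ->
  ccoord (lshift 1 i) ('D_ey (fcoord phi) p) = 0.
Proof.
move=> fphi Up; have [Bp dp] := Up; have mphi := max_of_fol fphi.
have [[[Fc _ _] _] _ _] := hF Bp.
have : nbhs (yof p : Cx R) (fun z => cdom phi (F (xof p) z) /\
    transv (phi (F (xof p) z)) = transv (phi (fam p))).
  pose A := [set q | cdom phi q /\ transv (phi q) = transv (phi (fam p))].
  have nA : nbhs (F (xof p) (yof p) : leafspace fol) A.
    apply: open_nbhs_nbhs; split; first exact: leaf_plaque.
    by rewrite -famE.
  exact: (Fc (yof p : Cx R) _ nA).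
move=> /nbhs_cmodP[d d0 dP].
have c0 (g : E -> E) j : differentiable g p ->
    (\forall h \near (0 : R), ccoord j (g (h *: ey + p)) = ccoord j (g p)) ->
    ccoord j ('D_ey g p) = 0.
  move=> dg gp.
  have D0 l : (\forall h \near (0 : R), g (h *: ey + p) 0 l = g p 0 l) ->
      'D_ey g p 0 l = 0.
    move=> gl; have [_ <-] := derive_coord ey l dg.
    rewrite (_ : 'D_ey (fun q => g q 0 l) p = 'D_ey (fun=> g p 0 l) p).
      exact: derive_cst.
    exact: derive_line_near.
  by rewrite /ccoord !D0 //; apply: filterS gp => h [].
apply: c0; first exact: fcoord_differentiable.
apply/(@nbhs_normP R R 0 _); exists d => // h /=; rewrite sub0r normrN => hd.
have xE : xof (h *: ey + p) = xof p.
  by apply/rowP => l; rewrite !xofE ccoordD ccoordZ ccoord_pt_l mxE mulr0 add0r.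
have yE : yof (h *: ey + p) = (h%:C)%C + yof p.
  by rewrite /yof ccoordD ccoordZ ccoord_pt_r mulr1.
rewrite !fcoordE !ccoord_toR.
have [|_] := dP ((h%:C)%C + yof p : R[i]); first by rewrite addrK cmodC.
have -> : fam (h *: ey + p) = F (xof p) ((h%:C)%C + yof p) by rewrite famE xE yE.
by move=> /rowP/(_ i); rewrite !mxE.
Qed.

(* Twice the antiholomorphic derivative in the direction [v]. *)
Definition dbar phi v p : E := 'D_v (fcoord phi) p + 'D_(v *m J) (fcoord phi) p *m J.

Lemma fcoord_neq0_last phi p : fol_atlas fol phi -> fdom phi p ->
  ccoord (lastc m) ('D_ey (fcoord phi) p) != 0.
Proof.
move=> fphi Up; apply: contra_neq (fcoord_ey_neq0 (max_of_fol fphi) Up) => e0.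
apply: ccoord_inj' => [i|]; rewrite ccoord0 //; exact: fcoord_ey_transv.
Qed.

(** For u along the leaf the transverse part of D_u F vanishes identically. By symmetry of second
    derivatives so does that of D_u D_v F, and the transverse part of D_v F is constant on the
    segment. *)
Lemma transv_locally_constant phi p v z i : fol_atlas fol phi ->
  (forall s : R, 0 <= s <= 1 -> fdom phi (p + s *: (ey *m cmx (m + 1) z))) ->
  ccoord (lshift 1 i) ('D_v (fcoord phi) (p + ey *m cmx (m + 1) z)) =
  ccoord (lshift 1 i) ('D_v (fcoord phi) p).
Proof.
move=> fphi Us; have mphi := max_of_fol fphi.
pose u : E := ey *m cmx (m + 1) z.
have sG := fcoord_smooth mphi; have sDv := csmooth_derive v sG.
have D0 q : fdom phi q -> ccoord (lshift 1 i) ('D_u ('D_v (fcoord phi)) q) = 0.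
  move=> Uq; have -> := csmooth_schwarz v u (@fdom_open phi) sG Uq.
  have nz : \forall q' \near q, ccoord (lshift 1 i) ('D_u (fcoord phi) q') = 0.
    apply: filterS (near_fdom Uq) => q' Uq'.
    rewrite (cr_on_cmx z sG (fcoord_cr mphi) Uq') ccoord_cmx.
    by rewrite (fcoord_ey_transv i fphi Uq') mulr0.
  have dD := csmooth_differentiable (csmooth_derive u sG) Uq.
  have c0 l : (\forall q' \near q, 'D_u (fcoord phi) q' 0 l = 0) ->
      'D_v ('D_u (fcoord phi)) q 0 l = 0.
    move=> nl; have [_ <-] := derive_coord v l dD.
    apply: etrans (derive_cst (0 : R) q v); apply: near_eq_derive.
    exact: nl.
  by rewrite /ccoord !c0 //; apply: filterS nz => q' [].
have c1 l : (forall q, fdom phi q -> 'D_u ('D_v (fcoord phi)) q 0 l = 0) ->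
    'D_v (fcoord phi) (p + u) 0 l = 'D_v (fcoord phi) p 0 l.
  move=> Dl; apply/eqP; rewrite -subr_eq0; apply/eqP.
  have [s s01|s s01] := @MVT_line R _ (fun q => 'D_v (fcoord phi) q 0 l) p u 1 ltr01.
    by apply: diff_derivable; have [] := derive_coord u l (csmooth_differentiable sDv (Us _ s01)).
  rewrite scale1r mul1r => ->.
  have s01' : 0 <= s <= 1 by case/andP: s01 => /ltW -> /ltW.
  have [_ ->] := derive_coord u l (csmooth_differentiable sDv (Us _ s01')).
  exact: Dl (Us _ s01').
have D0' q : fdom phi q -> 'D_u ('D_v (fcoord phi)) q 0 (lshift (m + 1) (lshift 1 i)) = 0
    /\ 'D_u ('D_v (fcoord phi)) q 0 (rshift (m + 1) (lshift 1 i)) = 0.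
  by move=> /D0 [].
exact: (f_equal2 (@Complex R) (c1 _ (fun q Uq => (D0' q Uq).1))
  (c1 _ (fun q Uq => (D0' q Uq).2))).
Qed.

(* A change of charts acts on both sides by the same complex linear map, so [a]
   does not depend on [phi]. *)
Definition dbar_ratio x u y a := forall phi, fol_atlas fol phi ->
  cdom phi (F x y) ->
  dbar phi (hx u) (pt x y) = 'D_ey (fcoord phi) (pt x y) *m cmx (m + 1) a.

Lemma dbar_ratio_chart phi x u y a : B x -> fol_atlas fol phi ->
  cdom phi (F x y) ->
  dbar phi (hx u) (pt x y) = 'D_ey (fcoord phi) (pt x y) *m cmx (m + 1) a ->
  dbar_ratio x u y a.
Proof.
move=> Bx fphi dphi e psi fpsi dpsi.
have Uphi : fdom phi (pt x y) by apply/fdom_pt.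
have famxy : fam (pt x y) = F x y by rewrite fam_pt.
have fc : {for pt x y, continuous fam} by apply: fam_continuous; rewrite xof_pt.
have [||chi mchi dchi|L [Ll LJ] LE] :=
    @chart_change R X (m + 1) M _ phi psi fam (pt x y)
      (max_of_fol fphi) (max_of_fol fpsi) _ _ fc.
- by rewrite famxy.
- by rewrite famxy.
- by apply: fcoord_differentiable => //; apply/fdom_pt; rewrite -famxy.
have LD v w : L (v + w) = L v + L w by have := Ll 1 v w; rewrite !scale1r.
have e1 : dbar psi (hx u) (pt x y) = L (dbar phi (hx u) (pt x y)).
  rewrite /dbar LD LJ.
  exact: (f_equal2 (fun a b => a + b *m J) (LE (hx u)) (LE (hx u *m J))).
apply: etrans e1 _; rewrite e (clinear_cmx _ _ (conj Ll LJ)).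
by congr (_ *m _); exact: (esym (LE ey)).
Qed.

Lemma fol_chart x y : exists2 phi, fol_atlas fol phi & cdom phi (F x y).
Proof. exact: fol_atlas_cover. Qed.

Lemma dbar_ratioP phi x u y : B x -> fol_atlas fol phi -> cdom phi (F x y) ->
  (exists a, dbar_ratio x u y a) <->
  (forall i, ccoord (lshift 1 i) (dbar phi (hx u) (pt x y)) = 0).
Proof.
move=> Bx fphi dphi; have Uphi : fdom phi (pt x y) by apply/fdom_pt.
split=> [[a ra] i|H].
  by rewrite (ra _ fphi dphi) ccoord_cmx fcoord_ey_transv // mulr0.
exists (ccoord (lastc m) (dbar phi (hx u) (pt x y)) /
        ccoord (lastc m) ('D_ey (fcoord phi) (pt x y))).
apply: (dbar_ratio_chart Bx fphi dphi).
apply: ccoord_inj' => [i|]; rewrite ccoord_cmx.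
  by rewrite H fcoord_ey_transv // mulr0.
by rewrite divfK // fcoord_neq0_last.
Qed.

Lemma dbar_ratio_last phi x u y a : B x -> fol_atlas fol phi ->
  cdom phi (F x y) -> dbar_ratio x u y a ->
  a = ccoord (lastc m) (dbar phi (hx u) (pt x y)) *
      (ccoord (lastc m) ('D_ey (fcoord phi) (pt x y)))^-1.
Proof.
move=> Bx fphi dphi ra; have Uphi : fdom phi (pt x y) by apply/fdom_pt.
by rewrite (ra _ fphi dphi) ccoord_cmx mulfK // fcoord_neq0_last.
Qed.

Lemma JJ (e : E) : e *m J *m J = - e.
Proof. by apply: ccoord_inj => j; rewrite !ccoordJ ccoordN mulrA -expr2 sqr_i mulN1r. Qed.

Lemma dbar0 phi x u : max_atlas M phi -> B x -> cdom phi (iota x) ->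
  dbar phi (hx u) (pt x 0) = 0.
Proof.
move=> mphi Bx dx; rewrite /dbar.
have -> := fcoord_hx_cr0 u mphi Bx dx.
by rewrite JJ addrN.
Qed.

Lemma ccoord_dbar phi v p j : ccoord j (dbar phi v p) =
  ccoord j ('D_v (fcoord phi) p) + 'i%C * ccoord j ('D_(v *m J) (fcoord phi) p).
Proof. by rewrite /dbar ccoordD ccoordJ. Qed.

(** A leaf need not lie in one chart, so tangency is expressed by the existence of a ratio, which
    does not depend on the chart. That existence is locally constant in y and holds at y = 0, where
    [dbar] vanishes. *)
Lemma dbar_ratio_exists x u y : B x -> exists a, dbar_ratio x u y a.
Proof.
move=> Bx.
apply: (@cconvex_locally_constant R (fun=> True)
  (fun y => exists a, dbar_ratio x u y a) 0 y) => //; last first.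
  exists 0 => phi fphi; have [_ -> _] := hF Bx => dx.
  by rewrite dbar0 ?cmx0 //; exact: max_of_fol.
move=> z _; have [phi fphi dphi] := fol_chart x z.
have Uphi : fdom phi (pt x z) by apply/fdom_pt.
have := cnear_cmx_segment ey (near_fdom Uphi) => /(cnearB z).
apply: cnearS => w Uw _.
have E' : pt x w = pt x z + ey *m cmx (m + 1) (w - z).
  by rewrite -pt_ey addrC subrK.
have dw : cdom phi (F x w).
  have := Uw 1; rewrite ler01 lexx scale1r -E' => /(_ isT)/fdom_pt[] //.
have ze (v : E) i : ccoord (lshift 1 i) ('D_v (fcoord phi) (pt x w)) =
    ccoord (lshift 1 i) ('D_v (fcoord phi) (pt x z)).
  by rewrite E'; exact: transv_locally_constant.
have Pw := dbar_ratioP u Bx fphi dw; have Pz := dbar_ratioP u Bx fphi dphi.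
have H i : ccoord (lshift 1 i) (dbar phi (hx u) (pt x w)) =
    ccoord (lshift 1 i) (dbar phi (hx u) (pt x z)).
  apply: etrans (ccoord_dbar _ _ _ _) _; apply: etrans _ (esym (ccoord_dbar _ _ _ _)).
  exact: (f_equal2 (fun a b => a + 'i%C * b) (ze _ i) (ze _ i)).
split.
  by move/Pw => h; apply/Pz => i; exact: etrans (esym (H i)) (h i).
by move/Pz => h; apply/Pw => i; exact: etrans (H i) (h i).
Qed.

(** In a chart the ratio is a quotient N / D of leafwise coordinates of derivatives of F. These are
    holomorphic in y, so [al] has the expansions that [entire_linear_growth] asks for. *)
Lemma dbar_ratio_function x u : B x -> exists (al : R[i] -> R[i]) (k : R[i] -> R[i]),
  [/\ forall y, dbar_ratio x u y (al y), forall y, taylor2 al y, ccts k 0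
    & cnear 0 (fun h => al h = h ^+ 2 * k h)].
Proof.
move=> Bx; have [al alP] := choice (fun y => dbar_ratio_exists u y Bx).
pose p0 : E := pt x 0.
have ptE y : pt x y = p0 + ey *m cmx (m + 1) y by rewrite -pt_ey add0r.
pose N phi y := ccoord (lastc m) ('D_(hx u) (fcoord phi) (p0 + ey *m cmx (m + 1) y)) +
  'i%C * ccoord (lastc m) ('D_(hx u *m J) (fcoord phi) (p0 + ey *m cmx (m + 1) y)).
pose D phi y := ccoord (lastc m) ('D_ey (fcoord phi) (p0 + ey *m cmx (m + 1) y)).
have loc phi z : fol_atlas fol phi -> cdom phi (F x z) ->
    [/\ cnear z (fun w => al w = N phi w * (D phi w)^-1), D phi z != 0,
        taylor2_at (N phi) z
         (ccoord (lastc m) ('D_ey ('D_(hx u) (fcoord phi)) (p0 + ey *m cmx (m + 1) z)) +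
         'i%C * ccoord (lastc m) ('D_ey ('D_(hx u *m J) (fcoord phi)) (p0 + ey *m cmx (m + 1) z)))
      & taylor2 (D phi) z].
  move=> fphi dz; have mphi := max_of_fol fphi.
  have Uz : fdom phi (pt x z) by apply/fdom_pt.
  have sG := fcoord_smooth mphi; have crG := fcoord_cr mphi.
  have Uz' : fdom phi (p0 + ey *m cmx (m + 1) z) by rewrite -ptE.
  have oU := @fdom_open phi.
  split.
  - have := cnear_cmx_segment ey (near_fdom Uz) => /(cnearB z).
    apply: cnearS => w Uw.
    have dw : cdom phi (F x w).
      have := Uw 1; rewrite ler01 lexx scale1r -pt_ey addrC subrK.
      by move=> /(_ isT)/fdom_pt[].
    apply: etrans (dbar_ratio_last Bx fphi dw (alP w)) _.
    rewrite /N /D -ptE; congr (_ * _); exact: ccoord_dbar.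
  - by rewrite /D -ptE fcoord_neq0_last.
  - apply: taylor2_at_lin.
      exact: (cr_on_taylor2 oU (lastc m) (csmooth_derive _ sG) (cr_on_derive oU _ sG crG) Uz').
    exact: (cr_on_taylor2 oU (lastc m) (csmooth_derive _ sG) (cr_on_derive oU _ sG crG) Uz').
  - eexists.
    exact: (cr_on_taylor2 oU (lastc m) (csmooth_derive _ sG) (cr_on_derive oU _ sG crG) Uz').
have [phi fphi d0] := fol_chart x 0.
have [al0 D0 [kN [kNc NE]] D2] := loc phi 0 fphi d0.
have dx : cdom phi (iota x) by move: d0; have [_ -> _] := hF Bx.
have mphi := max_of_fol fphi.
have U0 : fdom phi p0 by apply/fdom_pt.
exists al, (fun h => kN h * (D phi h)^-1); split => //.
- move=> z; have [psi fpsi dz] := fol_chart x z.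
  have [alz Dz N2 D2'] := loc psi z fpsi dz.
  apply: (@taylor2_near R (fun w => N psi w * (D psi w)^-1)).
    by apply: cnearS alz => w ->.
  by apply: taylor2M; [eexists; exact: N2|exact: taylor2V].
- by apply: cctsM => //; apply: cctsV => //; exact: taylor2_continuous.
apply: cnearS2 al0 NE => h ->; rewrite add0r => ->.
have N0 : N phi 0 = 0.
  rewrite /N -ptE; apply: etrans (esym (ccoord_dbar _ _ _ _)) _.
  by rewrite dbar0 // ccoord0.
(* By symmetry of second derivatives, this first-order coefficient of N is the leafwise coordinate
   of the antiholomorphic derivative of dF/dy, up to the factor 2; it vanishes because dF/dy at (x,
   0) is t_x, holomorphic in x. *)
have b0 : ccoord (lastc m) ('D_ey ('D_(hx u) (fcoord phi)) (p0 + ey *m cmx (m + 1) 0)) +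
    'i%C * ccoord (lastc m) ('D_ey ('D_(hx u *m J) (fcoord phi)) (p0 + ey *m cmx (m + 1) 0)) = 0.
  rewrite -ptE.
  have sw v := csmooth_schwarz v ey (@fdom_open phi) (fcoord_smooth mphi) U0.
  have s1 := congr1 (ccoord (lastc m)) (sw (hx u)).
  have s2 := congr1 (ccoord (lastc m)) (sw (hx u *m J)).
  have s3 := congr1 (ccoord (lastc m)) (fcoord_ey_hx_cr0 u mphi Bx dx).
  have aux (a b c : R[i]) : b = c -> c = 'i%C * a -> a + 'i%C * b = 0.
    by move=> -> ->; rewrite mulrA -expr2 sqr_i mulN1r addrN.
  exact: (aux _ _ _ s2 (etrans s3 (etrans (ccoordJ _ _)
    (congr1 (fun z => 'i%C * z) (esym s1))))).
by rewrite N0 b0 mul0r !add0r mulrA.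
Qed.

(** The displacement (0, c x), taken on all of C^m x C, so that the shift by it maps a space to
    itself and [implicit_differentiable] applies to it with the immersion F. *)
Definition period_jump (c : Cvec R m -> R[i]) (q : E) : E :=
  ey *m cmx (m + 1) (c (xof q)).

Lemma period_jump_continuous (c : Cvec R m -> R[i]) p :
  {for xof p, continuous (c : Cvec R m -> Cx R)} -> {for p, continuous (period_jump c)}.
Proof.
move=> cc; apply/(@cvgrPdistC_lt _ _ _ (nbhs p) _ (period_jump c)) => eps eps0.
have m0 : 0 < 2 * `|ey| + 1 by rewrite ltr_wpDl // mulr_ge0.
have e1 : 0 < eps / (2 * `|ey| + 1) by rewrite divr_gt0.
have /continuous_cmodP/(_ _ e1) nc := cc.
have nc' : \forall q \near p, cmod (c (xof q) - c (xof p)) < eps / (2 * `|ey| + 1).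
  exact: (@xof_continuous R m p _ nc).
apply: filterS nc' => q; rewrite ltr_pdivlMr // => h.
have -> : period_jump c q - period_jump c p = ey *m cmx (m + 1) (c (xof q) - c (xof p)).
  by apply: ccoord_inj => j; rewrite ccoordB !ccoord_cmx mulrBl.
apply: le_lt_trans (cmx_norm _ _) _; have := cmod_ge0 (c (xof q) - c (xof p)).
by move: h; rewrite mulrC mulrDl mul1r => h h'; lra.
Qed.

Lemma period_jump_transv c q i : ccoord (lshift 1 i) (period_jump c q) = 0.
Proof. by rewrite /period_jump ccoord_cmx ccoord_pt_l mxE mulr0. Qed.

Lemma period_jump_last c q : ccoord (lastc m) (period_jump c q) = c (xof q).
Proof. by rewrite /period_jump ccoord_cmx ccoord_pt_r mulr1. Qed.

Lemma period_jumpE c q : q + period_jump c q = pt (xof q) (yof q + c (xof q)).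
Proof.
apply: ccoord_inj' => [i|]; rewrite ccoordD ?period_jump_transv ?period_jump_last.
  by rewrite ccoord_pt_l addr0 xofE.
by rewrite ccoord_pt_r.
Qed.

Lemma fam_period c q : period_group (F (xof q)) (c (xof q)) ->
  fam (q + period_jump c q) = fam q.
Proof. by move=> pc; rewrite period_jumpE fam_pt famE pc. Qed.

(** * Differentiation of the period identity *)

Section PeriodDerivative.
Variables (c : Cvec R m -> R[i]) (x : Cvec R m).
Hypothesis Bx : B x.
Hypothesis cc : {for x, continuous (c : Cvec R m -> Cx R)}.
Hypothesis cper : \forall x' \near x, period_group (F x') (c x').

Let shift (q : E) : E := q + period_jump c q.

Let shift_pt y : shift (pt x y) = pt x (y + c x).
Proof. by rewrite /shift period_jumpE xof_pt yof_pt. Qed.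

Let fcoord_shift phi y : \forall q \near pt x y, fcoord phi (shift q) = fcoord phi q.
Proof.
have : \forall q \near pt x y, period_group (F (xof q)) (c (xof q)).
  by apply: (@xof_continuous R m (pt x y) (fun x' => period_group (F x') (c x')));
    rewrite xof_pt.
by apply: filterS => q pq; rewrite !fcoordE /shift fam_period.
Qed.

Lemma period_jump_differentiable y : differentiable (period_jump c) (pt x y).
Proof.
have [phi fphi dphi] := fol_chart x y; have mphi := max_of_fol fphi.
have Up : fdom phi (pt x y) by apply/fdom_pt.
have Us : fdom phi (shift (pt x y)).
  rewrite shift_pt; apply/fdom_pt; split => //.
  by rewrite (nbhs_singleton cper).
have ds : differentiable shift (pt x y).
  apply: (implicit_differentiable (fcoord_differentiable mphi Us)).
  - exact: fcoord_injective.
  - apply: continuousD; first exact: cvg_id.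
    by apply: period_jump_continuous; rewrite xof_pt.
  - apply: (near_differentiable _ (fcoord_differentiable mphi Up)).
    by apply: filterS (fcoord_shift phi y) => q e; exact: (esym e).
have -> : period_jump c = shift - id.
  by apply/funext => q; rewrite -[RHS]/(shift q - q) /shift addrAC subrr add0r.
by apply: differentiableB.
Qed.

(** The real differential of [c] at x, read off the jump at y = 0; by [derive_period_jump] any other
    y gives the same value. *)
Definition period_slope (w : E) : R[i] :=
  ccoord (lastc m) ('D_w (period_jump c) (pt x 0)).

Lemma derive_period_jump w y :
  'D_w (period_jump c) (pt x y) = ey *m cmx (m + 1) (period_slope w).
Proof.
have -> : 'D_w (period_jump c) (pt x y) = 'D_w (period_jump c) (pt x 0).
  apply: derive_line_near2 => h; rewrite /period_jump; congr (_ *m cmx _ (c _)).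
  by apply/rowP => i; rewrite !xofE !ccoordD !ccoord_pt_l.
have dj := period_jump_differentiable 0.
apply: ccoord_inj' => [i|]; rewrite ccoord_cmx ?ccoord_pt_r ?mulr1 // ccoord_pt_l mxE mulr0.
have D0 l : (forall q, period_jump c q 0 l = 0) ->
    'D_w (period_jump c) (pt x 0) 0 l = 0.
  move=> jl; have [_ <-] := derive_coord w l dj.
  rewrite (_ : (fun q => _) = fun=> 0); last exact/funext.
  exact: derive_cst.
have jl q : period_jump c q 0 (lshift (m + 1) (lshift 1 i)) = 0 /\
    period_jump c q 0 (rshift (m + 1) (lshift 1 i)) = 0.
  by have := period_jump_transv c q i => -[].
exact: (f_equal2 (@Complex R) (D0 _ (fun q => (jl q).1)) (D0 _ (fun q => (jl q).2))).
Qed.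

Lemma period_slope_ey w : (forall i, ccoord (lshift 1 i) w = 0) -> period_slope w = 0.
Proof.
move=> w0; rewrite /period_slope.
have -> : 'D_w (period_jump c) (pt x 0) = 'D_w (cst (period_jump c (pt x 0))) (pt x 0).
  apply: derive_line_near; apply: (@filterE _ (nbhs (0 : R))) => h.
  rewrite /period_jump /=; congr (_ *m cmx _ (c _)).
  by apply/rowP => i; rewrite !xofE ccoordD ccoordZ w0 mulr0 add0r.
by rewrite derive_cst ccoord0.
Qed.

Lemma fcoord_period_derive phi w y : max_atlas M phi -> fdom phi (pt x y) ->
  'D_w (fcoord phi) (pt x y) = 'D_w (fcoord phi) (pt x (y + c x)) +
    'D_ey (fcoord phi) (pt x (y + c x)) *m cmx (m + 1) (period_slope w).
Proof.
move=> mphi Up.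
have Us : fdom phi (shift (pt x y)).
  rewrite shift_pt; apply/fdom_pt; split => //.
  by have [_] := (fdom_pt _ _ _).1 Up; rewrite (nbhs_singleton cper).
have dj := period_jump_differentiable y.
have di : differentiable (@id E) (pt x y) by [].
have ds : differentiable shift (pt x y) by exact: differentiableD.
have dA := fcoord_differentiable mphi Us.
have dc : differentiable (fcoord phi \o shift) (pt x y) by exact: differentiable_comp.
have e1 : 'D_w (fcoord phi) (pt x y) = 'D_w (fcoord phi \o shift) (pt x y).
  apply: near_eq_derive.
  by apply: filterS (fcoord_shift phi y) => q e; exact: (esym e).
have e2 : 'D_w shift (pt x y) = w + ey *m cmx (m + 1) (period_slope w).
  rewrite -(derive_period_jump w y).
  have d1 : derivable (@id E) (pt x y) w by exact: diff_derivable di.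
  have d2 : derivable (period_jump c) (pt x y) w by exact: diff_derivable dj.
  by apply: etrans (deriveD d1 d2) _; rewrite derive_id.
have e3 : 'D_w (fcoord phi \o shift) (pt x y) =
    'd (fcoord phi) (shift (pt x y)) (w + ey *m cmx (m + 1) (period_slope w)).
  apply: etrans (deriveE w dc) _.
  apply: etrans (congr1 (fun g => g w) (diff_comp ds dA)) _.
  congr ('d _ _ _); apply: etrans e2; exact: (esym (deriveE w ds)).
apply: etrans e1 _; apply: etrans e3 _; rewrite linearD.
have e4 : 'd (fcoord phi) (shift (pt x y)) w = 'D_w (fcoord phi) (pt x (y + c x)).
  by rewrite -shift_pt; exact: (esym (deriveE w dA)).
have e5 : 'd (fcoord phi) (shift (pt x y)) (ey *m cmx (m + 1) (period_slope w)) =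
    'D_ey (fcoord phi) (pt x (y + c x)) *m cmx (m + 1) (period_slope w).
  rewrite -shift_pt; apply: etrans (esym (deriveE _ dA)) _.
  exact: (cr_on_cmx _ (fcoord_smooth mphi) (fcoord_cr mphi) Us).
exact: (f_equal2 +%R e4 e5).
Qed.

Lemma dbar_ratio_period u y a a' : dbar_ratio x u y a ->
  dbar_ratio x u (y + c x) a' ->
  a = a' + (period_slope (hx u) + 'i%C * period_slope (hx u *m J)).
Proof.
move=> ra ra'; have [phi fphi dphi] := fol_chart x y; have mphi := max_of_fol fphi.
have Up : fdom phi (pt x y) by apply/fdom_pt.
have dphi' : cdom phi (F x (y + c x)) by rewrite (nbhs_singleton cper).
have Us : fdom phi (pt x (y + c x)) by apply/fdom_pt.
have := congr1 (ccoord (lastc m)) (ra _ fphi dphi); rewrite ccoord_cmx => e1.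
have := congr1 (ccoord (lastc m)) (ra' _ fphi dphi'); rewrite ccoord_cmx => e2.
have k0 := fcoord_neq0_last fphi Us.
have Dw w : ccoord (lastc m) ('D_w (fcoord phi) (pt x y)) =
    ccoord (lastc m) ('D_w (fcoord phi) (pt x (y + c x))) +
    period_slope w * ccoord (lastc m) ('D_ey (fcoord phi) (pt x (y + c x))).
  apply: etrans (congr1 (ccoord (lastc m)) (fcoord_period_derive w mphi Up)) _.
  by rewrite ccoordD ccoord_cmx.
(* [c] does not depend on y, so dF/dy has the same leafwise coordinate at y and at y + c x, and it
   cancels from both ratios. *)
have De := Dw ey; rewrite period_slope_ey ?mul0r ?addr0 in De; last first.
  by move=> i; rewrite ccoord_pt_l mxE.
have c1 := ccoord_dbar phi (hx u) (pt x y) (lastc m).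
have c2 := ccoord_dbar phi (hx u) (pt x (y + c x)) (lastc m).
have aux (s1 s2 A1 A2 B1 B2 d1 d2 k1 k2 : R[i]) :
    A1 = A2 + s1 * k2 -> B1 = B2 + s2 * k2 -> k1 = k2 -> d1 = a * k1 ->
    d2 = a' * k2 -> d1 = A1 + 'i%C * B1 -> d2 = A2 + 'i%C * B2 -> k2 != 0 ->
    a = a' + (s1 + 'i%C * s2).
  move=> h1 h2 h3 h4 h5 h6 h7 k20; apply: (mulIf k20).
  by rewrite -[in LHS]h3 -h4 h6 h1 h2 mulrDl -h5 h7; ring.
exact: (aux _ _ _ _ _ _ _ _ _ _ (Dw (hx u)) (Dw (hx u *m J)) De e1 e2 c1 c2 k0).
Qed.

End PeriodDerivative.

(** * The period groups: cocompactness, uniform separation, closedness *)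

Lemma near_pt x y (A : E -> Prop) : nbhs (pt x y) A ->
  exists2 d : R, 0 < d & forall x' y', `|toR (x' - x)| < d -> cmod (y' - y) < d ->
    A (pt x' y').
Proof.
move=> /nbhs_normP[d /= d0 dA]; exists (d / 4) => [|x' y' xd yd].
  by rewrite divr_gt0.
apply: dA => /=; apply: (@le_lt_trans _ _ (d / 2)); last by lra.
rewrite distrC; apply: norm_ccoord => [|j]; first by rewrite divr_ge0 // ltW.
rewrite ccoordB; case: (split_ordP j) => i ->.
  rewrite !ccoord_pt_l; have := cmod_ccoord i (toR (x' - x)); rewrite ccoord_toR !mxE.
  by move=> h; apply: le_trans h _; lra.
by rewrite ord1 !ccoord_pt_r; apply: le_trans (ltW yd) _; lra.
Qed.

Lemma near_toR x (d : R) : 0 < d -> \forall x' \near x, `|toR (x' - x)| < d.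
Proof.
move=> d0; apply/nbhs_toR.
apply/(@nbhs_normP R _ (toR x) (fun e => `|toR (ofR e - x)| < d)); exists d => // e /=.
by rewrite toRB ofRK distrC.
Qed.

(** The leafwise coordinate of a foliated chart serves as the local coordinate in which the covering
    is holomorphic and immersive. *)
Lemma leaf_periods x : B x -> compact (leaf fol (iota x)) ->
  exists2 N : R, 0 < N &
    forall y, exists2 c : Cx R, period_group (F x) c & cmod (y - c) <= N.
Proof.
move=> Bx cL; have [[cov _] _ _] := hF Bx.
apply: (@compact_covering_periods R (leafspace fol) (F x) _ cov) => // y z e.
have [phi fphi dphi] := fol_chart x y; have mphi := max_of_fol fphi.
have dphi' : cdom phi (F x z) by move: dphi; rewrite e.
have sG := fcoord_smooth mphi; have crG := fcoord_cr mphi.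
have Uy : fdom phi (pt x y) by apply/fdom_pt.
have Uz : fdom phi (pt x z) by apply/fdom_pt.
have ptE w : pt x w = pt x 0 + ey *m cmx (m + 1) w by rewrite -pt_ey add0r.
have uE : (fun q : X => phi q 0 (lastc m) : R[i]) \o F x =
    (fun w => ccoord (lastc m) (fcoord phi (pt x 0 + ey *m cmx (m + 1) w))).
  by apply/funext => w; rewrite -ptE fcoordE ccoord_toR fam_pt.
exists (fun q : X => phi q 0 (lastc m) : R[i]),
  (ccoord (lastc m) ('D_ey (fcoord phi) (pt x y))),
  (ccoord (lastc m) ('D_ey (fcoord phi) (pt x z))); split.
- exact: fcoord_neq0_last.
- exact: fcoord_neq0_last.
- rewrite uE (ptE y); apply: (cr_on_taylor2 (@fdom_open phi) (lastc m) sG crG).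
  by rewrite -ptE.
- rewrite uE (ptE z); apply: (cr_on_taylor2 (@fdom_open phi) (lastc m) sG crG).
  by rewrite -ptE.
Qed.

Lemma periodB x (c c' : R[i]) : period_group (F x) c -> period_group (F x) c' ->
  period_group (F x) (c - c' : Cx R).
Proof.
move=> pc pc' y; have := pc' (y + (c - c')); rewrite -addrA subrK => <-.
exact: pc.
Qed.

Lemma Re_conj_mul_gt0 (b c b' : R[i]) : c != 0 -> cmod (b' - b) < cmod b / 2 ->
  0 < complex.Re ((b * c)^*%C * (c * b')).
Proof.
move=> c0 bb; have c1 : 0 < cmod c by rewrite cmod_gt0.
have b1 : 0 < cmod b by have := le_lt_trans (cmod_ge0 _) bb; lra.
have -> : (b * c)^*%C * (c * b') = (b * c)^*%C * (b * c) + (b * c)^*%C * (c * (b' - b)).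
  by ring.
rewrite raddfD /=.
have -> : complex.Re ((b * c)^*%C * (b * c)) = cmod (b * c) ^+ 2.
  by rewrite cmod_sqr; case: (b * c) => p q /=; ring.
have : `|complex.Re ((b * c)^*%C * (c * (b' - b)))| <=
    cmod b * cmod c * (cmod c * cmod (b' - b)).
  apply: le_trans (Re_le_cmod _) _; rewrite cmodM.
  have -> : cmod (b * c)^*%C = cmod (b * c) by rewrite /cmod normcJ.
  by rewrite !cmodM.
rewrite cmodM ler_norml => /andP[h _].
move: (cmod b) (cmod c) (cmod (b' - b)) (complex.Re _) b1 c1 bb h => p q r w p0 q0 pr h.
have pq : 0 < p * q * q by rewrite !mulr_gt0.
have : p * q * q * r < p * q * q * (p / 2) by rewrite ltr_pM2l.
have e1 : p * q * (q * r) = p * q * q * r by ring.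
have e2 : (p * q) ^+ 2 = 2 * (p * q * q * (p / 2)) by field.
have : 0 < (p * q) ^+ 2 by rewrite exprn_gt0 // mulr_gt0.
rewrite e1 in h; rewrite e2.
move: (p * q * q * r) (p * q * q * (p / 2)) h => a d; lra.
Qed.

(** Uniformly in x', dF/dy stays close to its value b near (x, 0). For a small nonzero period c, the
    real part of conj(b c) times the leafwise coordinate would have positive derivative along the
    segment from 0 to c, yet equal values at both ends. The factor conj(b c) brings the question
    within reach of the real mean value theorem. *)
Lemma period_gap x : B x -> exists2 d : R, 0 < d &
  \forall x' \near x, forall c : R[i], period_group (F x') c -> cmod c < d -> c = 0.
Proof.
move=> Bx; have [phi fphi dphi] := fol_chart x 0; have mphi := max_of_fol fphi.
have Up : fdom phi (pt x 0) by apply/fdom_pt.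
have sG := fcoord_smooth mphi; have crG := fcoord_cr mphi.
pose b := ccoord (lastc m) ('D_ey (fcoord phi) (pt x 0)).
have b0 : b != 0 by exact: fcoord_neq0_last.
have bp : 0 < cmod b by rewrite cmod_gt0.
pose P (q : E) := fdom phi q /\ cmod (ccoord (lastc m) ('D_ey (fcoord phi) q) - b) < cmod b / 2.
have nP : nbhs (pt x 0) P.
  apply: filterI; first exact: near_fdom.
  have b4 : 0 < cmod b / 4 by rewrite divr_gt0.
  have := csmooth_continuous (csmooth_derive ey sG) Up => /cvgrPdistC_lt/(_ _ b4).
  apply: filterS => q h; rewrite -ccoordB; apply: le_lt_trans (cmod_ccoord _ _) _.
  lra.
have [d d0 dP] := near_pt nP.
exists d => //; apply: filterS (near_toR x d0) => x' xd c pc cd.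
apply/eqP/negPn/negP => c0.
pose u : E := ey *m cmx (m + 1) c.
pose be := (b * c)^*%C.
have seg (s : R) : pt x' 0 + s *: u = pt x' ((s%:C)%C * c).
  rewrite -[(s%:C)%C * c]add0r pt_ey; congr (_ + _).
  by apply: ccoord_inj => j; rewrite ccoordZ !ccoord_cmx mulrA.
have Ps (s : R) : 0 <= s <= 1 -> P (pt x' 0 + s *: u).
  move=> /andP[s0 s1]; rewrite seg; apply: dP => //.
  rewrite subr0 cmodM cmodC ger0_norm //; apply: le_lt_trans cd.
  by rewrite ler_piMl ?cmod_ge0.
pose H (q : E) := fcoord phi q *m cmx (m + 1) be.
pose l := lshift (m + 1) (lastc m).
have dG q : P q -> differentiable (fcoord phi) q by move=> [Uq _]; exact: fcoord_differentiable.
have dH q : P q -> differentiable H q /\ 'D_u H q = 'D_u (fcoord phi) q *m cmx (m + 1) be.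
  by move=> Pq; exact: derive_mulmxr (dG _ Pq).
have [s s01|s s01] := @MVT_line R _ (fun q => H q 0 l) (pt x' 0) u 1 ltr01.
  have [d1 _] := dH _ (Ps _ s01); apply: diff_derivable.
  by have [] := derive_coord u l d1.
rewrite scale1r mul1r.
have -> : H (pt x' 0 + u) = H (pt x' 0).
  have -> : pt x' 0 + u = pt x' (0 + c) by rewrite pt_ey.
  by rewrite /H !fcoordE !fam_pt pc.
rewrite subrr => /esym.
have s01' : 0 <= s <= 1 by case/andP: s01 => /ltW -> /ltW.
have Pq := Ps _ s01'; have [Uq bq] := Pq; have [d1 d2] := dH _ Pq.
have [_ ->] := derive_coord u l d1; apply/eqP; rewrite gt_eqF //.
have -> : 'D_u H (pt x' 0 + s *: u) 0 l = complex.Re (be * (c *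
    ccoord (lastc m) ('D_ey (fcoord phi) (pt x' 0 + s *: u)))).
  apply: etrans (_ : complex.Re (ccoord (lastc m) ('D_u H (pt x' 0 + s *: u))) = _) _ => //.
  rewrite d2 ccoord_cmx; congr (complex.Re (_ * _)).
  apply: etrans (congr1 (ccoord (lastc m)) (cr_on_cmx c sG crG Uq)) _.
  exact: ccoord_cmx.
exact: Re_conj_mul_gt0.
Qed.

(** As X is Hausdorff, F x (y + c) and F x y have disjoint neighbourhoods, so c' is not a period at
    x' for (c', x') close to (c, x); compactness of [Q] makes this uniform in c. *)
Lemma period_closed x (Q : set (Cx R)) : B x -> compact Q ->
  (forall c, Q c -> ~ period_group (F x) c) ->
  \forall x' \near x, forall c, Q c -> ~ period_group (F x') c.
Proof.
move=> Bx /compact_near_coveringP cQ nQ.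
apply: (cQ _ (nbhs x) (fun x' c => ~ period_group (F x') c)) => c Qc.
have [y ny] : exists y, F x (y + c) <> F x y by apply/existsNP; exact: nQ.
have cf y' : {for pt x y', continuous fam} by apply: fam_continuous; rewrite xof_pt.
have [A1 [A2 [nA1 nA2 A12]]] : exists A1 A2 : set X,
    [/\ nbhs (F x (y + c)) A1, nbhs (F x y) A2 & forall r : X, A1 r -> A2 r -> False].
  have : ~ cluster (nbhs (F x (y + c))) (F x y) by move=> /(cm_hausdorff M).
  move=> /existsNP[A1 /existsNP[A2 /not_implyP[nA1 /not_implyP[nA2 A12]]]].
  by exists A1, A2; split=> // r r1 r2; apply: A12; exists r.
have n1 : nbhs (pt x (y + c)) (fun q => A1 (fam q)) by apply: cf; rewrite fam_pt.
have n2 : nbhs (pt x y) (fun q => A2 (fam q)) by apply: cf; rewrite fam_pt.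
have [d1 d10 d1P] := near_pt n1; have [d2 d20 d2P] := near_pt n2.
exists ([set c' : Cx R | cmod (c' - c) < d1],
    [set x' | `|toR (x' - x)| < d1 /\ `|toR (x' - x)| < d2]) => /=.
  split; first by apply/nbhs_cmodP; exact: cnear_disc.
  exact: filterI (near_toR x d10) (near_toR x d20).
move=> [c' x'] /= [cc' [xd1 xd2]] pc.
apply: (A12 (F x' y)).
  rewrite -pc -fam_pt; apply: d1P => //.
  by rewrite opprD addrACA subrr add0r.
by rewrite -fam_pt; apply: d2P => //; rewrite subrr cmod0.
Qed.

Lemma fcoord_dbar_continuous phi v p : max_atlas M phi -> fdom phi p ->
  {for p, continuous (dbar phi v)}.
Proof.
move=> mphi Up; have sG := fcoord_smooth mphi.
have c1 := csmooth_continuous (csmooth_derive v sG) Up.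
have c2 := csmooth_continuous (csmooth_derive (v *m J) sG) Up.
apply: (@continuousD R E E ('D_v (fcoord phi))
  (fun q => 'D_(v *m J) (fcoord phi) q *m J) p c1).
apply: (@continuous_comp _ _ _ ('D_(v *m J) (fcoord phi)) (mulmxr J) p c2).
exact: mulmxr_continuous.
Qed.

Hypothesis hcompact : forall x, B x -> compact (leaf fol (iota x)).

(** [A] is an arbitrary neighbourhood, so the points x1 are dense. The selection takes place in
    R^(2m), inside the part of [A] where one gap [d] holds for all parameters. *)
Lemma independent_periods_dense x0 (A : set (Cvec R m)) : B x0 -> nbhs x0 A ->
  exists x1 (c1 c2 : Cvec R m -> R[i]) (N : R), [/\ B x1 /\ A x1, 0 < N,
    cmod (((4 * N)%:C)%C - c1 x1) <= N /\ cmod ('i%C * ((4 * N)%:C)%C - c2 x1) <= N,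
    (\forall x' \near x1, period_group (F x') (c1 x')) /\
    (\forall x' \near x1, period_group (F x') (c2 x')) &
    {for x1, continuous (c1 : Cvec R m -> Cx R)} /\
    {for x1, continuous (c2 : Cvec R m -> Cx R)}].
Proof.
move=> Bx0 nA; have [d d0 gap] := period_gap Bx0.
pose O' := [set x | [/\ B x, A x &
  forall c : R[i], period_group (F x) c -> cmod c < d -> c = 0]].
have nO' : nbhs x0 O'.
  by apply: filterS3 (nbhs_unit_ball Bx0) nA gap => x' b1 b2 b3; split.
pose P (e : 'rV[R]_(m + m)) : set R[i] := period_group (F (ofR e)).
have push (e : 'rV[R]_(m + m)) (S : set (Cvec R m)) : nbhs (ofR e) S ->
    nbhs e (fun e' => S (ofR e')).
  by move=> /nbhs_toR; rewrite ofRK.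
have nO : nbhs (toR x0) (fun e => O' (ofR e)) by apply: push; rewrite toRK.
have [|||e1 [c1 [c2 [N [[B1 A1 gap1] N0 cN nP cP]]]]] :=
    @independent_selection R 'rV[R]_(m + m) P _ _ d nO d0.
- move=> e c c' [_ _ g] pc pc' cc; apply/eqP; rewrite -subr_eq0; apply/eqP.
  by apply: g => //; exact: periodB.
- by move=> e Q [Be _ _] cQ nQ; exact: (push e _ (period_closed Be cQ nQ)).
- by move=> e [Be _ _]; exact: leaf_periods (hcompact Be).
have pull (S : 'rV[R]_(m + m) -> Prop) : (\forall e \near e1, S e) ->
    \forall x' \near ofR e1, S (toR x').
  move=> nS; apply/nbhs_toR; rewrite ofRK; apply: filterS nS => e.
  by rewrite ofRK.
exists (ofR e1), (c1 \o (@toR R m)), (c2 \o (@toR R m)), N; split=> //=.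
- by rewrite ofRK.
- by split; apply: filterS (pull _ nP) => x' []; rewrite /P toRK.
- by split; apply/continuous_cmodP => eps eps0; rewrite /= ofRK;
    apply: filterS (pull _ (cP _ eps0)) => x' [].
Qed.

Lemma independent_periods_dbar_ratio x (c1 c2 : Cvec R m -> R[i]) (N : R) u y : B x ->
  0 < N -> cmod (((4 * N)%:C)%C - c1 x) <= N -> cmod ('i%C * ((4 * N)%:C)%C - c2 x) <= N ->
  (\forall x' \near x, period_group (F x') (c1 x')) ->
  (\forall x' \near x, period_group (F x') (c2 x')) ->
  {for x, continuous (c1 : Cvec R m -> Cx R)} ->
  {for x, continuous (c2 : Cvec R m -> Cx R)} -> dbar_ratio x u y 0.
Proof.
move=> Bx N0 h1 h2 p1 p2 cc1 cc2.
have [al [k [ra ta kc ak]]] := dbar_ratio_function u Bx.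
have [K K0 dec] := independent_coords N0 h1 h2.
have q1 z := dbar_ratio_period Bx cc1 p1 (ra z) (ra (z + c1 x)).
have q2 z := dbar_ratio_period Bx cc2 p2 (ra z) (ra (z + c2 x)).
have ac z : ccts al z by exact: taylor2_continuous (ta z).
have [C alC] := quasi_periodic_linear_growth ac q1 q2 K0 dec.
by have := ra y; rewrite (entire_linear_growth ta kc ak alC).
Qed.

Lemma dbar_eq0 phi x u y : fol_atlas fol phi -> B x -> cdom phi (F x y) ->
  dbar phi (hx u) (pt x y) = 0.
Proof.
move=> fphi Bx dphi; have mphi := max_of_fol fphi.
have Up : fdom phi (pt x y) by apply/fdom_pt.
apply/eqP/negPn/negP => n0; have e0 : 0 < `|dbar phi (hx u) (pt x y)| by rewrite normr_gt0.
have nz : \forall q \near pt x y, fdom phi q /\ dbar phi (hx u) q <> 0.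
  have /cvgrPdist_lt/(_ _ e0) := @fcoord_dbar_continuous phi (hx u) _ mphi Up.
  apply: filterS2 (near_fdom Up) => q Uq h; split=> // q0.
  by move: h; rewrite q0 subr0 ltxx.
have [d d0 dP] := near_pt nz.
have [x1 [c1 [c2 [N [[Bx1 xd] N0 [h1 h2] [p1 p2] [cc1 cc2]]]]]] :=
  independent_periods_dense Bx (near_toR x d0).
have [|Up1] := dP x1 y xd; first by rewrite subrr cmod0.
apply; have [_ dphi1] := (fdom_pt _ _ _).1 Up1.
rewrite (independent_periods_dbar_ratio u Bx1 N0 h1 h2 p1 p2 cc1 cc2 fphi dphi1).
by rewrite cmx0.
Qed.

(** * The Cauchy-Riemann equation for a family of periods *)

Section HolomorphicPeriod.
Variables (c : Cvec R m -> R[i]) (x : Cvec R m).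
Hypothesis Bx : B x.
Hypothesis cc : {for x, continuous (c : Cvec R m -> Cx R)}.
Hypothesis cper : \forall x' \near x, period_group (F x') (c x').

Lemma period_slopeE (w : E) :
  period_slope c x w = ccoord (lastc m) ('d (period_jump c) (pt x 0) w).
Proof. by rewrite /period_slope (deriveE w (period_jump_differentiable Bx cc cper 0)). Qed.

Lemma period_slope_hxJ u : period_slope c x (hx u *m J) = 'i%C * period_slope c x (hx u).
Proof.
have ra y : dbar_ratio x u y 0.
  by move=> phi fphi dphi; rewrite dbar_eq0 // cmx0.
have := dbar_ratio_period Bx cc cper (ra 0) (ra (0 + c x)).
rewrite add0r => /(congr1 ( *%R 'i%C)); rewrite mulr0 mulrDr mulrA -expr2 sqr_i mulN1r.
by move=> /esym/eqP; rewrite subr_eq0 => /eqP.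
Qed.

(** A vector splits into a part along x, where the Cauchy-Riemann equation is known, and a part
    along y, where the slope vanishes. *)
Lemma period_slopeJ (w : E) : period_slope c x (w *m J) = 'i%C * period_slope c x w.
Proof.
pose w1 := hx (xof w); pose w2 : E := pt 0 (yof w).
have -> : w = w1 + w2 by rewrite -[LHS]pt_of -ptD addr0 add0r.
have w20 i : ccoord (lshift 1 i) w2 = 0 by rewrite ccoord_pt_l mxE.
have w2J i : ccoord (lshift 1 i) (w2 *m J) = 0 by rewrite ccoordJ w20 mulr0.
have sD (a b : E) : period_slope c x (a + b) = period_slope c x a + period_slope c x b.
  by rewrite !period_slopeE linearD ccoordD.
have s0 (a : E) : (forall i, ccoord (lshift 1 i) a = 0) -> period_slope c x a = 0.
  by move=> a0; apply: period_slope_ey.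
apply: etrans (congr1 (period_slope c x) (mulmxDl w1 w2 J)) _.
apply: etrans (sD _ _) _.
apply: etrans (f_equal2 +%R (period_slope_hxJ _) (s0 _ w2J)) _.
apply: etrans (addr0 _) (congr1 ( *%R 'i%C) (esym _)).
by apply: etrans (sD _ _) _; apply: etrans (f_equal2 +%R erefl (s0 _ w20)) (addr0 _).
Qed.

(** [c] is the last coordinate of the jump along the slice y = 0, and the jump, as a map of C^(m+1),
    is complex differentiable by [realify_differentiable]. *)
Lemma period_differentiable : differentiable (c : Cvec R m -> Cx R) x.
Proof.
pose f (z : Cvec R (m + 1)) : Cvec R (m + 1) := ofR (period_jump c (toR z)).
have rf : realify f = period_jump c by apply/funext => e; rewrite /realify /f !ofRK.
have dj := period_jump_differentiable Bx cc cper 0.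
pose z0 : Cvec R (m + 1) := ofR (pt x 0).
have df : differentiable f z0.
  have dE (e : E) : 'd (period_jump c) (pt x 0) e =
      ey *m cmx (m + 1) (period_slope c x e).
    exact: etrans (esym (deriveE _ dj)) (derive_period_jump Bx cc cper _ _).
  have cmxJ (s : R[i]) : ey *m cmx (m + 1) ('i%C * s) = ey *m cmx (m + 1) s *m J.
    by apply: ccoord_inj => j; rewrite ccoordJ !ccoord_cmx [RHS]mulrA.
  apply: realify_differentiable; rewrite rf ofRK; first exact: dj.
  move=> e; apply: etrans (dE _) _.
  apply: etrans (congr1 (fun s => ey *m cmx (m + 1) s) (period_slopeJ e)) _.
  apply: etrans (cmxJ _) _.
  exact: (congr1 (mulmx^~ J) (esym (dE e))).
pose A (x' : Cvec R m) : Cvec R (m + 1) := ofR (pt x' 0).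
have AE u j : A u 0 j = ccoord j (pt u 0) by exact: ofR_ccoord.
have Al : linear A.
  move=> a u v; apply/rowP => j.
  apply: etrans (_ : _ = a * A u 0 j + A v 0 j) _; last by rewrite !mxE.
  rewrite !AE; case: (split_ordP j) => i ->; first by rewrite !ccoord_pt_l !mxE.
  by rewrite ord1 !ccoord_pt_r mulr0 addr0.
pose Ap : {linear Cvec R m -> Cvec R (m + 1)} :=
  HB.pack A (GRing.isLinear.Build _ _ _ _ A Al).
have Ac : continuous Ap.
  move=> u S /nbhs_toR; rewrite ofRK => /near_pt[d d0 dS].
  by apply: filterS (near_toR u d0) => u' h; apply: dS => //; rewrite subrr cmod0.
have [dfA _] := @differentiable_comp_linear _ _ _ _ Ap f x Ac df.
have di : differentiable (@id (Cx R)) ((f (A x)) 0 (lastc m)) by [].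
have [dl _] := differentiable_last_coord di.
have -> : (c : Cvec R m -> Cx R) =
    (fun w : Cvec R (m + 1) => id (w 0 (lastc m)) : Cx R) \o (f \o Ap).
  apply/funext => x'; rewrite /= /f /A ofRK ofR_ccoord.
  by rewrite period_jump_last xof_pt.
exact: differentiable_comp dfA dl.
Qed.

End HolomorphicPeriod.

End Geometry.

Theorem lemma3p2 (R : realType) (m : nat) (X : topologicalType)
    (M : complex_manifold R X (m + 1)) (fol : foliation M)
    (hX : kahler M \/ (m + 1 = 2)%N)
    (hpar : parabolic_leaves fol)
    (iota : Cvec R m -> X) (hD : transverse_disk fol iota)
    (hcompact : forall x, unit_ball R m x -> compact (leaf fol (iota x)))
    (t : Cvec R m -> chart R X (m + 1) -> Cvec R (m + 1))
    (ht : leaf_trivialization fol iota t)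
    (F : Cvec R m -> Cx R -> X)
    (hF : forall x, unit_ball R m x ->
       [/\ leaf_uniformization fol (iota x) (F x),
           F x 0 = iota x
         & forall phi, max_atlas M phi -> cdom phi (iota x) ->
             'd (phi \o F x) (0 : Cx R) (1 : Cx R) = t x phi])
    (himm : smooth_immersion M (ball_times_C R m) (family_map F))
    (gamma : Cvec R m -> Cx R)
    (hgamma : forall x, unit_ball R m x -> {for x, continuous gamma})
    (hG : forall x, unit_ball R m x -> period_group (F x) (gamma x)) :
  forall x, unit_ball R m x -> differentiable gamma x.
Proof.
move=> x Bx; apply: (period_differentiable hD ht hF himm hcompact Bx (hgamma x Bx)).
by apply: filterS (nbhs_unit_ball Bx) => x' /hG.
Qed.
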